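(* Let $Q$ be a natural join query with hypergraph $\mathcal H=(\mathcal V,\mathcal E)$, let $I$ be a database instance for $Q$ whose largest relation has size $N$, and let $D=Q(I)$. Let $V\subseteq\mathcal V$ be the set of features, $C\subseteq V$ the categorical ones, $y$ the continuous response variable, and let $h_1,\dots,h_m$ be feature functions with categorical variable sets $C_1,\dots,C_m$. For $i,j\in[m]$ let $$\boldsymbol\sigma_{ij}=\frac1{|D|}\sum_{(\mathbf x,y)\in D}h_i(\mathbf x)\otimes h_j(\mathbf x),\qquad \mathbf c_j=\frac1{|D|}\sum_{(\mathbf x,y)\in D}y\,h_j(\mathbf x).$$ Then the tensors $\boldsymbol\sigma_{ij}$ and $\mathbf c_j$ can be sparsely represented by functional aggregate queries (FAQs) with group-by (free) variables $C_i\cup C_j$ and $C_j$, respectively. They can all be computed in time $$O\Big(|\mathcal V|^2\cdot|\mathcal E|\cdot\sum_{i,j\in[m]}\big(N^{\mathrm{faqw}(i,j)}+|\boldsymbol\sigma_{ij}|\big)\cdot\log N\Big),$$ where $|\boldsymbol\sigma_{ij}|$ is the number of tuples in the sparse representation of $\boldsymbol\sigma_{ij}$ and $\mathrm{faqw}(i,j)$ is the FAQ-width of the FAQ expressing $\boldsymbol\sigma_{ij}$.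
   Context: Query: $\mathcal V$ is the set of variables of $Q$ and $\mathcal E$ has one hyperedge $F$ per relation $R_F$ of $Q$, namely its set of variables; $D=Q(I)$ is the set of tuples over $\mathcal V$ whose projection on each $F\in\mathcal E$ lies in $R_F$. For a tuple of $D$, $\mathbf x=(\mathbf x_f)_{f\in V}$, where $\mathbf x_f$ is the tuple's real value $x_f$ if $f$ is continuous and the one-hot indicator vector of the tuple's $f$-value (over the active domain of $f$) if $f$ is categorical; $y$ is the tuple's value of the response variable. Feature functions: $h_j(\mathbf x)=\prod_{f\in V_j\setminus C_j}x_f^{a_j(f)}\cdot\bigotimes_{f\in C_j}\mathbf x_f$, where $a_j\in\mathbb N^V$, $V_j=\{f\in V:a_j(f)>0\}$, $C_j=C\cap V_j$. FAQ: here, a sum-product query over the relations of $Q$, i.e. a function of free variables $L\subseteq\mathcal V$ of the form $\varphi(L)=\sum_{x_f:\,f\in\mathcal V\setminus L}\ \prod(\text{factors depending on single variables})\cdot\prod_{F\in\mathcal E}\delta_{\pi_F(\mathbf x)\in R_F}$ (up to a normalizing constant $1/|D|$), where $\delta$ is the 0/1 indicator. A sparse representation of a tensor is a relation listing the combinations of values of the free variables occurring in $D$ together with the associated tensor value (all other tensor entries are zero, and repeated occurrences of a categorical variable are identified). FAQ-width: For a hypergraph $\mathcal H=(\mathcal V,\mathcal E)$ and $B\subseteq\mathcal V$, $\rho^*_{\mathcal H}(B)$ is the minimum of $\sum_{S\in\mathcal E}\lambda_S$ over $\lambda_S\ge0$ with $\sum_{S\ni v}\lambda_S\ge1$ for all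 $v\in B$. For an ordering $\sigma=(v_1,\dots,v_\nu)$ of $\mathcal V$, the elimination sets are defined from the last vertex backwards: $U_\nu^\sigma$ is the union of all hyperedges containing $v_\nu$; then $v_\nu$ and all hyperedges containing it are removed, the hyperedge $U_\nu^\sigma\setminus\{v_\nu\}$ is added, and $U^\sigma_{\nu-1},\dots,U^\sigma_1$ are defined recursively on the resulting hypergraph. Put $\mathrm{faqw}(\sigma)=\max_j\rho^*_{\mathcal H}(U_j^\sigma)$ (with $\rho^*$ in the original hypergraph). The FAQ-width of a sum-product query with free variables $L$ is the minimum of $\mathrm{faqw}(\sigma)$ over all orderings $\sigma$ of $\mathcal V$ that list all variables of $L$ before all other variables. Thus $\mathrm{faqw}(i,j)$ is this quantity for $\mathcal H$ with $L=C_i\cup C_j$. Running time is in the RAM model with unit-cost arithmetic. *)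

(* Defs.v *)
From HB Require Import structures.
From mathcomp Require Import all_boot all_order all_algebra finmap.
From mathcomp Require Import all_classical all_reals all_analysis.

Set Implicit Arguments.
Unset Strict Implicit.
Unset Printing Implicit Defensive.

Import Order.TTheory GRing.Theory Num.Theory.

Local Open Scope classical_set_scope.
Local Open Scope ring_scope.

(** * Natural join queries *)

Section Query.
Variables (R : realType) (X : finType).

(* Every attribute takes values in R.  For a categorical attribute (and for an
   attribute that only serves as a join key) the real number is a mere label:
   the join and the tensors only test it for equality. *)
Definition tuple_over (F : {set X}) := {ffun {x : X | x \in F} -> R}.
Definition full_tuple := {ffun X -> R}.

Definition proj_on (F : {set X}) (t : full_tuple) : tuple_over F :=
  [ffun x => t (val x)].

(* The relation of a hyperedge F is duplicate-free and is listed in an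
   arbitrary order; the value of [rel] at a set that is not a hyperedge is
   irrelevant. *)
Record instance (E : {set {set X}}) := Instance {
  rel :> forall F : {set X}, seq (tuple_over F);
  rel_uniq : forall F, F \in E -> uniq (rel F) }.

Variable E : {set {set X}}.

Definition max_size (I : instance E) : nat := \max_(F in E) size (I F).

Definition join (I : instance E) : set full_tuple :=
  [set t | forall F, F \in E -> proj_on F t \in I F].

Definition join_size (I : instance E) : nat := #|` fset_set (join I)|.

(** * Tensors and feature functions *)

(* A tensor with one mode per variable of S, given by its entries.  The mode of
   f is indexed by all labels instead of the active domain of f, which amounts
   to an extension by zero. *)
Definition tensor (S : {set X}) := tuple_over S -> R.

Definition one_hot (c : R) : R -> R := fun v => (v == c)%:R.

Definition tensor_of_vectors (S : {set X}) (w : X -> R -> R) : tensor S :=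
  fun al => \prod_(f : {x : X | x \in S}) w (val f) (al f).

Definition tensor_prod (S S' : {set X}) (A : tensor S) (B : tensor S') :
    tuple_over S * tuple_over S' -> R :=
  fun p => A p.1 * B p.2.

Definition feat_vars (V : {set X}) (a : X -> nat) : {set X} :=
  [set f in V | (0 < a f)%N].

Definition feat_cats (V C : {set X}) (a : X -> nat) : {set X} :=
  C :&: feat_vars V a.

Definition feature_map (V C : {set X}) (a : X -> nat) (t : full_tuple) :
    tensor (feat_cats V C a) :=
  fun al =>
    (\prod_(f in feat_vars V a :\: feat_cats V C a) t f ^+ a f)
    * tensor_of_vectors (fun f => one_hot (t f)) al.
Arguments feature_map : clear implicits.

Definition sigma_tensor (V C : {set X}) (a b : X -> nat) (I : instance E) :
    tuple_over (feat_cats V C a) * tuple_over (feat_cats V C b) -> R :=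
  fun p => (join_size I)%:R^-1
    * \sum_(t \in join I)
        tensor_prod (feature_map V C a t) (feature_map V C b t) p.

Definition c_tensor (V C : {set X}) (y : X) (a : X -> nat) (I : instance E) :
    tensor (feat_cats V C a) :=
  fun al => (join_size I)%:R^-1
    * \sum_(t \in join I) t y * feature_map V C a t al.

(** * Sparse representations and functional aggregate queries *)

Definition table (L : {set X}) := seq (tuple_over L * R).

Definition lists_join (I : instance E) (L : {set X}) (s : table L) : Prop :=
  uniq (unzip1 s) /\
  forall z, z \in unzip1 s <-> exists2 t, join I t & z = proj_on L t.

(* [idx t] is the position of a tensor that corresponds to a tuple t.  When a
   variable indexes two modes, [idx] repeats its value, whereas it occurs only
   once in a key of the table. *)
Definition sparse_rep (I : instance E) (L : {set X}) (T : Type)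
    (idx : full_tuple -> T) (A : T -> R) (s : table L) : Prop :=
  [/\ lists_join I s,
      forall t, join I t -> (proj_on L t, A (idx t)) \in s &
      forall p, A p != 0 -> exists2 t, join I t & p = idx t].

(* The sum over the bound variables is taken over all real values; only
   finitely many terms are nonzero when the hyperedges cover X. *)
Definition faq (I : instance E) (L : {set X}) (g : X -> R -> R)
    (z : tuple_over L) : R :=
  (join_size I)%:R^-1
  * \sum_(t \in [set t : full_tuple | proj_on L t = z])
      (\prod_(f : X) g f (t f)) * \prod_(F in E) (proj_on F t \in I F)%:R.

Definition faq_table (I : instance E) (L : {set X}) (g : X -> R -> R)
    (s : table L) : Prop :=
  lists_join I s /\ forall z v, (z, v) \in s -> v = faq I g z.

(* The query, i.e. g, does not depend on the database instance. *)
Definition represented_by_faq (L : {set X}) (T : Type)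
    (idx : full_tuple -> T) (A : instance E -> T -> R) : Prop :=
  exists g : X -> R -> R, forall I : instance E,
    exists2 s : table L, faq_table I g s & sparse_rep I idx (A I) s.

Definition sigma_idx (S S' : {set X}) (t : full_tuple) :
    tuple_over S * tuple_over S' := (proj_on S t, proj_on S' t).

(** * FAQ-width *)

(* The infimum is the minimum of a linear program (feasible as soon as the
   hyperedges cover B). *)
Definition rho_star (B : {set X}) : R :=
  inf [set w | exists lam : {set X} -> R,
    [/\ forall S, S \in E -> 0 <= lam S,
        forall v, v \in B -> 1 <= \sum_(S in E | v \in S) lam S &
        w = \sum_(S in E) lam S]].

(* [rs] lists the vertices in the order of their elimination, that is, from the
   last one to the first one. *)
Fixpoint elim_sets (H : {set {set X}}) (rs : seq X) : seq {set X} :=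
  if rs is v :: rs' then
    let U := (\bigcup_(F in H | v \in F) F)%SET in
    U :: elim_sets ((U :\ v) |: [set F in H | v \notin F]) rs'
  else [::].

Definition ordering_first (L : {set X}) (o : seq X) : Prop :=
  perm_eq o (enum X) /\
  forall u v, u \in L -> v \notin L -> (index u o < index v o)%N.

Definition faqw_ord (o : seq X) : R :=
  \big[Num.max/0]_(U <- elim_sets E (rev o)) rho_star U.

(* An infimum over a finite nonempty set, hence a minimum. *)
Definition faqw (L : {set X}) : R :=
  inf [set w | exists2 o, ordering_first L o & w = faqw_ord o].

End Query.

Arguments feature_map {R X} V C a t _.
Arguments sigma_tensor {R X E} V C a b I _.
Arguments c_tensor {R X E} V C y a I _.

(** * Real RAM with unit-cost arithmetic *)

(* One bank of cells holds natural numbers (indices, addresses, counters), the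
   other one holds real numbers.  Control is structured instead of being given
   by jumps; such programs are particular jump programs, up to a constant
   factor in the running time. *)

Inductive addr := Dir of nat | Ind of nat.
Inductive nat_op := NAdd | NSub | NMul | NDiv.
Inductive real_op := RAdd | RSub | RMul | RDiv.

Inductive instr :=
| NConst of addr & nat
| NMove of addr & addr
| NArith of nat_op & addr & addr & addr
| RConst of addr & nat
| RMove of addr & addr
| RArith of real_op & addr & addr & addr
| RPow of addr & addr & nat.

Inductive test :=
| NLe of addr & addr
| RLe of addr & addr.

Inductive prog :=
| Skip
| Do of instr
| Seq of prog & prog
| If of test & prog & prog
| While of test & prog.

Section Machine.
Variable R : realType.

Record state := State { nmem : nat -> nat; rmem : nat -> R }.

(* Indirect addresses always go through the bank of natural numbers. *)
Definition loc (s : state) (a : addr) : nat :=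
  match a with Dir k => k | Ind k => nmem s k end.

Definition nget (s : state) (a : addr) : nat := nmem s (loc s a).
Definition rget (s : state) (a : addr) : R := rmem s (loc s a).

Definition nset (s : state) (a : addr) (v : nat) : state :=
  let k := loc s a in
  State (fun b => if b == k then v else nmem s b) (rmem s).
Definition rset (s : state) (a : addr) (v : R) : state :=
  let k := loc s a in
  State (nmem s) (fun b => if b == k then v else rmem s b).

Definition eval_nat_op (o : nat_op) (u v : nat) : nat :=
  match o with
  | NAdd => u + v | NSub => u - v | NMul => u * v | NDiv => u %/ v
  end%N.

Definition eval_real_op (o : real_op) (u v : R) : R :=
  match o with
  | RAdd => u + v | RSub => u - v | RMul => u * v | RDiv => u / v
  end.

(* The destination is the first address. *)
Definition do_instr (i : instr) (s : state) : state :=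
  match i with
  | NConst d k => nset s d k
  | NMove d a => nset s d (nget s a)
  | NArith o d a b => nset s d (eval_nat_op o (nget s a) (nget s b))
  | RConst d k => rset s d k%:R
  | RMove d a => rset s d (rget s a)
  | RArith o d a b => rset s d (eval_real_op o (rget s a) (rget s b))
  | RPow d a k => rset s d (rget s a ^+ k)
  end.

Definition eval_test (c : test) (s : state) : bool :=
  match c with
  | NLe a b => (nget s a <= nget s b)%N
  | RLe a b => rget s a <= rget s b
  end.

(* [exec p s n s']: from state s, program p halts in state s' after n steps,
   each instruction and each evaluation of a test being one step. *)
Inductive exec : prog -> state -> nat -> state -> Prop :=
| ExecSkip s : exec Skip s 0 s
| ExecDo i s : exec (Do i) s 1 (do_instr i s)
| ExecSeq p q s n s' n' s'' :
    exec p s n s' -> exec q s' n' s'' -> exec (Seq p q) s (n + n') s''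
| ExecIf c p q s n s' :
    exec (if eval_test c s then p else q) s n s' -> exec (If c p q) s n.+1 s'
| ExecWhileStop c p s : ~~ eval_test c s -> exec (While c p) s 1 s
| ExecWhileLoop c p s n s' n' s'' :
    eval_test c s -> exec p s n s' -> exec (While c p) s' n' s'' ->
    exec (While c p) s (n + n').+1 s''.

Variables (X : finType) (E : {set {set X}}).

Definition row_of (F : {set X}) (t : tuple_over R F) : seq R :=
  [seq t x | x <- enum {: {x : X | x \in F}}].

(* Input: cell k of the first bank holds the size of the k-th relation, and the
   second bank holds the relations one after the other, row by row; all the
   other cells are 0.  Hyperedges and attributes are in [enum] order. *)
Definition input_state (I : instance R E) : state :=
  State
    (fun k => nth 0%N [seq size (I F) | F <- enum E] k)
    (fun k => nth 0
       (flatten [seq flatten [seq row_of t | t <- I F] | F <- enum E]) k).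

(* Output: table number k starts at the cell of the second bank whose address
   is in cell 2k of the first bank, and its number of rows is in cell 2k+1.  A
   row consists of the values of the key followed by the tensor entry. *)
Definition holds_table (s : state) (k : nat) (L : {set X})
    (tb : table R L) : Prop :=
  nmem s k.*2.+1 = size tb /\
  mkseq (fun c => rmem s (nmem s k.*2 + c)) (size tb * #|L|.+1) =
    flatten [seq rcons (row_of r.1) r.2 | r <- tb].

End Machine.

(* Main.v *)
Require Import Defs.
From HB Require Import structures.
From mathcomp Require Import all_boot all_order all_algebra finmap.
From mathcomp Require Import all_classical all_reals all_analysis.
From mathcomp Require Import zify ring lra.

Set Implicit Arguments.
Unset Strict Implicit.
Unset Printing Implicit Defensive.

Import Order.TTheory GRing.Theory Num.Theory.
Local Open Scope nat_scope.

Notation nm := (seq nat).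

Definition pk (a : nm) : nat := choice.pickle a.

Lemma pk_inj : injective pk.
Proof. exact: (pcan_inj (@choice.pickleK _)). Qed.

Inductive nexp := Nc of nat | Na of nm & nexp | No of nat_op & nexp & nexp.

Notation Nv a := (Na a (Nc 0)).

Inductive bexp := Ble of nexp & nexp | Brle of nm & nexp & nm & nexp.

Inductive cmd :=
| Cskip
| Cn of nm & nexp & nexp
| CRc of nm & nexp & nat
| CRo of real_op & nm & nexp & nm & nexp & nm & nexp
| CRp of nm & nexp & nm & nexp & nat
| Cseq of cmd & cmd
| Cif of bexp & cmd & cmd
| Cfor of nm & nexp & cmd.

Fixpoint nsz (e : nexp) : nat :=
  match e with
  | Nc _ => 1
  | Na _ e => nsz e + 5
  | No _ e1 e2 => nsz e1 + nsz e2 + 1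
  end.

Fixpoint ndp (e : nexp) : nat :=
  match e with
  | Nc _ => 1
  | Na _ e => (ndp e).+1
  | No _ e1 e2 => maxn (ndp e1) (ndp e2).+1
  end.

Lemma ndp_gt0 e : 0 < ndp e.
Proof. by elim: e => //= o e1 IH1 e2 IH2; rewrite leq_max IH1. Qed.

Fixpoint nms (e : nexp) : seq nm :=
  match e with
  | Nc _ => [::]
  | Na a e => a :: nms e
  | No _ e1 e2 => nms e1 ++ nms e2
  end.

Definition bnms (b : bexp) : seq nm :=
  match b with
  | Ble e1 e2 => nms e1 ++ nms e2
  | Brle a i b j => a :: b :: nms i ++ nms j
  end.

Fixpoint cnms (c : cmd) : seq nm :=
  match c with
  | Cskip => [::]
  | Cn a i e => a :: nms i ++ nms e
  | CRc a i _ => a :: nms i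
  | CRo _ a i b j c k => [:: a, b, c & nms i ++ nms j ++ nms k]
  | CRp a i b j _ => [:: a, b & nms i ++ nms j]
  | Cseq c1 c2 => cnms c1 ++ cnms c2
  | Cif b c1 c2 => bnms b ++ cnms c1 ++ cnms c2
  | Cfor x e c => x :: nms e ++ cnms c
  end.

Fixpoint wr (c : cmd) : seq nm :=
  match c with
  | Cskip => [::]
  | Cn a _ _ | CRc a _ _ | CRo _ a _ _ _ _ _ | CRp a _ _ _ _ => [:: a]
  | Cseq c1 c2 | Cif _ c1 c2 => wr c1 ++ wr c2
  | Cfor x _ c => x :: wr c
  end.

Definition bdp (b : bexp) : nat :=
  match b with
  | Ble e1 e2 => maxn (ndp e1) (ndp e2).+1
  | Brle a i b j => maxn (ndp i).+1 (ndp j).+2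
  end.

Fixpoint cdp (c : cmd) : nat :=
  match c with
  | Cskip => 0
  | Cn a i e => maxn (ndp i).+1 (ndp e).+1
  | CRc a i _ => (ndp i).+1
  | CRo _ a i b j c k => maxn (ndp i).+1 (maxn (ndp j).+2 (ndp k).+3)
  | CRp a i b j _ => maxn (ndp i).+1 (ndp j).+2
  | Cseq c1 c2 => maxn (cdp c1) (cdp c2)
  | Cif b c1 c2 => maxn (bdp b) (maxn (cdp c1) (cdp c2))
  | Cfor x e c => maxn (ndp e).+1 (maxn 3 (cdp c).+2)
  end.

Section HighLevel.
Variable R : realType.

Record hst := HSt { na : nm -> nat -> nat; ra : nm -> nat -> R }.

Definition setn (h : hst) (a : nm) (i v : nat) : hst :=
  HSt (fun b j => if (b == a) && (j == i) then v else na h b j) (ra h).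
Definition setr (h : hst) (a : nm) (i : nat) (v : R) : hst :=
  HSt (na h) (fun b j => if (b == a) && (j == i) then v else ra h b j).

Fixpoint evn (h : hst) (e : nexp) : nat :=
  match e with
  | Nc k => k
  | Na a e => na h a (evn h e)
  | No o e1 e2 => eval_nat_op o (evn h e1) (evn h e2)
  end.

Definition evb (h : hst) (b : bexp) : bool :=
  match b with
  | Ble e1 e2 => evn h e1 <= evn h e2
  | Brle a i b j => (ra h a (evn h i) <= ra h b (evn h j))%R
  end.

Fixpoint run (c : cmd) (h : hst) : hst :=
  match c with
  | Cskip => h
  | Cn a i e => setn h a (evn h i) (evn h e)
  | CRc a i k => setr h a (evn h i) k%:R%R
  | CRo o a i b j c k => setr h a (evn h i)
      (eval_real_op o (ra h b (evn h j)) (ra h c (evn h k)))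
  | CRp a i b j k => setr h a (evn h i) (ra h b (evn h j) ^+ k)%R
  | Cseq c1 c2 => run c2 (run c1 h)
  | Cif b c1 c2 => if evb h b then run c1 h else run c2 h
  | Cfor x e c => iteri (evn h e) (fun q h => run c (setn h x 0 q)) h
  end.

Definition bsz (b : bexp) : nat :=
  match b with
  | Ble e1 e2 => nsz e1 + nsz e2
  | Brle a i b j => nsz i + nsz j + 10
  end.

(* The numbers of steps of the compiled commands. *)
Fixpoint cost (c : cmd) (h : hst) : nat :=
  match c with
  | Cskip => 0
  | Cn a i e => nsz i + nsz e + 5
  | CRc a i _ => nsz i + 6
  | CRo _ a i b j c k => nsz i + nsz j + nsz k + 16
  | CRp a i b j _ => nsz i + nsz j + 11
  | Cseq c1 c2 => cost c1 h + cost c2 (run c1 h)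
  | Cif b c1 c2 => bsz b + 1 + (if evb h b then cost c1 h else cost c2 h)
  | Cfor x e c => nsz e + 2 + \sum_(q < evn h e)
      (5 + cost c (setn (iteri q (fun q h => run c (setn h x 0 q)) h) x 0 q))
  end.

Lemma frame (c : cmd) (h : hst) (a : nm) (i : nat) : a \notin wr c ->
  na (run c h) a i = na h a i /\ ra (run c h) a i = ra h a i.
Proof.
elim: c h i => [|b e e'|b e k|o b e b1 e1 b2 e2|b e b1 e1 k|c1 IH1 c2 IH2|b c1 IH1 c2 IH2|x e c IH] h i //=;
  rewrite ?inE //.
1-4: by move=> /negbTE ->.
- rewrite mem_cat negb_or => /andP[n1 n2].
  by have [-> ->] := IH2 (run c1 h) i n2; have [-> ->] := IH1 h i n1.
- rewrite mem_cat negb_or => /andP[n1 n2]; case: evb; [exact: IH1|exact: IH2].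
- rewrite negb_or => /andP[/negbTE nx n].
  elim: (evn h e) => //= q IHq.
  set h' := iteri _ _ _ in IHq *.
  by have [-> ->] := IH (setn h' x 0 q) i n; rewrite /= nx.
Qed.

Section Compile.
Variables (S0 O b0 : nat).

Fixpoint cexp (r : nat) (e : nexp) : prog :=
  match e with
  | Nc k => Do (NConst (Dir r) k)
  | Na a e => Seq (cexp r e) (Seq (Do (NConst (Dir r.+1) S0))
       (Seq (Do (NArith NMul (Dir r) (Dir r) (Dir r.+1)))
       (Seq (Do (NConst (Dir r.+1) (O + pk a)))
       (Seq (Do (NArith NAdd (Dir r) (Dir r) (Dir r.+1)))
            (Do (NMove (Dir r) (Ind r)))))))
  | No o e1 e2 => Seq (cexp r e1) (Seq (cexp r.+1 e2)
       (Do (NArith o (Dir r) (Dir r) (Dir r.+1))))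
  end.

Definition cadr (r : nat) (a : nm) (e : nexp) : prog :=
  Seq (cexp r e) (Seq (Do (NConst (Dir r.+1) S0))
       (Seq (Do (NArith NMul (Dir r) (Dir r) (Dir r.+1)))
       (Seq (Do (NConst (Dir r.+1) (O + pk a)))
            (Do (NArith NAdd (Dir r) (Dir r) (Dir r.+1)))))).

Definition rcadr (r : nat) (a : nm) (e : nexp) : prog :=
  Seq (cexp r e) (Seq (Do (NConst (Dir r.+1) S0))
       (Seq (Do (NArith NMul (Dir r) (Dir r) (Dir r.+1)))
       (Seq (Do (NConst (Dir r.+1) (pk a)))
       (Seq (Do (NArith NAdd (Dir r) (Dir r) (Dir r.+1)))
            (Do (NArith NAdd (Dir r) (Dir r) (Dir b0))))))).

Fixpoint comp (r : nat) (c : cmd) : prog :=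
  match c with
  | Cskip => Skip
  | Cn a i e => Seq (cadr r a i) (Seq (cexp r.+1 e) (Do (NMove (Ind r) (Dir r.+1))))
  | CRc a i k => Seq (rcadr r a i) (Do (RConst (Ind r) k))
  | CRo o a i b j c k => Seq (rcadr r a i) (Seq (rcadr r.+1 b j) (Seq (rcadr r.+2 c k)
      (Do (RArith o (Ind r) (Ind r.+1) (Ind r.+2)))))
  | CRp a i b j k => Seq (rcadr r a i) (Seq (rcadr r.+1 b j)
      (Do (RPow (Ind r) (Ind r.+1) k)))
  | Cseq c1 c2 => Seq (comp r c1) (comp r c2)
  | Cif (Ble e1 e2) c1 c2 => Seq (cexp r e1) (Seq (cexp r.+1 e2)
      (If (NLe (Dir r) (Dir r.+1)) (comp r c1) (comp r c2)))
  | Cif (Brle a i b j) c1 c2 => Seq (rcadr r a i) (Seq (rcadr r.+1 b j)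
      (If (RLe (Ind r) (Ind r.+1)) (comp r c1) (comp r c2)))
  | Cfor x e c => Seq (cexp r.+1 e) (Seq (Do (NConst (Dir r) 1))
      (While (NLe (Dir r) (Dir r.+1))
        (Seq (Do (NConst (Dir r.+2) 1))
        (Seq (Do (NArith NSub (Dir (O + pk x)) (Dir r) (Dir r.+2)))
        (Seq (comp r.+2 c)
        (Seq (Do (NConst (Dir r.+2) 1))
             (Do (NArith NAdd (Dir r) (Dir r) (Dir r.+2)))))))))
  end.

Variable base : nat.

Definition rep (h : hst) (s : state R) : Prop :=
  [/\ forall a i, pk a < S0 -> nmem s (O + (i * S0 + pk a)) = na h a i,
      forall a i, pk a < S0 -> rmem s (base + (i * S0 + pk a)) = ra h a i
    & nmem s b0 = base].

Hypothesis b0O : b0 < O.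

Definition okn (a : nm) := pk a < S0.

Lemma adr_inj a b i j : okn a -> okn b ->
  (i * S0 + pk a == j * S0 + pk b) = (a == b) && (i == j).
Proof.
rewrite /okn => la lb; apply/eqP/andP => [e|[/eqP-> /eqP->]//].
have S1 : 0 < S0 by apply: leq_ltn_trans la.
have ij : i = j.
  by have := congr1 (divn^~ S0) e; rewrite !divnMDl // !divn_small // !addn0.
subst j; split=> //; apply/eqP.
by move/addnI: e => /pk_inj.
Qed.

Lemma O_ne m k : k < O -> (O + m == k) = false.
Proof. lia. Qed.

Lemma cexp_ok r e s h : rep h s -> all okn (nms e) -> b0 < r -> r + ndp e <= O ->
  exists s', [/\ exec (cexp r e) s (nsz e) s', rmem s' = rmem s,
    nmem s' r = evn h e & forall k, k < r \/ O <= k -> nmem s' k = nmem s k].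
Proof.
elim: e r s => [k|a e IH|o e1 IH1 e2 IH2] r s rp /=.
- move=> _ br rO; exists (do_instr (NConst (Dir r) k) s); split=> //=.
  + exact: ExecDo.
  + by rewrite eqxx.
  + by move=> j jr; rewrite (_ : (j == r) = false) //; lia.
- move=> /andP[oa oe] br rO; have e0 := ndp_gt0 e.
  have [|s1 [x1 m1 v1 f1]] := IH r s rp oe br; first by lia.
  set s2 := do_instr (NConst (Dir r.+1) S0) s1.
  set s3 := do_instr (NArith NMul (Dir r) (Dir r) (Dir r.+1)) s2.
  set s4 := do_instr (NConst (Dir r.+1) (O + pk a)) s3.
  set s5 := do_instr (NArith NAdd (Dir r) (Dir r) (Dir r.+1)) s4.
  set s6 := do_instr (NMove (Dir r) (Ind r)) s5.
  exists s6; split => //.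
  + by apply: ExecSeq x1 _; do 4!(apply: (@ExecSeq _ _ _ _ 1); first exact: ExecDo); exact: ExecDo.
  + rewrite /= /nget /= !eqxx /=.
    rewrite !(ltn_eqF (ltnSn r)).
    
    rewrite v1.
    have -> : evn h e * S0 + (O + pk a) = O + (evn h e * S0 + pk a) by lia.
    rewrite !O_ne; try lia.
    rewrite f1; last by right; exact: leq_addr.
    by case: rp => -> .
  + move=> k kr /=; have -> : (k == r) = false by lia.
    have -> : (k == r.+1) = false by lia.
    by rewrite f1.
- rewrite all_cat => /andP[p1 p2] br rO.
  have [|s1 [x1 m1 v1 f1]] := IH1 r s rp p1 br; first by lia.
  have rp1 : rep h s1.
    case: rp => A B C; split=> [b i /A <-|b i /B <-|]; rewrite ?m1 //; first by rewrite f1 //; lia.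
    by rewrite f1 //; lia.
  have [| |s2 [x2 m2 v2 f2]] := IH2 r.+1 s1 rp1 p2; [by lia| by lia|].
  exists (do_instr (NArith o (Dir r) (Dir r) (Dir r.+1)) s2); split=> //=.
  + by rewrite -addnA; apply: ExecSeq x1 _; apply: ExecSeq x2 _; exact: ExecDo.
  + by rewrite m2.
  + by rewrite eqxx /nget /= v2 f2 ?v1 //; lia.
  + by move=> k kr; rewrite (_ : (k == r) = false) ?f2 ?f1 //; lia.
Qed.

Lemma rep_eq h s s' : rep h s -> rmem s' = rmem s ->
  (forall k, k = b0 \/ O <= k -> nmem s' k = nmem s k) -> rep h s'.
Proof.
move=> [A B C] m f; split=> [b i /A <-|b i /B <-|]; rewrite ?m ?f //; first by right; exact: leq_addr.
by left.
Qed.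

Lemma cadr_ok r a e s h : rep h s -> all okn (nms e) -> b0 < r -> r + (ndp e).+1 <= O ->
  exists s', [/\ exec (cadr r a e) s (nsz e + 4) s', rmem s' = rmem s,
    nmem s' r = O + (evn h e * S0 + pk a) & forall k, k < r \/ O <= k -> nmem s' k = nmem s k].
Proof.
move=> rp oe br rO; have e0 := ndp_gt0 e; have [|s1 [x1 m1 v1 f1]] := cexp_ok rp oe br; first by lia.
set s2 := do_instr (NConst (Dir r.+1) S0) s1.
set s3 := do_instr (NArith NMul (Dir r) (Dir r) (Dir r.+1)) s2.
set s4 := do_instr (NConst (Dir r.+1) (O + pk a)) s3.
set s5 := do_instr (NArith NAdd (Dir r) (Dir r) (Dir r.+1)) s4.
exists s5; split => //.
- by apply: ExecSeq x1 _; do 3!(apply: (@ExecSeq _ _ _ _ 1); first exact: ExecDo); exact: ExecDo.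
- rewrite /= /nget /= !eqxx /=.
  rewrite !(ltn_eqF (ltnSn r)).
  
  by rewrite v1; lia.
- move=> k kr /=; have -> : (k == r) = false by lia.
  have -> : (k == r.+1) = false by lia.
  by rewrite f1.
Qed.

Lemma rcadr_ok r a e s h : rep h s -> all okn (nms e) -> b0 < r -> r + (ndp e).+1 <= O ->
  exists s', [/\ exec (rcadr r a e) s (nsz e + 5) s', rmem s' = rmem s,
    nmem s' r = base + (evn h e * S0 + pk a) & forall k, k < r \/ O <= k -> nmem s' k = nmem s k].
Proof.
move=> rp oe br rO; have e0 := ndp_gt0 e; have [|s1 [x1 m1 v1 f1]] := cexp_ok rp oe br; first by lia.
set s2 := do_instr (NConst (Dir r.+1) S0) s1.
set s3 := do_instr (NArith NMul (Dir r) (Dir r) (Dir r.+1)) s2.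
set s4 := do_instr (NConst (Dir r.+1) (pk a)) s3.
set s5 := do_instr (NArith NAdd (Dir r) (Dir r) (Dir r.+1)) s4.
set s6 := do_instr (NArith NAdd (Dir r) (Dir r) (Dir b0)) s5.
exists s6; split => //.
- by apply: ExecSeq x1 _; do 4!(apply: (@ExecSeq _ _ _ _ 1); first exact: ExecDo); exact: ExecDo.
- rewrite /= /nget /= !eqxx /=.
  rewrite !(ltn_eqF (ltnSn r)).
  
  have -> : (b0 == r) = false by lia.
  have -> : (b0 == r.+1) = false by lia.
  by rewrite v1 f1; [case: rp => _ _ ->; lia|left].
- move=> k kr /=; have -> : (k == r) = false by lia.
  have -> : (k == r.+1) = false by lia.
  by rewrite f1.
Qed.

Lemma rep_setn h s s' a i v : rep h s -> okn a -> rmem s' = rmem s ->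
  (forall k, k = b0 \/ O <= k ->
    nmem s' k = if k == O + (i * S0 + pk a) then v else nmem s k) ->
  rep (setn h a i v) s'.
Proof.
move=> [A B C] oa m f; split=> [b j ob|b j /B <-|]; rewrite ?m //=.
- rewrite f; last by right; exact: leq_addr.
  by rewrite eqn_add2l adr_inj // A.
- by rewrite f; [case: eqP => // e; lia|left].
Qed.

Lemma rep_setr h s s' a i v : rep h s -> okn a ->
  (forall k, k = b0 \/ O <= k -> nmem s' k = nmem s k) ->
  (forall k, rmem s' k = if k == base + (i * S0 + pk a) then v else rmem s k) ->
  rep (setr h a i v) s'.
Proof.
move=> [A B C] oa f m; split=> [b j /A <-|b j ob|]; rewrite ?f ?m //=; try by lia.
by rewrite eqn_add2l adr_inj // B.
Qed.

Lemma comp_ok c r s h : rep h s -> all okn (cnms c) -> b0 < r -> r + cdp c <= O ->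
  exists s', [/\ exec (comp r c) s (cost c h) s', rep (run c h) s' &
    forall k, k < r -> nmem s' k = nmem s k].
Proof.
elim: c r s h => [|a i e|a i k|o a i b j c k|a i b j k|c1 IH1 c2 IH2|t c1 IH1 c2 IH2|x e c IH] r s h rp /=.
- by move=> _ br rO; exists s; split=> //; exact: ExecSkip.
- rewrite all_cat => /and3P[oa oi oe] br rO.
  have [|s1 [x1 m1 v1 f1]] := cadr_ok a rp oi br; first by lia.
  have rp1 : rep h s1 by apply: rep_eq rp m1 _ => k kb; apply: f1; lia.
  have [| |s2 [x2 m2 v2 f2]] := @cexp_ok r.+1 _ _ _ rp1 oe; [by lia|by lia|].
  have a2 : nmem s2 r = O + (evn h i * S0 + pk a) by rewrite f2 ?v1 //; lia.
  exists (do_instr (NMove (Ind r) (Dir r.+1)) s2); split=> //=.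
  + have -> : nsz i + nsz e + 5 = nsz i + 4 + (nsz e + 1) by lia.
    by apply: ExecSeq x1 _; apply: ExecSeq x2 _; exact: ExecDo.
  + apply: (rep_setn rp oa); first by rewrite /= m2.
    by move=> k kO /=; rewrite a2 /nget /= v2; case: eqP => // _; rewrite f2 ?f1; lia.
  + by move=> k kr /=; rewrite a2; case: eqP => [e0|_]; [lia|rewrite f2 ?f1; lia].
- move=> /andP[oa oi] br rO.
  have [|s1 [x1 m1 v1 f1]] := rcadr_ok a rp oi br; first by lia.
  exists (do_instr (RConst (Ind r) k) s1); split=> //=.
  + have -> : nsz i + 6 = nsz i + 5 + 1 by lia.
    by apply: ExecSeq x1 _; exact: ExecDo.
  + apply: (rep_setr rp oa) => [j jO|j] /=; first by rewrite f1 //; lia.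
    by rewrite v1 m1.
  + by move=> j jr /=; rewrite f1 //; lia.
- rewrite !all_cat => /and3P[oa ob /andP[oc /and3P[oi oj ok]]] br rO.
  have [|s1 [x1 m1 v1 f1]] := rcadr_ok a rp oi br; first by lia.
  have rp1 : rep h s1 by apply: rep_eq rp m1 _ => q kb; apply: f1; lia.
  have [| |s2 [x2 m2 v2 f2]] := @rcadr_ok r.+1 b _ _ _ rp1 oj; [by lia|by lia|].
  have rp2 : rep h s2 by apply: rep_eq rp1 m2 _ => q kb; apply: f2; lia.
  have [| |s3 [x3 m3 v3 f3]] := @rcadr_ok r.+2 c _ _ _ rp2 ok; [by lia|by lia|].
  exists (do_instr (RArith o (Ind r) (Ind r.+1) (Ind r.+2)) s3); split=> //=.
  + have -> : nsz i + nsz j + nsz k + 16 = nsz i + 5 + (nsz j + 5 + (nsz k + 5 + 1)) by lia.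
    by apply: ExecSeq x1 _; apply: ExecSeq x2 _; apply: ExecSeq x3 _; exact: ExecDo.
  + apply: (rep_setr rp oa) => [q qO|q] /=; first by rewrite f3 ?f2 ?f1 //; lia.
    rewrite f3 ?f2 ?v1; try lia.
    rewrite m3 m2 m1 /rget /= v3 f3 ?v2; last by lia.
    by rewrite m3 m2 m1; case: rp => _ B _; rewrite !B.
  + by move=> q qr /=; rewrite f3 ?f2 ?f1 //; lia.
- rewrite !all_cat => /and3P[oa ob /andP[oi oj]] br rO.
  have [|s1 [x1 m1 v1 f1]] := rcadr_ok a rp oi br; first by lia.
  have rp1 : rep h s1 by apply: rep_eq rp m1 _ => q kb; apply: f1; lia.
  have [| |s2 [x2 m2 v2 f2]] := @rcadr_ok r.+1 b _ _ _ rp1 oj; [by lia|by lia|].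
  exists (do_instr (RPow (Ind r) (Ind r.+1) k) s2); split=> //=.
  + have -> : nsz i + nsz j + 11 = nsz i + 5 + (nsz j + 5 + 1) by lia.
    by apply: ExecSeq x1 _; apply: ExecSeq x2 _; exact: ExecDo.
  + apply: (rep_setr rp oa) => [q qO|q] /=; first by rewrite f2 ?f1 //; lia.
    rewrite f2 ?v1; last by lia.
    by rewrite m2 m1 /rget /= v2 m2 m1; case: rp => _ B _; rewrite !B.
  + by move=> q qr /=; rewrite f2 ?f1 //; lia.
- rewrite all_cat => /andP[p1 p2] br rO.
  have [|s1 [x1 rp1 f1]] := IH1 r s h rp p1 br; first by lia.
  have [|s2 [x2 rp2 f2]] := IH2 r s1 _ rp1 p2 br; first by lia.
  by exists s2; split=> //; [apply: ExecSeq x1 x2|move=> k kr; rewrite f2 ?f1].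
- rewrite !all_cat => /and3P[ot p1 p2] br rO.
  case: t ot rO => [e1 e2|a i b j] /=.
  + rewrite all_cat => /andP[oe1 oe2] rO.
    have [|s1 [x1 m1 v1 g1]] := cexp_ok rp oe1 br; first by lia.
    have rp1 : rep h s1 by apply: rep_eq rp m1 _ => k kb; apply: g1; lia.
    have [| |s2 [x2 m2 v2 g2]] := @cexp_ok r.+1 _ _ _ rp1 oe2; [by lia|by lia|].
    have rp2 : rep h s2 by apply: rep_eq rp1 m2 _ => k kb; apply: g2; lia.
    have ev : eval_test (NLe (Dir r) (Dir r.+1)) s2 = (evn h e1 <= evn h e2).
      by rewrite /= /nget /= v2 g2 ?v1 //; lia.
    have [s3 [x3 rp3 f3]] : exists s', [/\ exec (if evn h e1 <= evn h e2 then comp r c1 else comp r c2) s2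
       (if evn h e1 <= evn h e2 then cost c1 h else cost c2 h) s',
       rep (if evn h e1 <= evn h e2 then run c1 h else run c2 h) s' &
       forall k, k < r -> nmem s' k = nmem s2 k].
      by case: ifP => _; [apply: IH1|apply: IH2] => //; lia.
    exists s3; split=> //; last by move=> k kr; rewrite f3 ?g2 ?g1 //; lia.
    rewrite -!addnA; apply: ExecSeq x1 _; apply: ExecSeq x2 _.
    by rewrite add1n; apply: ExecIf; rewrite ev.
  + rewrite all_cat => /and3P[oa ob /andP[oi oj]] rO.
    have [|s1 [x1 m1 v1 f1]] := rcadr_ok a rp oi br; first by lia.
    have rp1 : rep h s1 by apply: rep_eq rp m1 _ => q kb; apply: f1; lia.
    have [| |s2 [x2 m2 v2 f2]] := @rcadr_ok r.+1 b _ _ _ rp1 oj; [by lia|by lia|].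
    have rp2 : rep h s2 by apply: rep_eq rp1 m2 _ => k kb; apply: f2; lia.
    set tst := (ra h a _ <= _)%R.
    have ev : eval_test (RLe (Ind r) (Ind r.+1)) s2 = tst.
      rewrite /= /rget /= v2 f2 ?v1; last by lia.
      by case: rp2 => _ B _; rewrite !B.
    have [s3 [x3 rp3 f3]] : exists s', [/\ exec (if tst then comp r c1 else comp r c2) s2
       (if tst then cost c1 h else cost c2 h) s',
       rep (if tst then run c1 h else run c2 h) s' &
       forall k, k < r -> nmem s' k = nmem s2 k].
      by case: ifP => _; [apply: IH1|apply: IH2] => //; lia.
    exists s3; split=> //; last by move=> k kr; rewrite f3 ?f2 ?f1 //; lia.
    set cc := (if tst then cost _ _ else _) in x3 *.
    have -> : nsz i + nsz j + 10 + 1 + cc = nsz i + 5 + (nsz j + 5 + cc.+1) by lia.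
    apply: ExecSeq x1 _; apply: ExecSeq x2 _.
    by apply: ExecIf; rewrite ev.
- rewrite all_cat => /and3P[ox oe oc] br rO.
  have [| |s1 [x1 m1 v1 f1]] := @cexp_ok r.+1 _ _ _ rp oe; [by lia|by lia|].
  set s2 := do_instr (NConst (Dir r) 1) s1.
  set n := evn h e in v1 *.
  set it := fun q => iteri q (fun q h => run c (setn h x 0 q)) h.
  have loop : forall m q s', q + m = n -> rep (it q) s' -> nmem s' r = q.+1 -> nmem s' r.+1 = n ->
    exists s'', [/\ exec (While (NLe (Dir r) (Dir r.+1))
        (Seq (Do (NConst (Dir r.+2) 1))
        (Seq (Do (NArith NSub (Dir (O + pk x)) (Dir r) (Dir r.+2)))
        (Seq (comp r.+2 c)
        (Seq (Do (NConst (Dir r.+2) 1))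
             (Do (NArith NAdd (Dir r) (Dir r) (Dir r.+2)))))))) s'
        (1 + \sum_(q <= k < n) (5 + cost c (setn (it k) x 0 k))) s'',
        rep (it n) s'' & forall k, k < r -> nmem s'' k = nmem s' k].
    elim=> [|m IHm] q s' qm rps vr vr1.
      rewrite addn0 in qm; rewrite -qm big_geq //.
      exists s'; split=> //; apply: ExecWhileStop; rewrite /= /nget /= vr vr1 -qm; lia.
    have qn : q < n by lia.
    set t1 := do_instr (NConst (Dir r.+2) 1) s'.
    set t2 := do_instr (NArith NSub (Dir (O + pk x)) (Dir r) (Dir r.+2)) t1.
    have e1 : (r == r.+2) = false by lia.
    have e3 : (r.+1 == r.+2) = false by lia.
    have e2 : (r == O + pk x) = false by lia.
    have e4 : (r.+1 == O + pk x) = false by lia.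
    have rpt : rep (setn (it q) x 0 q) t2.
      apply: (rep_setn rps ox) => // k kO.
      rewrite /t2 /t1 /= /nget /= eqxx e1 vr mul0n add0n subn1 /=.
      by case: eqP => // _; case: eqP => // k2; lia.
    have [| |t3 [x3 rp3 f3]] := IH r.+2 t2 _ rpt oc; [by lia|by lia|].
    set t4 := do_instr (NConst (Dir r.+2) 1) t3.
    set t5 := do_instr (NArith NAdd (Dir r) (Dir r) (Dir r.+2)) t4.
    have g3 : forall k, k < r.+2 -> nmem t3 k = nmem s' k.
      move=> k kr; rewrite f3 // /t2 /t1 /=.
      case: eqP => [?|_]; first by lia.
      by case: eqP => // ?; lia.
    have [| | | |s'' [x'' rp'' f'']] := IHm q.+1 t5.
    + by lia.
    + apply: rep_eq rp3 _ _ => // k kO; rewrite /t5 /t4 /=.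
      have -> : (k == r) = false by lia.
      by have -> : (k == r.+2) = false by lia.
    + by rewrite /t5 /t4 /= /nget /= !eqxx e1 g3 // vr addn1.
    + by rewrite /t5 /t4 /= /nget /= e3 (_ : (r.+1 == r) = false) ?g3 ?vr1 //; lia.
    exists s''; split=> //; last first.
      move=> k kr; rewrite f'' // /t5 /t4 /= (_ : (k == r) = false); last by lia.
      by rewrite (_ : (k == r.+2) = false) ?g3 //; lia.
    rewrite big_ltn //.
    have -> : forall A, 1 + (5 + cost c (setn (it q) x 0 q) + A) =
      (1 + (1 + (cost c (setn (it q) x 0 q) + (1 + 1))) + (1 + A)).+1 by move=> A; lia.
    apply: (ExecWhileLoop (s' := t5)) x''; first by rewrite /= /nget /= vr vr1.
    apply: (@ExecSeq _ _ _ _ 1 t1); first exact: ExecDo.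
    apply: (@ExecSeq _ _ _ _ 1 t2); first exact: ExecDo.
    apply: ExecSeq x3 _; apply: (@ExecSeq _ _ _ _ 1 t4); exact: ExecDo.
  have rps2 : rep h s2.
    apply: rep_eq rp _ _ => // k kO; rewrite /s2 /=.
    have -> : (k == r) = false by lia.
    by rewrite f1 //; lia.
  have [| |s3 [x3 rp3 f3]] := loop n 0 s2 (add0n n) rps2.
  + by rewrite /s2 /= eqxx.
  + by rewrite /s2 /= (_ : (r.+1 == r) = false) //; lia.
  exists s3; split=> //.
    have -> : nsz e + 2 + \sum_(q < n) (5 + cost c (setn (it q) x 0 q)) =
      nsz e + (1 + (1 + \sum_(0 <= k < n) (5 + cost c (setn (it k) x 0 k)))) by rewrite big_mkord; lia.
    by apply: ExecSeq x1 _; apply: (@ExecSeq _ _ _ _ 1 s2); [exact: ExecDo|exact: x3].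
  by move=> k kr; rewrite f3 // /s2 /= (_ : (k == r) = false) ?f1 //; lia.
Qed.
End Compile.
End HighLevel.

Definition seqs (l : seq cmd) : cmd := foldr Cseq Cskip l.

Section Rules.
Variable R : realType.
Implicit Types (h : hst R) (c : cmd).

Lemma frameP (P : pred nm) c h a i : all P (wr c) -> ~~ P a ->
  na (run c h) a i = na h a i /\ ra (run c h) a i = ra h a i.
Proof.
by move=> /allP wP Pa; apply: frame; apply: contra Pa => /wP.
Qed.

Lemma wr_seqs (T : Type) (P : pred nm) (f : T -> cmd) (l : seq T) :
  all P (wr (seqs (map f l))) = all (fun x => all P (wr (f x))) l.
Proof. by elim: l => //= x l IH; rewrite all_cat IH. Qed.

Lemma for_rule (I : nat -> hst R -> Prop) (t : nat -> R) x e c h :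
  I 0 h ->
  (forall q h', q < evn h e -> I q h' ->
    I q.+1 (run c (setn h' x 0 q)) /\ ((cost c (setn h' x 0 q))%:R <= t q)%R) ->
  I (evn h e) (run (Cfor x e c) h) /\
  ((cost (Cfor x e c) h)%:R <= (nsz e + 2)%:R + \sum_(q < evn h e) (5 + t q))%R.
Proof.
move=> I0 step /=; set n := evn h e in step *.
set it := fun q => iteri q (fun q h => run c (setn h x 0 q)) h.
have Iq q : q <= n -> I q (it q).
  elim: q => //= q IH qn; exact: (step q _ qn (IH (ltnW qn))).1.
split; first exact: Iq.
rewrite natrD lerD2l natr_sum; apply: ler_sum => q _.
by rewrite natrD lerD2l; apply: (step q _ _ (Iq q _)).2 => //; exact: ltnW.
Qed.

Lemma for_rule_nat (I : nat -> hst R -> Prop) (t : nat) x e c h :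
  I 0 h ->
  (forall q h', q < evn h e -> I q h' ->
    I q.+1 (run c (setn h' x 0 q)) /\ cost c (setn h' x 0 q) <= t) ->
  I (evn h e) (run (Cfor x e c) h) /\
  cost (Cfor x e c) h <= nsz e + 2 + evn h e * (5 + t).
Proof.
move=> I0 step; have [|A B] := @for_rule I (fun=> t%:R)%R x e c h I0 _.
  by move=> q h' qn /step[] // iq ct; split=> //; rewrite ler_nat.
split=> //; rewrite -(ler_nat R); apply: le_trans B _.
by rewrite sumr_const card_ord !natrD natrM natrD mulr_natl.
Qed.

Lemma for_inv (I : nat -> hst R -> Prop) x e c h : I 0 h ->
  (forall q h', q < evn h e -> I q h' -> I q.+1 (run c (setn h' x 0 q))) ->
  I (evn h e) (run (Cfor x e c) h).
Proof.
move=> I0 step /=; set n := evn h e in step *.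
have H q : q <= n -> I q (iteri q (fun q h => run c (setn h x 0 q)) h).
  elim: q => //= q IH qn; exact: (step q _ qn (IH (ltnW qn))).
exact: H.
Qed.

Lemma for_cost x e c h t : (forall h', cost c h' <= t) ->
  cost (Cfor x e c) h <= nsz e + 2 + evn h e * (5 + t).
Proof.
move=> ct /=; rewrite leq_add2l -[X in X * _]card_ord -sum_nat_const.
by apply: leq_sum => q _; rewrite leq_add2l.
Qed.

Lemma cost_cons c l h : cost (seqs (c :: l)) h = cost c h + cost (seqs l) (run c h).
Proof. by []. Qed.

Lemma run_cons c l h : run (seqs (c :: l)) h = run (seqs l) (run c h).
Proof. by []. Qed.

Lemma seqs_rule (T : Type) (f : T -> cmd) (l : seq T) (I : seq T -> hst R -> Prop) (t : T -> nat) h :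
  I [::] h ->
  (forall pre x post h', l = pre ++ x :: post -> I pre h' ->
     I (rcons pre x) (run (f x) h') /\ cost (f x) h' <= t x) ->
  I l (run (seqs (map f l)) h) /\ cost (seqs (map f l)) h <= \sum_(x <- l) t x.
Proof.
move=> I0 step; suff: forall post pre h', l = pre ++ post -> I pre h' ->
   I l (run (seqs (map f post)) h') /\ cost (seqs (map f post)) h' <= \sum_(x <- post) t x.
  by move=> H; apply: (H l [::] h).
elim=> [|x post IH] pre h' E Ih /=; first by rewrite E cats0.
have [I1 c1] := step pre x post h' E Ih.
rewrite big_cons; have [||I2 c2] := IH (rcons pre x) (run (f x) h'); rewrite -?cats1 -?catA //.
  by rewrite cats1.
by split=> //; exact: leq_add.
Qed.
End Rules.

Section Digits.
Variable M : nat.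

Fixpoint enc (ds : seq nat) : nat := if ds is d :: ds' then d + enc ds' * M else 0.

Lemma enc_cat a b : enc (a ++ b) = enc a + enc b * M ^ size a.
Proof.
elim: a => [|d a IH] /=; first by rewrite expn0 muln1.
by rewrite IH expnS; nia.
Qed.

Hypothesis M0 : 0 < M.

Lemma enc_lt ds : all (gtn M) ds -> enc ds < M ^ size ds.
Proof. by elim: ds => [|d ds IH] //= /andP[dM /IH]; rewrite expnS; nia. Qed.

Lemma enc_lt_exp ds p : all (gtn M) ds -> enc (take p ds) < M ^ p.
Proof.
move=> a; have a1 : all (gtn M) (take p ds).
  by move: a; rewrite -{1}(cat_take_drop p ds) all_cat => /andP[].
apply: leq_trans (enc_lt a1) _; rewrite leq_pexp2l // size_take; case: ifP => //; lia.
Qed.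

Lemma enc_split ds p : enc ds = enc (take p ds) + enc (drop p ds) * M ^ p.
Proof.
rewrite -{1}(cat_take_drop p ds) enc_cat.
case: (leqP p (size ds)) => ps; first by rewrite size_takel.
by rewrite drop_oversize ?(ltnW ps) // !mul0n.
Qed.

Lemma enc_div ds p : all (gtn M) ds -> enc ds %/ M ^ p = enc (drop p ds).
Proof.
move=> a; rewrite (enc_split ds p) divnDMl ?expn_gt0 ?M0 //.
by rewrite divn_small ?enc_lt_exp.
Qed.

Lemma enc_mod ds p : all (gtn M) ds ->
  enc ds - enc ds %/ M ^ p * M ^ p = enc (take p ds).
Proof. by move=> a; rewrite enc_div // {1}(enc_split ds p) addnK. Qed.

Lemma enc_digit ds p : all (gtn M) ds -> p < size ds ->
  enc ds %/ M ^ p - enc ds %/ M ^ p %/ M * M = nth 0 ds p.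
Proof.
move=> a ps; rewrite enc_div // (drop_nth 0 ps) /=.
rewrite divnDMl // divn_small ?add0n ?addnK //.
by move/allP: a; apply; exact: mem_nth.
Qed.

Lemma enc_insert ds p x : all (gtn M) ds -> p <= size ds ->
  enc (take p ds ++ x :: drop p ds) =
  enc ds %/ M ^ p * M ^ p.+1 + x * M ^ p + (enc ds - enc ds %/ M ^ p * M ^ p).
Proof.
move=> a ps; rewrite enc_mod // enc_div // enc_cat /= size_takel // expnS; lia.
Qed.
End Digits.

Section Dictionary.
Variable R : realType.
Implicit Types (h : hst R).

Definition gINP : nm := [:: 0; 0].
Definition gM : nm := [:: 0; 1].
Definition gID : nm := [:: 0; 2].
Definition gLB : nm := [:: 0; 3].
Definition gND : nm := [:: 0; 4].
Definition gZ : nm := [:: 0; 5].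
Definition gPW : nm := [:: 0; 6].
Definition gLG : nm := [:: 0; 7].
Definition gK : nm := [:: 0; 8].
Definition gLO : nm := [:: 0; 9].
Definition gHI : nm := [:: 0; 10].
Definition gMID : nm := [:: 0; 11].
Definition gDG : nm := [:: 0; 12].
Definition gFD : nm := [:: 0; 13].
Definition gP2 : nm := [:: 0; 14].
Definition gS : nm := [:: 0; 15].

Notation "a +! b" := (No NAdd a b) (at level 50, left associativity).
Notation "a -! b" := (No NSub a b) (at level 50, left associativity).
Notation "a *! b" := (No NMul a b) (at level 40, left associativity).
Notation "a /! b" := (No NDiv a b) (at level 40, left associativity).
Definition Cs a e := Cn a (Nc 0) e.

Definition digit (p : nexp) : nexp :=
  (Nv gZ /! Na gPW p) -! ((Nv gZ /! Na gPW p) /! Nv gM) *! Nv gM.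

Definition bin_step : cmd :=
  Cif (Ble (Nv gLO +! Nc 1) (Nv gHI))
   (seqs [:: Cs gMID ((Nv gLO +! Nv gHI) /! Nc 2);
             Cs gDG (digit (Nv gMID));
             Cif (Brle gINP (Nv gK) gLB (Nv gDG))
               (Cs gHI (Nv gMID)) (Cs gLO (Nv gMID +! Nc 1))]) Cskip.

Definition dict_fin : cmd :=
  seqs [:: Cif (Ble (Nv gLO +! Nc 1) (Nv gND))
      (seqs [:: Cs gDG (digit (Nv gLO));
        Cif (Brle gLB (Nv gDG) gINP (Nv gK))
          (Cseq (Cs gFD (Nc 1)) (Cn gID (Nv gK) (Nv gDG))) Cskip]) Cskip;
    Cif (Ble (Nv gFD) (Nc 0))
      (seqs [:: CRp gLB (Nv gND) gINP (Nv gK) 1;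
        Cn gID (Nv gK) (Nv gND);
        Cs gZ ((Nv gZ /! Na gPW (Nv gLO)) *! Na gPW (Nv gLO +! Nc 1)
               +! Nv gND *! Na gPW (Nv gLO)
               +! (Nv gZ -! (Nv gZ /! Na gPW (Nv gLO)) *! Na gPW (Nv gLO)));
        Cs gND (Nv gND +! Nc 1)]) Cskip].

Definition dict_step : cmd :=
  seqs [:: Cs gLO (Nc 0); Cs gHI (Nv gND);
    Cfor gS (Nv gLG) bin_step; Cs gFD (Nc 0); dict_fin].

Definition dict : cmd :=
  seqs [:: Cn gPW (Nc 0) (Nc 1);
    Cfor gK (Nv gM) (Cn gPW (Nv gK +! Nc 1) (Na gPW (Nv gK) *! Nv gM));
    Cs gP2 (Nc 1);
    Cfor gK (Nv gM) (Cif (Ble (Nv gP2) (Nv gM))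
      (Cseq (Cs gP2 (Nv gP2 *! Nc 2)) (Cs gLG (Nv gLG +! Nc 1))) Cskip);
    Cfor gK (Nv gM) dict_step].

Variables (M : nat) (inp : nat -> R).

Definition dstat h := [/\ na h gM 0 = M, forall j, ra h gINP j = inp j,
  forall j, j <= M -> na h gPW j = M ^ j & M < 2 ^ na h gLG 0].

Lemma bin_step_ok h dl ds n :
  dstat h -> all (gtn M) ds -> size dl = size ds -> na h gZ 0 = enc M ds ->
  size ds <= M ->
  (forall i, i < size dl -> ra h gLB i = nth 0%R dl i) ->
  all (gtn (size dl)) ds -> sorted <%R [seq nth 0%R dl i | i <- ds] ->
  let v := inp (na h gK 0) in
  let vs := [seq nth 0%R dl i | i <- ds] in
  [/\ na h gLO 0 <= na h gHI 0 <= size ds,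
      forall i, i < na h gLO 0 -> (nth 0 vs i < v)%R,
      forall i, na h gHI 0 <= i < size ds -> (v <= nth 0 vs i)%R &
      na h gHI 0 - na h gLO 0 < 2 ^ n.+1] ->
  let h' := run bin_step h in
  [/\ na h' gLO 0 <= na h' gHI 0 <= size ds,
      forall i, i < na h' gLO 0 -> (nth 0 vs i < v)%R,
      forall i, na h' gHI 0 <= i < size ds -> (v <= nth 0 vs i)%R &
      na h' gHI 0 - na h' gLO 0 < 2 ^ n].
Proof.
move=> [eM eI eP eL] a sz Z szM LB szds srt v vs [/andP[lh hs] low high gap] /=.
case: ifP => [lt|ge] /=; last first.
  have g0 : na h gHI 0 - na h gLO 0 = 0 by lia.
  by split=> //; [rewrite lh hs|rewrite g0 expn_gt0].
set mid := (_ + _) %/ 2.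
have mlt : mid < na h gHI 0 by rewrite /mid; lia.
have mge : na h gLO 0 <= mid by rewrite /mid; lia.
have msz : mid < size ds by lia.
have M0 : 0 < M by lia.
rewrite eM eP ?Z; last by lia.
rewrite (enc_digit M0 a msz) eI LB; last first.
  by have := allP szds _ (mem_nth 0 msz).
have -> : nth 0%R dl (nth 0 ds mid) = nth 0%R vs mid by rewrite (nth_map 0).
have mono i j : i <= j -> j < size ds -> (nth 0%R vs i <= nth 0%R vs j)%R.
  move=> ij js; by apply: (sorted_leq_nth le_trans lexx) => //; rewrite ?inE ?size_map //;
    [exact: (sub_sorted (@ltW _ _))|lia].
rewrite expnS in gap.
case: (leP v (nth 0%R vs mid)) => vm /=.
- split; [by lia|by []| |by rewrite /mid; lia].
  by move=> i /andP[mi iz]; apply: le_trans vm _; exact: mono.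
- split; [by lia| |by []|by rewrite /mid; lia].
  by move=> i im; apply: le_lt_trans vm; apply: mono => //; lia.
Qed.



Definition dinv (k : nat) h := exists dl ds, [/\
  [/\ dstat h, uniq dl & dl =i [seq inp j | j <- iota 0 k]],
  [/\ size ds = size dl, na h gND 0 = size dl, size dl <= k,
     forall i, i < size dl -> ra h gLB i = nth 0%R dl i &
     forall j, j < k -> na h gID j = index (inp j) dl],
  perm_eq ds (iota 0 (size dl)), sorted <%R [seq nth 0%R dl i | i <- ds] &
  na h gZ 0 = enc M ds].

Lemma dict_step_ok k h : k < M -> dinv k h -> na h gK 0 = k -> dinv k.+1 (run dict_step h).
Proof.
move=> kM [dl [ds [[st udl mdl] [sz eN dk LB ID] pds srt Z]]] eK.
rewrite /dict_step.
set h1 := run (Cs gLO (Nc 0)) h.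
set h2 := run (Cs gHI (Nv gND)) h1.
set h3 := run (Cfor gS (Nv gLG) bin_step) h2.
have dsM : all (gtn (size dl)) ds by apply/allP => i; rewrite (perm_mem pds) mem_iota.
have dsM' : all (gtn M) ds by apply: sub_all dsM => i /= il; exact: leq_trans il (leq_trans dk (ltnW kM)).
set vs := [seq nth 0%R dl i | i <- ds] in srt.
pose fr (a : nm) := a \in [:: gLO; gHI; gMID; gDG; gS].
have f2 a i : ~~ fr a -> na h2 a i = na h a i /\ ra h2 a i = ra h a i.
  by apply: (@frameP _ fr (Cseq (Cs gLO (Nc 0)) (Cs gHI (Nv gND))) h).
pose In q h' := [/\ forall a i, ~~ fr a -> na h' a i = na h a i /\ ra h' a i = ra h a i,
   na h' gLO 0 <= na h' gHI 0 <= size ds,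
      forall i, i < na h' gLO 0 -> (nth 0 vs i < inp k)%R,
      forall i, na h' gHI 0 <= i < size ds -> (inp k <= nth 0 vs i)%R &
      na h' gHI 0 - na h' gLO 0 < 2 ^ (na h gLG 0 - q)].
have I3 : In (na h gLG 0) h3.
  have eL : evn h2 (Nv gLG) = na h gLG 0 by [].
  rewrite /h3 -eL; apply: for_inv.
    split=> //=.
    + by rewrite eN sz leqnn.
    + by move=> i; rewrite eN sz ltnNge andbN.
    + by rewrite eN !subn0; case: st => _ _ _; apply: leq_ltn_trans; lia.
  move=> q h' qL [g lh low high gap].
  have gg a i : ~~ fr a -> na (run bin_step (setn h' gS 0 q)) a i = na h a i
      /\ ra (run bin_step (setn h' gS 0 q)) a i = ra h a i.
    move=> na; have [-> ->] := @frameP _ fr bin_step (setn h' gS 0 q) a i isT na.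
    by rewrite /= (_ : (a == gS) = false) /=; [exact: g|apply: contraNF na => /eqP->].
  have gn a : ~~ fr a -> forall i, na (setn h' gS 0 q) a i = na h a i.
    move=> Ha i; rewrite /= (_ : (a == gS) = false) /=; first by have [] := g a i Ha.
    by apply: contraNF Ha => /eqP->.
  have gr a i : ~~ fr a -> ra (setn h' gS 0 q) a i = ra h a i by move=> Ha; have [] := g a i Ha.
  have st' : dstat (setn h' gS 0 q).
    case: st => A B C D; split; [by rewrite gn|by move=> j; rewrite gr| |by rewrite gn].
    by move=> j jM; rewrite gn ?C.
  have LB' i : i < size dl -> ra (setn h' gS 0 q) gLB i = nth 0%R dl i.
    by move=> il; rewrite gr ?LB.
  have Z' : na (setn h' gS 0 q) gZ 0 = enc M ds by rewrite gn.
  have szM : size ds <= M by rewrite sz; lia.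
  have := bin_step_ok (n := na h gLG 0 - q.+1) st' dsM' (esym sz) Z' szM LB' dsM srt.
  have eK' : na (setn h' gS 0 q) gK 0 = k by rewrite gn.
  have eLG : na h gLG 0 - q = (na h gLG 0 - q.+1).+1 by move: qL; rewrite /=; lia.
  rewrite eK' /= -eLG => /(_ _)[]; first by split.
  by move=> A B C D; split.
case: I3 => g3 lh low high; rewrite subnn expn0 => gap.
have {}lh : na h3 gLO 0 = na h3 gHI 0 /\ na h3 gLO 0 <= size ds by lia.
case: lh => eLH; set p := na h3 gLO 0 in eLH low high gap * => pz.
rewrite -eLH in high; clear gap eLH.
have n3 a i : ~~ fr a -> na h3 a i = na h a i by move=> /(g3 a i)[].
have r3 a i : ~~ fr a -> ra h3 a i = ra h a i by move=> /(g3 a i)[].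
set v := inp k in low high *.
have vs_dl i : i < size ds -> nth 0%R vs i = nth 0%R dl (nth 0 ds i).
  by move=> il; rewrite (nth_map 0).
have ds_lt i : i < size ds -> nth 0 ds i < size dl.
  by move=> il; have := allP dsM _ (mem_nth 0 il).
have M0 : 0 < M by lia.
have [eM eI eP eL] := st.
have pM : p < M by lia.
have inp' : v \in dl -> dl =i [seq inp j | j <- iota 0 k.+1].
  move=> vin w; rewrite -addn1 iotaD map_cat mem_cat -mdl inE add0n.
  by case: eqP => [->|_]; rewrite ?vin ?orbT ?orbF.
set h4 := run (Cs gFD (Nc 0)) h3.
rewrite (_ : run _ h = run dict_fin h4) //.
clearbody h3; clear f2 h1 h2 In g3.
have LEN := enc_digit M0 dsM'.
case: (boolP ((p < size ds) && (nth 0%R vs p <= v)%R)) => [/andP[pl pv]|npv].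
- have vE : v = nth 0%R dl (nth 0 ds p).
    by rewrite -vs_dl //; apply/eqP; rewrite eq_le pv high ?leqnn.
  have -> : run dict_fin h4 = setn (setn (setn h4 gDG 0 (nth 0 ds p)) gFD 0 1) gID k (nth 0 ds p).
    rewrite /h4 /= (n3 gND) // eN -sz addn1 pl /= (n3 gZ) // (n3 gPW) // (n3 gM) // eM eP ?Z; last by lia.
    rewrite -/p LEN // (r3 gLB) // (r3 gINP) // eI (n3 gK) // eK LB ?ds_lt // -vE lexx /=.
    by [].
  have frx a : ~~ fr a -> a != gDG.
    by apply: contraNneq => ->.
  exists dl, ds; split=> //; last by rewrite /= n3.
  + split=> //; last by apply: inp'; rewrite vE mem_nth // ds_lt.
    by split; [rewrite /= n3|move=> j; rewrite /= r3|move=> j /eP <-; rewrite /= n3|rewrite /= n3].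
  + split=> //; [by rewrite /= n3|by lia|by move=> i /LB <-; rewrite /= r3|].
    move=> j; rewrite ltnS leq_eqVlt => /orP[/eqP->|jk] /=.
      by rewrite eqxx -/v vE index_uniq // ds_lt.
    by rewrite (ltn_eqF jk) n3 // ID.
have vlt i : i < size dl -> nth 0%R dl i != v.
  move=> il; apply/eqP => vE.
  have ids : i \in ds by rewrite (perm_mem pds) mem_iota.
  have := vs_dl (index i ds); rewrite index_mem => /(_ ids); rewrite nth_index // vE.
  set q := index i ds => vq; have qs : q < size ds by rewrite index_mem.
  case: (ltnP q p) => qp; first by have := low _ qp; rewrite vq ltxx.
  move: npv; rewrite negb_and => /orP[|]; first by lia.
  rewrite -ltNge.
  rewrite -vq ltNge; apply/negP; rewrite negbK.
  apply: (sorted_leq_nth le_trans lexx) => //; rewrite ?inE ?size_map //;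
    [exact: (sub_sorted (@ltW _ _))|exact: leq_ltn_trans qp qs].
have vdl : v \notin dl by apply/(nthP 0%R) => -[i /vlt /eqP].
have szM : size ds < M by lia.
set c1 := Cif (Ble (Nv gLO +! Nc 1) (Nv gND))
      (seqs [:: Cs gDG (digit (Nv gLO));
        Cif (Brle gLB (Nv gDG) gINP (Nv gK))
          (Cseq (Cs gFD (Nc 1)) (Cn gID (Nv gK) (Nv gDG))) Cskip]) Cskip.
have f5 a i : a != gDG -> na (run c1 h4) a i = na h4 a i /\ ra (run c1 h4) a i = ra h4 a i.
  move=> /negbTE nDG; rewrite /h4 /c1 /= (n3 gND) // eN -sz addn1 -/p.
  case: ifP => [pl|_] //=.
  rewrite (n3 gZ) // (n3 gPW) // (n3 gM) // eM eP ?Z; last by lia.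
  rewrite LEN // (r3 gLB) // (r3 gINP) // eI (n3 gK) // eK LB ?ds_lt // -vs_dl //.
  move: npv; rewrite pl /= => /negbTE -> /=.
  by rewrite nDG.
have -> : run dict_fin h4 = run (Cseq (Cif (Ble (Nv gFD) (Nc 0))
      (seqs [:: CRp gLB (Nv gND) gINP (Nv gK) 1;
        Cn gID (Nv gK) (Nv gND);
        Cs gZ ((Nv gZ /! Na gPW (Nv gLO)) *! Na gPW (Nv gLO +! Nc 1)
               +! Nv gND *! Na gPW (Nv gLO)
               +! (Nv gZ -! (Nv gZ /! Na gPW (Nv gLO)) *! Na gPW (Nv gLO)));
        Cs gND (Nv gND +! Nc 1)]) Cskip) Cskip) (run c1 h4) by [].
set h5 := run c1 h4 in f5 *; clearbody h5.
have n5 a i : ~~ (a \in gFD :: gDG :: gLO :: [::]) -> ~~ fr a -> na h5 a i = na h a i.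
  move=> + fa; rewrite !inE !negb_or => /and3P[/negbTE a1 a2 a3].
  by have [-> _] := f5 a i a2; rewrite /h4 /= a1 /= n3.
have r5 a i : ~~ fr a -> ra h5 a i = ra h a i.
  move=> fa; have [|_ ->] := f5 a i; last by rewrite /h4 /= r3.
  by apply: contraNneq fa => ->.
have lo5 : na h5 gLO 0 = p by have [->] := f5 gLO 0 isT.
have fd5 : na h5 gFD 0 = 0 by have [->] := f5 gFD 0 isT.
set hh := run _ h5.
have -> : hh = setn (setn (setn (setr h5 gLB (size dl) v) gID k (size dl))
   gZ 0 (enc M (take p ds ++ size dl :: drop p ds))) gND 0 (size dl).+1.
  rewrite /hh /= fd5 leqnn /= !(n5 gND) // !(n5 gK) // !(n5 gZ) // !(n5 gPW) // eN !r5 // eK eI expr1 lo5 addn1 -(addn1 (size dl)).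
  by rewrite !eP ?Z -?enc_insert //; lia.
clear hh.
exists (rcons dl v), (take p ds ++ size dl :: drop p ds); split.
- split; last 1 first.
  + by move=> w; rewrite mem_rcons inE -addn1 iotaD map_cat mem_cat mdl !inE orbC.
  + by split; [rewrite /= n5|move=> j; rewrite /= r5|move=> j /eP <-; rewrite /= n5|rewrite /= n5].
  + by rewrite rcons_uniq vdl.
- split.
  + by rewrite size_cat /= size_takel // size_drop size_rcons addnS subnKC // sz.
  + by rewrite /= size_rcons.
  + by rewrite size_rcons; lia.
  + move=> i; rewrite size_rcons ltnS leq_eqVlt => /orP[/eqP->|il] /=.
      by rewrite eqxx nth_rcons ltnn eqxx.
    by rewrite (ltn_eqF il) nth_rcons il r5 // LB.
  + move=> j; rewrite ltnS leq_eqVlt => /orP[/eqP->|jk] /=.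
      by rewrite eqxx -/v -cats1 index_cat (negbTE vdl) /= eqxx addn0.
    rewrite (ltn_eqF jk) n5 // ID // -cats1 index_cat mdl.
    by rewrite (map_f inp) // mem_iota.
- rewrite size_rcons -addn1 iotaD /= add0n.
  apply: perm_trans (_ : perm_eq (size dl :: ds) _).
    by rewrite -[_ :: drop _ _]cat1s perm_catCA cat_take_drop /= perm_refl.
  by rewrite perm_sym perm_catC /= perm_cons perm_sym.
- set f := nth _ _.
  have fds : map f ds = vs.
    apply/eq_in_map => i ids; rewrite /f nth_rcons.
    by have := allP dsM _ ids => /= ->.
  rewrite map_cat /= map_take map_drop fds.
  have -> : f (size dl) = v by rewrite /f nth_rcons ltnn eqxx.
  have szvs : size vs = size ds by rewrite size_map.
  move: srt; rewrite !(sorted_pairwise lt_trans) -{1}(cat_take_drop p vs) !pairwise_cat /=.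
  move=> /and3P[A B C]; rewrite allrel_consr A B C !andbT; apply/andP; split.
    apply/allP => w /(nthP 0%R)[i]; rewrite size_takel ?szvs // => ip <-.
    by rewrite nth_take // low.
  apply/allP => w /(nthP 0%R)[i]; rewrite size_drop szvs => ip <-.
  have pi : p + i < size ds by move: ip; rewrite ltn_subRL.
  rewrite nth_drop lt_neqAle high ?leq_addr // andbT eq_sym vs_dl // vlt //.
  exact: ds_lt.
- by [].
Qed.

Lemma bin_step_cost h : cost bin_step h <= 200.
Proof. by rewrite /bin_step /=; case: ifP => _ //=; case: ifP. Qed.

Lemma dict_step_cost h : cost dict_step h <= 1000 + na h gLG 0 * 205.
Proof.
rewrite /dict_step; do 5 rewrite cost_cons.
set h1 := run (Cs gLO (Nc 0)) h; set h2 := run (Cs gHI _) h1.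
have := @for_cost R gS (Nv gLG) bin_step h2 _ bin_step_cost.
have c5 h' : cost dict_fin h' <= 800.
  by rewrite /dict_fin /=; do 3?(case: ifP => _ /=).
have := c5 (run (Cs gFD (Nc 0)) (run (Cfor gS (Nv gLG) bin_step) h2)).
rewrite (_ : evn h2 (Nv gLG) = na h gLG 0) //.
set X := cost (Cfor _ _ _) _; set Y := cost dict_fin _; move: X Y => X Y /=; lia.
Qed.

Definition dict_pre h := [/\ na h gM 0 = M, na h gLG 0 = 0, na h gND 0 = 0, na h gZ 0 = 0 &
  forall j, ra h gINP j = inp j].

Lemma dict_ok h : 0 < M -> dict_pre h ->
  (exists dl, [/\ uniq dl, size dl <= M, dl =i [seq inp j | j <- iota 0 M],
    forall i, i < size dl -> ra (run dict h) gLB i = nth 0%R dl i &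
    forall j, j < M -> na (run dict h) gID j = index (inp j) dl]) /\
  cost dict h <= 2000 * (M * (2 + trunc_log 2 M)).
Proof.
move=> M0 [eM eL eN eZ eI].
rewrite /dict !cost_cons !run_cons.
set h1 := run (Cn gPW (Nc 0) (Nc 1)) h; set h2 := run (Cfor _ _ _) h1; set h3 := run _ h2.
set h4 := run (Cfor _ _ _) h3; set h5 := run (Cfor _ _ _) h4.
pose I1 q h' := [/\ dict_pre h' & forall j, j <= q -> na h' gPW j = M ^ j].
have H2 : I1 M h2.
  have := @for_inv R I1 gK (Nv gM) (Cn gPW (Nv gK +! Nc 1) (Na gPW (Nv gK) *! Nv gM)) h1.
  rewrite (_ : evn h1 (Nv gM) = M) //; apply=> [|q h' qM [[a1 a2 a3 a4 a5] pw]] /=.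
    by split=> // j; rewrite leqn0 => /eqP->.
  split; first by split.
  by move=> j; rewrite leq_eqVlt /= addn1 => /orP[/eqP->|jq];
    [rewrite eqxx a1 pw // expnSr|rewrite (ltn_eqF jq) pw].
pose I2 q h' := [/\ na h' gM 0 = M, na h' gND 0 = 0, na h' gZ 0 = 0, forall j, ra h' gINP j = inp j &
   forall j, j <= M -> na h' gPW j = M ^ j] /\
   [/\ na h' gP2 0 = 2 ^ na h' gLG 0, 2 ^ na h' gLG 0 <= M * 2 &
     (q < 2 ^ na h' gLG 0) \/ (M < 2 ^ na h' gLG 0)].
have H4 : I2 M h4.
  case: H2 => -[a1 a2 a3 a4 a5] pw.
  have := @for_inv R I2 gK (Nv gM) (Cif (Ble (Nv gP2) (Nv gM))
      (Cseq (Cs gP2 (Nv gP2 *! Nc 2)) (Cs gLG (Nv gLG +! Nc 1))) Cskip) h3.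
  rewrite (_ : evn h3 (Nv gM) = M) //; apply=> [|q h' qM [[b1 b3 b4 b5 b6] [b7 b8 b9]]] /=.
    rewrite /I2 /h3 /= a2 expn0; split=> //; split=> //; first lia.
    by left.
  rewrite b7 b1; case: leqP => le; rewrite /I2 /=; last by split=> //; split=> //; right.
  rewrite addn1 expnSr; split=> //; split=> //; first lia.
  left; move: (expn_gt0 2 (na h' gLG 0)); lia.
case: H4 => -[b1 b3 b4 b5 b6] [b7 b8 b9].
have LG : M < 2 ^ na h4 gLG 0 by case: b9.
have := @for_rule_nat R (fun q h' => dinv q h' /\ na h' gLG 0 = na h4 gLG 0)
  (1000 + na h4 gLG 0 * 205) gK (Nv gM) dict_step h4.
rewrite (_ : evn h4 (Nv gM) = M) //.
case=> [|q h' qM [Iq eLq]|].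
  by split=> //; exists [::], [::]; split.
- split; last by have := dict_step_cost (setn h' gK 0 q); rewrite /= eLq.
  split; last first.
    rewrite -eLq; have [-> //] := @frame R dict_step (setn h' gK 0 q) gLG 0 isT.
  exact: dict_step_ok.
rewrite -/h5 => -[H5 eL5] c5.
split.
  by case: H5 => dl [ds [[st u m] [_ _ z LB ID] _ _ _]]; exists dl.
have lgM : na h4 gLG 0 <= (trunc_log 2 M).+1.
  rewrite -ltnS -(ltn_exp2l (m := 2)) //; apply: leq_ltn_trans b8 _.
  by rewrite expnSr ltn_mul2r /=; exact: trunc_log_ltn.
have c2 := @for_cost R gK (Nv gM) (Cn gPW (Nv gK +! Nc 1) (Na gPW (Nv gK) *! Nv gM)) h1 100.
have {}c2 := c2 (fun _ => isT).
have c4 : cost (Cfor gK (Nv gM) (Cif (Ble (Nv gP2) (Nv gM))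
      (Cseq (Cs gP2 (Nv gP2 *! Nc 2)) (Cs gLG (Nv gLG +! Nc 1))) Cskip)) h3 <= nsz (Nv gM) + 2 + evn h3 (Nv gM) * (5 + 100).
  by apply: for_cost => h' /=; case: ifP.
move: c2 c4 c5; rewrite (_ : evn h1 (Nv gM) = M) // (_ : evn h3 (Nv gM) = M) //.
set X := cost _ _; set Y := cost _ _; set W := cost (Cfor _ _ dict_step) _.
move: X Y W => X Y W /=; nia.
by case: H2 => -[].
Qed.

Definition dict_names : seq nm := [:: gID; gLB; gND; gZ; gPW; gLG; gK; gLO; gHI; gMID; gDG; gFD; gP2; gS].

Lemma dict_wr : all (mem dict_names) (wr dict).
Proof. by []. Qed.
End Dictionary.

Notation "a +! b" := (No NAdd a b) (at level 50, left associativity).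
Notation "a -! b" := (No NSub a b) (at level 50, left associativity).
Notation "a *! b" := (No NMul a b) (at level 40, left associativity).
Notation "a /! b" := (No NDiv a b) (at level 40, left associativity).

Section Multimap.
Variables (R : realType) (B' : nat).
Local Notation B := B'.+1.
Implicit Types (h : hst R) (f : nat -> seq 'I_B).

Lemma idx_eq K K' i j : i < B -> j < B ->
  (K * B + i == K' * B + j) = (K == K') && (i == j).
Proof.
move=> iB jB; apply/eqP/andP => [e|[/eqP-> /eqP->] //].
have := congr1 (divn^~ B) e; rewrite !divnMDl // !divn_small // !addn0 => eK.
by move: e; rewrite eK => /addnI ->; rewrite !eqxx.
Qed.

Section Insert.
Variables (c k p : nm).
Hypotheses (ck : c != k) (cp : c != p) (kp : k != p).

Definition mmrep h f := forall K,
  [/\ uniq (f K), na h c K = size (f K),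
     forall i, i < size (f K) -> na h k (K * B + i) = nth ord0 (f K) i &
     forall x : 'I_B, na h p (K * B + x) = (x \in f K)].

Definition ins (y z : nm) : cmd :=
  Cif (Ble (Na p (Nv y *! Nv gM +! Nv z)) (Nc 0))
   (seqs [:: Cn p (Nv y *! Nv gM +! Nv z) (Nc 1);
             Cn k (Nv y *! Nv gM +! Na c (Nv y)) (Nv z);
             Cn c (Nv y) (Na c (Nv y) +! Nc 1)]) Cskip.

Definition insm f K (x : 'I_B) := fun K' =>
  if (K' == K) && (x \notin f K) then rcons (f K) x else f K'.

Lemma ins_ok h f y z (x : 'I_B) : mmrep h f -> na h gM 0 = B ->
  y \notin [:: c; k; p] -> z \notin [:: c; k; p] -> gM \notin [:: c; k; p] ->
  na h z 0 = x ->
  mmrep (run (ins y z) h) (insm f (na h y 0) x).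
Proof.
move=> mm eB; rewrite !inE !negb_or => /and3P[/negbTE yc /negbTE yk /negbTE yp].
move=> /and3P[/negbTE zc /negbTE zk /negbTE zp] /and3P[/negbTE gc /negbTE gk /negbTE gp] ez.
set K := na h y 0; have [u eN eK eP] := mm K.
rewrite /ins /= -/K ez eB eP.
rewrite leqn0 eqb0; case: ifP => [xn|/negbFE xin] /=; last first.
  move=> K'; have := mm K'; rewrite /insm; case: eqP => [->|_] //=.
  by rewrite xin.
rewrite ?gp ?yp ?zp ?yk ?gk ?zk ?(negbTE cp) ?(negbTE ck) /= -?/K ?ez ?eB ?eN.
have szB : size (f K) < B.
  have /card_uniqP/= E : uniq (x :: f K) by rewrite /= xn u.
  by rewrite -[X in _ < X]card_ord -ltnS -[X in X < _]E ltnS max_card.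
move=> K'; have [u' eN' eK' eP'] := mm K'.
rewrite /insm xn andbT; case: (eqVneq K' K) => [EK|nK].
  subst K'; split.
  - by rewrite rcons_uniq xn.
  - by rewrite /= !eqxx addn1 size_rcons.
  - move=> i; rewrite size_rcons ltnS => il /=.
    rewrite (negbTE kp) /= [k == c]eq_sym (negbTE ck) /= eqxx idx_eq //; last exact: leq_ltn_trans il szB.
    rewrite eqxx /= nth_rcons; move: il; rewrite leq_eqVlt => /orP[/eqP->|il].
      by rewrite ltnn eqxx.
    by rewrite il (ltn_eqF il) eK.
  - move=> w /=; rewrite [p == c]eq_sym (negbTE cp) [p == k]eq_sym (negbTE kp) /= eqxx.
    rewrite idx_eq // eqxx /= mem_rcons inE eP -val_eqE.
    by case: eqP.
split=> //.
- by rewrite /= (negbTE nK) andbF (negbTE cp) (negbTE ck).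
- move=> i il /=; rewrite [k == c]eq_sym (negbTE ck) /= eqxx idx_eq //; last first.
    apply: leq_trans il _; rewrite -(card_uniqP u') -[X in _ <= X]card_ord; exact: max_card.
  by rewrite (negbTE nK) (negbTE kp) eK'.
- move=> w /=; rewrite [p == c]eq_sym (negbTE cp) [p == k]eq_sym (negbTE kp) /= eqxx.
  by rewrite idx_eq // (negbTE nK) eP'.
Qed.

Lemma ins_cost h y z : cost (ins y z) h <= 200.
Proof. by rewrite /ins /=; case: ifP. Qed.

Lemma ins_wr y z : wr (ins y z) = [:: p; k; c].
Proof. by []. Qed.

Lemma mmrep_eq h h' f : mmrep h f ->
  (forall a i, a \in [:: c; k; p] -> na h' a i = na h a i) -> mmrep h' f.
Proof.
move=> mm E K; have [u eN eK eP] := mm K.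
by split=> // [|i /eK|x]; rewrite E ?inE ?eqxx ?orbT.
Qed.

Lemma mmrep0 h : (forall a i, a \in [:: c; k; p] -> na h a i = 0) -> mmrep h (fun=> [::]).
Proof. by move=> E K; split=> // [|x]; rewrite E // ?inE ?eqxx ?orbT. Qed.
End Insert.

Definition mmfold (l : seq (nat * 'I_B)) := foldl (fun f it => insm f it.1 it.2) (fun=> [::]) l.

Lemma mmfold_rcons l K x : mmfold (rcons l (K, x)) = insm (mmfold l) K x.
Proof. by rewrite /mmfold foldl_rcons. Qed.

Lemma mem_mmfold l K x : (x \in mmfold l K) = ((K, x) \in l).
Proof.
elim/last_ind: l K x => [|l [K0 x0] IH] K x //.
rewrite mmfold_rcons /insm mem_rcons inE xpair_eqE.
case: eqP => [->|_] /=; last by rewrite IH.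
case: ifP => [_|/negbFE]; first by rewrite mem_rcons inE IH.
by rewrite IH => x0l; case: eqP => [->|_]; rewrite IH ?x0l.
Qed.
End Multimap.

Section Codes.
Variables (X : finType) (B' : nat).
Local Notation B := B'.+1.

Definition code (s : seq X) (t : X -> 'I_B) : nat := foldl (fun a x => a * B + t x) 0 s.

Lemma code_rcons s x t : code (rcons s x) t = code s t * B + t x.
Proof. by rewrite /code foldl_rcons. Qed.

Lemma code_inj s t t' : (code s t == code s t') = all (fun x => t x == t' x) s.
Proof.
elim/last_ind: s => [|s x IH] //.
by rewrite !code_rcons idx_eq // IH all_rcons andbC.
Qed.

Lemma eq_code s t t' : {in s, t =1 t'} -> code s t = code s t'.
Proof. by move=> E; apply/eqP; rewrite code_inj; apply/allP => x /E ->. Qed.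
End Codes.

Section Trie.
Variables (R : realType) (X : finType) (E : {set {set X}}) (B' : nat).
Local Notation B := B'.+1.
Variables (sz : {set X} -> nat) (rv : {set X} -> nat -> X -> 'I_B) (pos : {set X} -> X -> nat).
Implicit Types (h : hst R) (F : {set X}) (x : X).

Definition pkF F : nat := choice.pickle F.
Definition pkX x : nat := choice.pickle x.
Lemma pkF_inj : injective pkF. Proof. exact: (pcan_inj (@choice.pickleK _)). Qed.
Lemma pkX_inj : injective pkX. Proof. exact: (pcan_inj (@choice.pickleK _)). Qed.

Definition gSZ F : nm := [:: 16; 0; pkF F].
Definition gOFF F : nm := [:: 17; 0; pkF F].
Definition gKE : nat := (\max_(F in E) pkF F).+1.

Lemma pkF_lt F : F \in E -> pkF F < gKE.
Proof. by move=> FE; rewrite ltnS (bigD1 F) //= leq_maxl. Qed.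

Definition stat h := na h gM 0 = B /\ forall F, F \in E -> na h (gSZ F) 0 = sz F /\
  forall r x, r < sz F -> x \in F ->
    na h gID (na h (gOFF F) 0 + r * #|F| + pos F x) = rv F r x.

Definition own q (a : nm) := (2 < size a) && (nth 0 a 1 == q).
Definition own2 q v (a : nm) := own q a && (nth 0 a 2 == v).

Lemma stat_eq h h' : stat h -> (forall a i, a \in [:: gM; gID] -> na h' a i = na h a i) ->
  (forall F, na h' (gSZ F) 0 = na h (gSZ F) 0) -> (forall F, na h' (gOFF F) 0 = na h (gOFF F) 0) -> stat h'.
Proof.
move=> [eM S] A eS eO; split=> [|F /S[s r]]; first by rewrite A.
by rewrite eS s; split=> // r0 x r0s xF; rewrite eO A ?r.
Qed.

Lemma stat_frame q h c : stat h -> 0 < q -> all (own q) (wr c) -> stat (run c h).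
Proof.
move=> S q0 w; have nq : (0 == q) = false by case: (q) q0.
apply: stat_eq S _ _ _ => [a i|F|F].
- rewrite !inE => /orP[/eqP->|/eqP->].
    by have [] := @frameP R _ c h gM i w isT.
  by have [] := @frameP R _ c h gID i w isT.
- by have [] := @frameP R _ c h (gSZ F) 0 w; rewrite // /own /= nq.
- by have [] := @frameP R _ c h (gOFF F) 0 w; rewrite // /own /= nq.
Qed.

Variables (q v : nat) (us : seq X).
Hypotheses (q0 : 0 < q) (uus : uniq us).

Definition T1 x : nm := [:: 1; q; v; pkX x].
Definition T2 x : nm := [:: 2; q; v; pkX x].
Definition T3 x : nm := [:: 3; q; v; pkX x].
Definition tRK : nm := [:: 10; q; v].
Definition tCODE : nm := [:: 11; q; v].
Definition tBASE : nm := [:: 12; q; v].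
Definition tC : nm := [:: 13; q; v].
Definition tKEY : nm := [:: 14; q; v].

Definition fs F := [seq y <- us | y \in F].
Definition pre x := take (index x us) us.
Definition key F (p : seq X) (t : X -> 'I_B) := code [seq y <- p | y \in F] t * gKE + pkF F.
Definition agr F (p : seq X) (t : X -> 'I_B) r := all (fun y => (y \in F) ==> (rv F r y == t y)) p.

Definition trie_step F x : cmd :=
  seqs [:: Cs tC (Na gID (Nv tBASE +! Nc (pos F x)));
           Cs tKEY (Nv tCODE *! Nc gKE +! Nc (pkF F));
           ins (T1 x) (T2 x) (T3 x) tKEY tC;
           Cs tCODE (Nv tCODE *! Nv gM +! Nv tC)].
Definition trie_row F : cmd :=
  Cseq (Cseq (Cs tCODE (Nc 0)) (Cs tBASE (Nv (gOFF F) +! Nv tRK *! Nc #|F|)))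
       (seqs (map (trie_step F) (fs F))).
Definition trie : cmd :=
  seqs [seq Cfor tRK (Nv (gSZ F)) (trie_row F) | F <- enum E].

Definition items x (l : seq ({set X} * nat * X)) :=
  [seq (key t.1.1 (pre x) (rv t.1.1 t.1.2), rv t.1.1 t.1.2 x) | t <- l & t.2 == x].

Definition tinv l h := stat h /\ forall x, mmrep (T1 x) (T2 x) (T3 x) h (mmfold (items x l)).

Lemma filter_pre (a : pred X) x (s : seq X) : x \in s -> a x ->
  [seq y <- take (index x s) s | a y] = take (index x [seq y <- s | a y]) [seq y <- s | a y].
Proof.
move=> + ax; elim: s => // y s IH; rewrite inE.
case: (eqVneq y x) => [->|nyx] /=; first by rewrite ax /= eqxx.
move=> /IH E'.
by rewrite (negbTE nyx) /=; case: ifP => ay /=; rewrite ?(negbTE nyx) E'.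
Qed.

Lemma pre_fs F p x post : fs F = p ++ x :: post -> [seq y <- pre x | y \in F] = p.
Proof.
move=> e; have : x \in fs F by rewrite e mem_cat inE eqxx orbT.
rewrite mem_filter => /andP[xF xus].
rewrite /pre (filter_pre (a := mem F)) //= -/(fs F) e.
have := filter_uniq (mem F) uus; rewrite -/(fs F) e cat_uniq /= negb_or.
move=> /and3P[_ /andP[xp _] _].
by rewrite index_cat (negbTE xp) /= eqxx addn0 take_size_cat.
Qed.

Lemma trie_wr : all (own2 q v) (wr trie).
Proof.
rewrite wr_seqs; apply/allP => F _ /=; rewrite /own2 /own /= !eqxx /=.
rewrite wr_seqs; apply/allP => x _ /=.
by rewrite /own2 /own /= !eqxx.
Qed.

Lemma trie_step_ok F r l p x post h : F \in E -> r < sz F -> fs F = p ++ x :: post ->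
  tinv l h -> na h tCODE 0 = code p (rv F r) ->
  na h tBASE 0 = na h (gOFF F) 0 + r * #|F| ->
  let h' := run (trie_step F x) h in
  [/\ tinv (rcons l (F, r, x)) h', na h' tCODE 0 = code (rcons p x) (rv F r)
    & na h' tBASE 0 = na h' (gOFF F) 0 + r * #|F|].
Proof.
move=> FE rF efs [S mm] eC eB h'.
have xF : x \in F.
  have : x \in fs F by rewrite efs mem_cat inE eqxx orbT.
  by rewrite mem_filter => /andP[].
have wrE : wr (trie_step F x) = [:: tC; tKEY; T3 x; T2 x; T1 x; tCODE] by [].
have S' : stat h'.
  apply: stat_frame S q0 _; rewrite wrE /own /=; by rewrite !eqxx.
set h2 := run (Cseq (Cs tC (Na gID (Nv tBASE +! Nc (pos F x))))
           (Cs tKEY (Nv tCODE *! Nc gKE +! Nc (pkF F)))) h.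
have eM : na h2 gM 0 = B by case: S.
have ez : na h2 tC 0 = rv F r x.
  rewrite /h2 /= ?eqxx /= eB; by case: S => _ /(_ F FE)[_ ->].
have ey : na h2 tKEY 0 = key F (pre x) (rv F r).
  by rewrite /h2 /= !eqxx /= /key (pre_fs efs) eC.
have mm2 y : mmrep (T1 y) (T2 y) (T3 y) h2 (mmfold (items y l)).
  by apply: mmrep_eq (mm y) _ => a i; rewrite !inE => /or3P[] /eqP->.
set h3 := run (ins (T1 x) (T2 x) (T3 x) tKEY tC) h2.
have h'E : h' = run (Cs tCODE (Nv tCODE *! Nv gM +! Nv tC)) h3 by [].
have f3 a i : a \notin [:: T3 x; T2 x; T1 x] -> na h3 a i = na h2 a i.
  by move=> aw; have [] := @frame R (ins (T1 x) (T2 x) (T3 x) tKEY tC) h2 a i aw.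
split.
- split=> // y; apply: (mmrep_eq (h := h3)); last first.
    by move=> a i; rewrite !inE h'E => /or3P[] /eqP->.
  rewrite /items filter_rcons /=; case: eqVneq => [<-|nxy].
    rewrite map_rcons /= mmfold_rcons -ey; apply: ins_ok => //.
  apply: mmrep_eq (mm2 y) _ => a i; rewrite !inE => ay; apply: f3; apply: contraNN nxy.
  rewrite !inE => ax; apply/eqP/pkX_inj.
  by case/or3P: ay ax => /eqP-> /or3P[] /eqP[].
- rewrite h'E /= !eqxx /= !f3 // ez eM code_rcons.
  by rewrite /h2 /= eC.
- by rewrite h'E /= !f3.
Qed.

Lemma trie_step_cost F x h : cost (trie_step F x) h <= 300.
Proof.
rewrite /trie_step; do 4 rewrite cost_cons.
have := @ins_cost R (T1 x) (T2 x) (T3 x) (run (Cs tKEY (Nv tCODE *! Nc gKE +! Nc (pkF F)))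
  (run (Cs tC (Na gID (Nv tBASE +! Nc (pos F x)))) h)) tKEY tC.
set A := cost (ins _ _ _ _ _) _; move: A => A /=; lia.
Qed.

Definition Lrow F (r : nat) := [seq (F, r, x) | x <- fs F].

Lemma trie_row_ok F r l h : F \in E -> r < sz F -> tinv l h -> na h tRK 0 = r ->
  tinv (l ++ Lrow F r) (run (trie_row F) h) /\ cost (trie_row F) h <= 100 + size us * 300.
Proof.
move=> FE rF tl eR.
pose I p h := [/\ tinv (l ++ [seq (F, r, x) | x <- p]) h, na h tCODE 0 = code p (rv F r)
    & na h tBASE 0 = na h (gOFF F) 0 + r * #|F|].
set h1 := run (Cseq (Cs tCODE (Nc 0)) (Cs tBASE (Nv (gOFF F) +! Nv tRK *! Nc #|F|))) h.
have I1 : I [::] h1.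
  have [S mm] := tl; split.
  - rewrite cats0; split; last first.
      move=> x; apply: mmrep_eq (mm x) _ => a i.
      by rewrite !inE => /or3P[] /eqP->.
    by apply: stat_frame S q0 _; rewrite /= /own /= !eqxx.
  - by rewrite /h1 /= !eqxx.
  - by rewrite /h1 /= !eqxx /= eR.
have [|A C] := @seqs_rule R X (trie_step F) (fs F) I (fun=> 300) h1 I1.
  move=> p x post h' e [t' c' b']; have [A B C] := trie_step_ok FE rF e t' c' b'.
  split; last exact: trie_step_cost.
  by split=> //; rewrite map_rcons -rcons_cat.
split; first by case: A.
have -> : cost (trie_row F) h = cost (Cseq (Cs tCODE (Nc 0)) (Cs tBASE (Nv (gOFF F) +! Nv tRK *! Nc #|F|))) h
   + cost (seqs (map (trie_step F) (fs F))) h1 by [].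
apply: leq_add => //; apply: leq_trans C _; rewrite big_const_seq count_predT iter_addn_0 mulnC leq_mul2r /=.
by rewrite size_filter count_size.
Qed.

Definition Ltrie := flatten [seq flatten [seq Lrow F r | r <- iota 0 (sz F)] | F <- enum E].

Lemma trie_inv h : tinv [::] h -> tinv Ltrie (run trie h) /\
  cost trie h <= \sum_(F <- enum E) (20 + sz F * (105 + size us * 300)).
Proof.
move=> t0.
pose I p h := tinv (flatten [seq flatten [seq Lrow F r | r <- iota 0 (sz F)] | F <- p]) h.
apply: (seqs_rule (I := I)) => // p F post h' e Ip.
have FE : F \in E by rewrite -mem_enum e mem_cat inE eqxx orbT.
have eS : evn h' (Nv (gSZ F)) = sz F by case: Ip => -[_ /(_ F FE)[]].
rewrite /I map_rcons flatten_rcons.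
set l := flatten _ in Ip *.
have := @for_rule_nat R (fun k => tinv (l ++ flatten [seq Lrow F r | r <- iota 0 k]))
  (100 + size us * 300) tRK (Nv (gSZ F)) (trie_row F) h'.
rewrite eS => -[|k h2 ks t2|A C]; first by rewrite cats0.
- rewrite -addn1 iotaD map_cat flatten_cat /= cats0 catA add0n.
  by apply: trie_row_ok => //; rewrite /= eqxx.
split=> //; apply: leq_trans C _; rewrite /= addnA; lia.
Qed.

Lemma mem_items x F t (c : 'I_B) : x \in us -> F \in E -> x \in F ->
  (c \in mmfold (items x Ltrie) (key F (pre x) t)) =
  has (fun r => agr F (pre x) t r && (rv F r x == c)) (iota 0 (sz F)).
Proof.
move=> xus FE xF; rewrite mem_mmfold; apply/mapP/hasP => [[[[F' r] y]]|[r]].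
  rewrite mem_filter /= => /andP[/eqP-> /flattenP[s /mapP[F0 F0E ->]]].
  move=> /flattenP[s' /mapP[r0 + ->] /mapP[y' y'F [e1 e2 e3]]]; subst F0 r0 y'.
  rewrite mem_iota add0n /= => rF [+ ->].
  have F'E : F' \in E by rewrite -mem_enum.
  rewrite /key => /eqP; rewrite eq_sym.
  have kd : forall a b, a * gKE + pkF F' = b * gKE + pkF F -> F' = F /\ a = b.
    move=> a b e; have ab : a = b.
      have := congr1 (divn^~ gKE) e; rewrite !divnMDl // !divn_small ?pkF_lt // !addn0.
      by [].
    by move: e; rewrite ab => /addnI /pkF_inj.
  move=> /eqP /kd[e1 /eqP]; subst F'; rewrite code_inj all_filter => ag.
  by exists r; rewrite ?mem_iota // eqxx andbT; exact: ag.
rewrite mem_iota add0n /= => rF /andP[ag /eqP rc].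
exists (F, r, x); last first.
  rewrite /= rc; congr (_ * _ + _, _); apply/eqP.
  by rewrite eq_sym code_inj all_filter.
rewrite mem_filter /= eqxx /=; apply/flattenP.
exists (flatten [seq Lrow F r | r <- iota 0 (sz F)]).
  by apply/mapP; exists F; rewrite ?mem_enum.
apply/flattenP; exists (Lrow F r); first by apply/mapP; exists r; rewrite ?mem_iota.
by apply/mapP; exists x => //; rewrite mem_filter xF.
Qed.
End Trie.

Section AGM.
Variables (R : realType) (X : finType) (E : {set {set X}}) (B' : nat).
Local Notation B := B'.+1.
Notation asg := {ffun X -> 'I_B}.
Variables (sz : {set X} -> nat) (rv : {set X} -> nat -> X -> 'I_B).
Implicit Types (F : {set X}) (x : X) (t : asg) (c : 'I_B) (p : seq X).

Definition upd t x c : asg := [ffun y => if y == x then c else t y].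

Definition nF F p t : nat := count (agr rv F p t) (iota 0 (sz F)).

Definition Nd p t : bool := [forall F in E, 0 < nF F p t].

Lemma agr_upd F p x t c r : x \notin p ->
  agr rv F (rcons p x) (upd t x c) r = agr rv F p t r && ((x \in F) ==> (rv F r x == c)).
Proof.
move=> xp; rewrite /agr all_rcons ffunE eqxx andbC; congr andb.
by apply: eq_in_all => y yp; rewrite ffunE (_ : (y == x) = false) //; apply/negbTE; apply: contraNneq xp => <-.
Qed.

Lemma nF_upd F p x t c : x \notin p -> x \notin F -> nF F (rcons p x) (upd t x c) = nF F p t.
Proof.
move=> xp xF; apply: eq_in_count => r _.
by rewrite agr_upd // (negbTE xF) andbT.
Qed.

Lemma nF_sum F p x t : x \notin p -> x \in F -> \sum_c nF F (rcons p x) (upd t x c) = nF F p t.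
Proof.
move=> xp xF; rewrite /nF.
under eq_bigr => c _ do under eq_count => r do rewrite agr_upd // xF /=.
elim: (iota _ _) => [|r s IH] /=; first by rewrite big1.
rewrite big_split /= IH; congr addn.
case: (agr _ _ _ _ _) => /=; last by rewrite big1.
by rewrite (bigD1 (rv F r x)) //= eqxx big1 // => c; rewrite eq_sym => /negbTE->.
Qed.

Lemma nF_le F p x t c : x \notin p -> nF F (rcons p x) (upd t x c) <= nF F p t.
Proof. by move=> xp; apply: sub_count => r; rewrite agr_upd // => /andP[]. Qed.

Lemma Nd_upd p x t c : x \notin p -> Nd p t ->
  Nd (rcons p x) (upd t x c) =
  [forall F in E, (x \in F) ==> has (fun r => agr rv F p t r && (rv F r x == c)) (iota 0 (sz F))].
Proof.
move=> xp /forall_inP N; apply: eq_forallb => F; case: (boolP (F \in E)) => //= FE.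
case: (boolP (x \in F)) => xF /=; last by rewrite nF_upd // N.
rewrite /nF -has_count; apply: eq_has => r; by rewrite agr_upd // xF.
Qed.

Lemma eq_agr F p t t' r : {in p, t =1 t'} -> agr rv F p t r = agr rv F p t' r.
Proof. by move=> e; apply: eq_in_all => y /e ->. Qed.

Lemma eq_nF F p t t' : {in p, t =1 t'} -> nF F p t = nF F p t'.
Proof. by move=> e; apply: eq_count => r; exact: eq_agr. Qed.

Lemma eq_Nd p t t' : {in p, t =1 t'} -> Nd p t = Nd p t'.
Proof. by move=> e; apply: eq_forallb => F; rewrite (eq_nF F e). Qed.

Lemma Nd_cat p p' t : Nd (p ++ p') t -> Nd p t.
Proof.
move=> /forall_inP N; apply/forall_inP => F /N /leq_trans; apply.
by apply: sub_count => r; rewrite /agr all_cat => /andP[].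
Qed.

Local Open Scope ring_scope.

Variable lam : {set X} -> R.
Hypothesis lam0 : forall F, F \in E -> 0 <= lam F.

(* Weighted AM-GM, from expR y >= 1 + y at the tangent point. *)
Lemma amgm (P : pred {set X}) (s : {set X} -> R) :
  1 <= \sum_(F in E | P F) lam F -> (forall F, s F <= 0) ->
  expR (\sum_(F in E | P F) lam F * s F) <=
  \sum_(F in E | P F) (lam F / \sum_(F in E | P F) lam F) * expR (s F).
Proof.
set L := \sum_(_ in _ | _) _ => L1 s0.
have Lp : 0 < L by apply: lt_le_trans L1.
set m := \sum_(F in E | P F) (lam F / L) * s F.
apply: (@le_trans _ _ (expR m)).
  rewrite ler_expR; apply: ler_sum => F /andP[FE _].
  rewrite ler_wnM2r // ler_pdivrMr // ler_peMr //; exact: lam0.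
have -> : expR m = \sum_(F in E | P F) (lam F / L) * (expR m * (1 + (s F - m))).
  under eq_bigr => F _ do rewrite mulrCA.
  rewrite -mulr_sumr.
  under eq_bigr => F _ do rewrite mulrDr mulr1 mulrBr.
  have L1' : \sum_(F in E | P F) lam F / L = 1 by rewrite -mulr_suml divff ?gt_eqF.
  by rewrite big_split /= sumrB -/m L1' -mulr_suml L1' mul1r subrr addr0 mulr1.
apply: ler_sum => F /andP[FE _]; apply: ler_wpM2l.
  by rewrite divr_ge0 ?lam0 // ltW.
rewrite -[X in _ <= expR X](subrK m) expRD [X in _ <= X]mulrC.
by rewrite ler_pM2l ?expR_gt0 // expR_ge1Dx.
Qed.

Definition Phi p t : R := \prod_(F in E) (nF F p t)%:R `^ lam F.

Lemma Phi_ge1 p t : Nd p t -> 1 <= Phi p t.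
Proof.
move=> /forall_inP N; rewrite /Phi; apply: (big_ind (fun z => 1 <= z)) => // [a b a1 b1|F FE].
  by rewrite -[1]mulr1; apply: ler_pM.
have := @ler_powR R (nF F p t)%:R _ 0 (lam F) (lam0 FE); rewrite powRr0; apply.
by rewrite ler1n N.
Qed.

Lemma agm_step p x t : x \notin p -> Nd p t -> 1 <= \sum_(F in E | x \in F) lam F ->
  \sum_(c | Nd (rcons p x) (upd t x c)) Phi (rcons p x) (upd t x c) <= Phi p t.
Proof.
move=> xp N L1; have /forall_inP Np := N.
set L := \sum_(_ in _ | _) _ in L1.
have Lp : 0 < L by apply: lt_le_trans L1.
pose w F := lam F / L.
have step c : Nd (rcons p x) (upd t x c) -> Phi (rcons p x) (upd t x c) <=
   Phi p t * \sum_(F in E | x \in F) w F * ((nF F (rcons p x) (upd t x c))%:R / (nF F p t)%:R).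
  move=> /forall_inP Nc.
  pose s F : R := if F \in E then ln ((nF F (rcons p x) (upd t x c))%:R / (nF F p t)%:R) else 0.
  have rp F : F \in E -> (0 : R) < (nF F (rcons p x) (upd t x c))%:R / (nF F p t)%:R.
    by move=> FE; rewrite divr_gt0 // ltr0n ?Nc ?Np.
  have s0 F : s F <= 0.
    rewrite /s; case: ifP => // FE; rewrite -ln1 ler_ln ?posrE ?ltr01 ?rp //.
    by rewrite ler_pdivrMr ?ltr0n ?Np // mul1r ler_nat nF_le.
  have -> : Phi (rcons p x) (upd t x c) =
    Phi p t * expR (\sum_(F in E | x \in F) lam F * s F).
    rewrite expR_sum /Phi (bigID (fun F : {set X} => x \in F)) /=.
    rewrite [in RHS](bigID (fun F : {set X} => x \in F)) /= [RHS]mulrAC.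
    congr (_ * _); last by apply: eq_bigr => F /andP[FE xF]; rewrite nF_upd.
    rewrite -big_split /=; apply: eq_bigr => F /andP[FE xF].
    rewrite /s FE (mulrC (lam F)) expRM lnK ?posrE ?rp // -powRM ?ler0n ?(ltW (rp F FE)) //.
    by rewrite mulrC divfK // pnatr_eq0 -lt0n Np.
  apply: ler_wpM2l; first exact: le_trans (Phi_ge1 N).
  apply: le_trans (amgm L1 s0) _; apply: ler_sum => F /andP[FE xF].
  by rewrite /s FE lnK ?posrE ?rp.
apply: (le_trans (ler_sum _ step)).
rewrite -mulr_sumr -[X in _ <= X]mulr1; apply: ler_wpM2l; first exact: le_trans (Phi_ge1 N).
rewrite exchange_big /=.
apply: (@le_trans _ _ (\sum_(F in E | x \in F) w F)).
  apply: ler_sum => F /andP[FE xF]; rewrite -mulr_sumr -[X in _ <= X]mulr1.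
  apply: ler_wpM2l; first by rewrite divr_ge0 ?lam0 // ltW.
  rewrite -mulr_suml ler_pdivrMr ?ltr0n ?Np // mul1r -(nF_sum t xp xF) natr_sum.
  rewrite [X in _ <= X](bigID (fun c => Nd (rcons p x) (upd t x c))) /= lerDl.
  by apply: sumr_ge0 => c _; rewrite ler0n.
by rewrite -mulr_suml divff ?gt_eqF.
Qed.

Lemma min_le_Phi p x t (b : nat) : Nd p t -> 1 <= \sum_(F in E | x \in F) lam F ->
  (forall F, F \in E -> x \in F -> (b <= nF F p t)%N) -> b%:R <= Phi p t.
Proof.
move=> N L1 bF; have /forall_inP Np := N.
case: (posnP b) => [->|b0]; first by apply: le_trans (Phi_ge1 N).
rewrite /Phi (bigID (fun F : {set X} => x \in F)) /= -[b%:R]mulr1.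
apply: ler_pM => //; last first.
  apply: (big_ind (fun z => 1 <= z)) => // [c d c1 d1|F /andP[FE _]].
    by rewrite -[1]mulr1; apply: ler_pM.
  have := @ler_powR R (nF F p t)%:R _ 0 (lam F) (lam0 FE); rewrite powRr0; apply.
  by rewrite ler1n Np.
apply: (@le_trans _ _ (\prod_(F in E | x \in F) b%:R `^ lam F)).
  have -> : \prod_(F in E | x \in F) b%:R `^ lam F = b%:R `^ (\sum_(F in E | x \in F) lam F) :> R.
    apply: (big_ind2 (fun u v => u = b%:R `^ v)) => [|u u' w w' -> ->|//]; first by rewrite powRr0.
    by rewrite powRD // pnatr_eq0 -lt0n b0 implybT.
  by have := @ler_powR R b%:R _ 1 _ L1; rewrite powRr1 ?ler0n //; apply; rewrite ler1n.
apply: ler_prod => F /andP[FE xF]; rewrite powR_ge0 /=.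
by rewrite ge0_ler_powR ?lam0 ?nnegrE ?ler0n // ler_nat bF.
Qed.

Lemma Phi0_le t N : (forall F, F \in E -> (0 < sz F <= N)%N) ->
  Phi [::] t <= N%:R `^ (\sum_(F in E) lam F).
Proof.
move=> szN; case: (set_0Vmem E) => [E0|[F0 F0E]].
  by rewrite /Phi E0 !big_set0 powRr0.
have N0 : (0 < N)%N by have /andP[/leq_trans] := szN _ F0E; apply.
have -> : N%:R `^ (\sum_(F in E) lam F) = \prod_(F in E) N%:R `^ lam F :> R.
  apply: (big_ind2 (fun u v => N%:R `^ u = v)) => [|u u' w w' <- <-|//]; first by rewrite powRr0.
  by rewrite powRD // pnatr_eq0 -lt0n N0 implybT.
apply: ler_prod => F FE; rewrite powR_ge0 /=.
rewrite ge0_ler_powR ?lam0 ?nnegrE ?ler0n // ler_nat /nF count_predT size_iota.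
by have /andP[] := szN _ FE.
Qed.
End AGM.

Lemma arith_body a b e u : a <= 80 -> b <= e * 60 -> a + (b + (1 + 6 + 1 + u)) <= 100 + e * 60 + u.
Proof. lia. Qed.
Lemma arith_upd e a b : a <= e * 40 -> 100 + e * 60 + (a + b) <= 160 + 60 * e + 40 * e + b.
Proof. lia. Qed.
Lemma arith_skip e : 100 + e * 60 + 0 <= 160 + 60 * e.
Proof. lia. Qed.

Lemma arith_level (K : realFieldType) (a f s C u w z : K) :
  (0 <= a -> 0 <= C -> 1 <= f -> 0 <= s <= f -> u <= 20 + a * 60 -> w <= 13 + (s * (165 + 60 * a) + z) ->
  z <= (40 * a + C) * f -> u + w <= (C + 400 * (a + 1)) * f)%R.
Proof. nra. Qed.

Section BagDfs.
Variables (R : realType) (X : finType) (E : {set {set X}}) (B' : nat).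
Local Notation B := B'.+1.
Notation asg := {ffun X -> 'I_B}.
Variables (sz : {set X} -> nat) (rv : {set X} -> nat -> X -> 'I_B) (pos : {set X} -> X -> nat).
Variables (q v : nat).
Hypothesis q0 : 0 < q.
Implicit Types (h : hst R) (F : {set X}) (x : X) (t : asg) (c : 'I_B) (p : seq X) (d : nat).

Definition dCODE d F : nm := [:: 20; q; v; d; pkF F].
Definition dBK d : nm := [:: 21; q; v; d].
Definition dK d : nm := [:: 22; q; v; d].
Definition dVAL d : nm := [:: 23; q; v; d].
Definition dOK d : nm := [:: 24; q; v; d].
Definition dKEY d F : nexp := Nv (dCODE d F) *! Nc (gKE E) +! Nc (pkF F).
Definition edges x := [seq F : {set X} <- enum E | x \in F].

Definition c_sel1 d x F : cmd :=
  Cif (Ble (Na (T1 q v x) (dKEY d F)) (Na (T1 q v x) (Nv (dBK d.+1))))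
          (Cs (dBK d.+1) (dKEY d F)) Cskip.
Definition c_sel d x : cmd :=
 Cseq (Cs (dBK d.+1) (dKEY d (head finset.set0 (edges x)))) (seqs (map (c_sel1 d x) (edges x))).
Definition c_pick d x : cmd :=
  Cseq (Cs (dVAL d.+1) (Na (T2 q v x) (Nv (dBK d.+1) *! Nv gM +! Nv (dK d.+1)))) (Cs (dOK d.+1) (Nc 1)).
Definition c_chk1 d x F : cmd :=
  Cs (dOK d.+1) (Nv (dOK d.+1) *! Na (T3 q v x) (dKEY d F *! Nv gM +! Nv (dVAL d.+1))).
Definition c_chk d x : cmd := seqs (map (c_chk1 d x) (edges x)).
Definition c_upd1 d x (F : {set X}) : cmd :=
  Cs (dCODE d.+1 F) (if x \in F then Nv (dCODE d F) *! Nv gM +! Nv (dVAL d.+1) else Nv (dCODE d F)).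
Definition c_upd d x : cmd := seqs (map (c_upd1 d x) (enum E)).
Definition c_body d x (body : cmd) : cmd :=
  Cseq (c_pick d x) (Cseq (c_chk d x)
    (Cif (Ble (Nc 1) (Nv (dOK d.+1))) (Cseq (c_upd d x) body) Cskip)).
Definition lev d x (body : cmd) : cmd :=
  Cseq (c_sel d x) (Cfor (dK d.+1) (Na (T1 q v x) (Nv (dBK d.+1))) (c_body d x body)).

Fixpoint dfs d (us : seq X) (leaf : cmd) : cmd :=
  if us is x :: us' then lev d x (dfs d.+1 us' leaf) else leaf.

Definition W d (a : nm) := own2 q v a &&
  ((30 <= nth 0 a 0) || (20 <= nth 0 a 0) && (d < nth 0 a 3)).

Definition eqoff (P : pred nm) h h' := forall a i, ~~ P a ->
  na h' a i = na h a i /\ ra h' a i = ra h a i.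

Lemma eqoff_trans P h1 h2 h3 : eqoff P h1 h2 -> eqoff P h2 h3 -> eqoff P h1 h3.
Proof. by move=> A A' a i Pa; have [-> ->] := A' a i Pa; apply: A. Qed.
Lemma eqoff_sub (P P' : pred nm) h h' : subpred P P' -> eqoff P h h' -> eqoff P' h h'.
Proof. by move=> s A a i Pa; apply: A; apply: contra Pa => /s. Qed.
Lemma eqoff_run P (c : cmd) h : all P (wr c) -> eqoff P h (run c h).
Proof. by move=> w a i Pa; apply: frameP w Pa. Qed.

Lemma W_sub d : subpred (W d.+1) (W d).
Proof.
move=> a /andP[w0 /orP[A|/andP[A A']]]; apply/andP; split=> //; rewrite ?A //=.
by rewrite (ltnW A') orbT.
Qed.

Variables (us : seq X) (g : X -> nat -> seq 'I_B).
Hypothesis uus : uniq us.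
Hypothesis g_mem : forall x F t c, x \in us -> F \in E -> x \in F ->
  (c \in g x (key E F (take (index x us) us) t)) =
  has (fun r => agr rv F (take (index x us) us) t r && (rv F r x == c)) (iota 0 (sz F)).

Definition ST h := stat E sz rv pos h /\ forall x, mmrep (T1 q v x) (T2 q v x) (T3 q v x) h (g x).

Definition G x0 p t h := [/\ ST h,
  forall F, F \in E -> na h (dCODE (size p) F) 0 = code [seq y <- p | y \in F] t &
  forall i, i < size p -> na h (dVAL i.+1) 0 = t (nth x0 p i)].

Lemma ST_eq d h h' : ST h -> eqoff (W d) h h' -> ST h'.
Proof.
have nq : (0 == q) = false by case: (q) q0.
move=> [S mm] e; split.
  apply: stat_eq S _ _ _ => [a i|F|F].
  - by rewrite !inE => /orP[/eqP->|/eqP->]; [have [] := e gM i isT|have [] := e gID i isT].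
  - by have [] := e (gSZ F) 0; rewrite // /W /own2 /own /= nq.
  - by have [] := e (gOFF F) 0; rewrite // /W /own2 /own /= nq.
move=> x; apply: mmrep_eq (mm x) _ => a i.
have nW k s : k < 20 -> ~~ W d (k :: s).
  by move=> k20; rewrite /W /= (leqNgt 30) (leqNgt 20) k20 (ltn_trans k20 (isT : 20 < 30)) andbF.
by rewrite !inE => /or3P[] /eqP->; [have [] := e (T1 q v x) i (nW 1 [:: q; v; pkX x] isT)|
  have [] := e (T2 q v x) i (nW 2 [:: q; v; pkX x] isT)|have [] := e (T3 q v x) i (nW 3 [:: q; v; pkX x] isT)].
Qed.

Lemma G_eq x0 p t h h' : G x0 p t h -> eqoff (W (size p)) h h' -> G x0 p t h'.
Proof.
move=> [S C V] e; split; first exact: ST_eq S e.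
  move=> F FE; have [|-> _] := e (dCODE (size p) F) 0; last by rewrite C.
  by rewrite /W /= ltnn andbF.
move=> i ip; have [|-> _] := e (dVAL i.+1) 0; last by rewrite V.
by rewrite /W /= ltnNge ip andbF.
Qed.

Lemma c_sel_wr d x : all (W d) (wr (c_sel d x)).
Proof.
rewrite /= wr_seqs /=; have w : W d (dBK d.+1) by rewrite /W /own2 /own /= !eqxx ltnSn.
by rewrite w /=; apply/allP.
Qed.

Lemma c_body_wr d x body : all (W d.+1) (wr body) -> all (W d) (wr (c_body d x body)).
Proof.
move=> wb; have w k s : (20 <= k) -> W d [:: k, q, v, d.+1 & s].
  by move=> k20; rewrite /W /own2 /own /= !eqxx k20 ltnSn orbT.
rewrite -[wr _]/([:: dVAL d.+1; dOK d.+1] ++ wr (c_chk d x) ++ (wr (c_upd d x) ++ wr body) ++ [::]).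
rewrite !all_cat /= !w //= !wr_seqs andbT; apply/and3P; split.
- by apply/allP => F _ /=; rewrite w.
- by apply/allP => F _ /=; rewrite w.
- by apply: sub_all wb; exact: W_sub.
Qed.

Lemma lev_wr d x body : all (W d.+1) (wr body) -> all (W d) (wr (lev d x body)).
Proof.
move=> wb; rewrite -[wr _]/(wr (c_sel d x) ++ dK d.+1 :: wr (c_body d x body)) all_cat c_sel_wr.
rewrite andTb; apply/andP; split; last exact: c_body_wr.
by rewrite /W /own2 /own /= !eqxx ltnSn.
Qed.

Lemma dfs_wr d us' leaf : all (W (d + size us')) (wr leaf) -> all (W d) (wr (dfs d us' leaf)).
Proof.
elim: us' d => [|x us' IH] d; first by rewrite addn0.
by rewrite [size _]/= addnS -addSn => /IH /lev_wr; apply.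
Qed.

Lemma dKEYE x0 p t h F : F \in E -> G x0 p t h -> evn h (dKEY (size p) F) = key E F p t.
Proof. by move=> FE [_ C _]; rewrite /= C. Qed.

Lemma W_BK d : W d (dBK d.+1). Proof. by rewrite /W /own2 /own /= !eqxx ltnSn. Qed.
Lemma W_OK d : W d (dOK d.+1). Proof. by rewrite /W /own2 /own /= !eqxx ltnSn. Qed.

Lemma edgesP F x : (F \in edges x) = (F \in E) && (x \in F).
Proof. by rewrite mem_filter mem_enum andbC. Qed.

Lemma size_edges x : size (edges x) <= #|E|.
Proof. by rewrite /edges size_filter cardE count_size. Qed.

Lemma c_sel_ok x0 p x t h : edges x != [::] -> G x0 p t h ->
  let h' := run (c_sel (size p) x) h in
  (exists F, [/\ F \in E, x \in F, na h' (dBK (size p).+1) 0 = key E F p t &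
    forall F', F' \in E -> x \in F' -> size (g x (key E F p t)) <= size (g x (key E F' p t))]) /\
  cost (c_sel (size p) x) h <= 20 + #|E| * 60.
Proof.
move=> ex Gh h'; set d := size p.
set F0 := head finset.set0 (edges x).
have F0in : F0 \in edges x by rewrite /F0; case: (edges x) ex => //= a l _; rewrite mem_head.
have /andP[F0E xF0] : (F0 \in E) && (x \in F0) by rewrite -edgesP.
set h1 := run (Cs (dBK d.+1) (dKEY d F0)) h.
have e1 : eqoff (W d) h h1 by apply: eqoff_run; rewrite /= W_BK.
pose I (pr : seq {set X}) h' := [/\ G x0 p t h', exists F, [/\ F \in edges x, na h' (dBK d.+1) 0 = key E F p t &
  forall F', F' \in pr -> size (g x (key E F p t)) <= size (g x (key E F' p t))] & True].
have I1 : I [::] h1.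
  split=> //; exists F0; split=> //.
  by rewrite -(dKEYE F0E Gh) /h1 /Cs /= !eqxx.
have [|[_ [F [Fin eF mF]] _] C] := @seqs_rule R {set X} (c_sel1 d x) (edges x) I (fun=> 60) h1 I1.
  move=> pr F post h2 e [G2 [F1 [F1in eF1 mF1]] _].
  have /andP[FE xF] : (F \in E) && (x \in F) by rewrite -edgesP e mem_cat inE eqxx orbT.
  split; last by rewrite /c_sel1 /=; case: ifP.
  have szE K : na h2 (T1 q v x) K = size (g x K) by case: G2 => -[_ /(_ x K)[]].
  have ev : evb h2 (Ble (Na (T1 q v x) (dKEY d F)) (Na (T1 q v x) (Nv (dBK d.+1)))) =
     (size (g x (key E F p t)) <= size (g x (key E F1 p t))).
    by rewrite -[evb _ _]/(na h2 (T1 q v x) (evn h2 (dKEY d F)) <= na h2 (T1 q v x) (na h2 (dBK d.+1) 0))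
       !szE eF1 (dKEYE FE G2).
  rewrite -[run _ h2]/(if evb h2 (Ble (Na (T1 q v x) (dKEY d F)) (Na (T1 q v x) (Nv (dBK d.+1))))
    then run (Cs (dBK d.+1) (dKEY d F)) h2 else h2) ev.
  case: leqP => le; split=> //.
  + exists F; split=> //; first by rewrite edgesP FE.
      by rewrite -(dKEYE FE G2) /Cs /= !eqxx.
    by move=> F'; rewrite mem_rcons inE => /orP[/eqP->//|/mF1]; exact: leq_trans.
  + by exists F1; split=> // F'; rewrite mem_rcons inE => /orP[/eqP->|/mF1//]; exact: ltnW.
split.
  have /andP[FE xF] : (F \in E) && (x \in F) by rewrite -edgesP.
  by exists F; split=> // F' F'E xF'; apply: mF; rewrite edgesP F'E.
have -> : cost (c_sel d x) h = cost (Cs (dBK d.+1) (dKEY d F0)) h +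
  cost (seqs (map (c_sel1 d x) (edges x))) h1 by [].
apply: leq_add => //; apply: leq_trans C _; rewrite big_const_seq count_predT iter_addn_0 mulnC leq_mul2r /=.
exact: size_edges.
Qed.

Lemma c_chk_ok x0 p x t h (c : 'I_B) : G x0 p t h -> na h (dVAL (size p).+1) 0 = c ->
  na h (dOK (size p).+1) 0 = 1 ->
  na (run (c_chk (size p) x) h) (dOK (size p).+1) 0 = all (fun F => c \in g x (key E F p t)) (edges x) /\
  cost (c_chk (size p) x) h <= #|E| * 60.
Proof.
set d := size p => Gh eV eO.
pose I pr h' := [/\ G x0 p t h', na h' (dVAL d.+1) 0 = c & na h' (dOK d.+1) 0 = all (fun F => c \in g x (key E F p t)) pr].
have [|[_ _ A] C] := @seqs_rule R {set X} (c_chk1 d x) (edges x) I (fun=> 60) h (And3 Gh eV eO).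
  move=> pr F post h2 e [G2 eV2 eO2]; split=> //.
  have /andP[FE xF] : (F \in E) && (x \in F) by rewrite -edgesP e mem_cat inE eqxx orbT.
  have [[[eM _] mm] _ _] := G2.
  have ev : evn h2 (dKEY d F *! Nv gM +! Nv (dVAL d.+1)) = key E F p t * B + c.
    by rewrite -[LHS]/(evn h2 (dKEY d F) * na h2 gM 0 + na h2 (dVAL d.+1) 0) (dKEYE FE G2) eM eV2.
  split.
  + by apply: (@G_eq x0 p t h2 (run (c_chk1 d x F) h2)) => //; apply: eqoff_run; rewrite /= W_OK.
  + by [].
  + rewrite all_rcons andbC -mulnb -eO2.
    have [_ _ _ mP] := mm x (key E F p t); rewrite -mP -ev.
    by rewrite /c_chk1 /Cs /= !eqxx.
split=> //; apply: leq_trans C _; rewrite big_const_seq count_predT iter_addn_0 mulnC leq_mul2r /=.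
exact: size_edges.
Qed.

Lemma c_upd_ok x0 p x t h (c : 'I_B) : x \notin p -> G x0 p t h -> na h (dVAL (size p).+1) 0 = c ->
  G x0 (rcons p x) (upd t x c) (run (c_upd (size p) x) h) /\
  cost (c_upd (size p) x) h <= #|E| * 40.
Proof.
set d := size p => xp Gh eV.
pose I (pr : seq {set X}) h' := [/\ G x0 p t h', na h' (dVAL d.+1) 0 = c &
  forall F, F \in pr -> na h' (dCODE d.+1 F) 0 = code [seq y <- rcons p x | y \in F] (upd t x c)].
have I0 : I [::] h by split.
have [|[G2 V2 C2] C] := @seqs_rule R {set X} (c_upd1 d x) (enum E) I (fun=> 40) h I0.
  move=> pr F post h2 e [G2 eV2 eC2]; split; last first.
    by rewrite /c_upd1; case: ifP.
  have FE : F \in E by rewrite -mem_enum e mem_cat inE eqxx orbT.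
  have Wc : W d (dCODE d.+1 F) by rewrite /W /own2 /own /= !eqxx ltnSn.
  split.
  + by apply: (@G_eq x0 p t h2 (run (c_upd1 d x F) h2)) => //; apply: eqoff_run; rewrite /= Wc.
  + by [].
  + move=> F'; rewrite mem_rcons inE => F'in.
    have -> : na (run (c_upd1 d x F) h2) (dCODE d.+1 F') 0 = if F' == F then
      evn h2 (if x \in F then Nv (dCODE d F) *! Nv gM +! Nv (dVAL d.+1) else Nv (dCODE d F))
      else na h2 (dCODE d.+1 F') 0.
      by rewrite /= andbT /dCODE !eqseq_cons !eqxx /= andbT (inj_eq (@pkF_inj X)); case: eqP.
    case: eqP F'in => [->|_] /=; last exact: eC2.
    move=> _; have [[[eM _] _] C _] := G2.
    have cE : code [seq y <- p | y \in F] (upd t x c) = code [seq y <- p | y \in F] t.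
      apply: eq_code => y; rewrite mem_filter => /andP[_ yp]; rewrite ffunE.
      by rewrite (_ : (y == x) = false) //; apply/negbTE; apply: contraNneq xp => <-.
    rewrite filter_rcons; case: ifP => _; last by rewrite cE /= C.
    by rewrite code_rcons cE ffunE eqxx /= C // eM eV2.
split; last by apply: leq_trans C _; rewrite big_const_seq count_predT iter_addn_0 mulnC cardE.
have [S _ V] := G2; split=> //; rewrite size_rcons.
  by move=> F FE; rewrite C2 // mem_enum.
move=> i; rewrite ltnS leq_eqVlt => /orP[/eqP->|ip].
  by rewrite V2 nth_rcons ltnn eqxx ffunE eqxx.
rewrite V // nth_rcons ip ffunE (_ : (_ == x) = false) //.
by apply/negbTE; apply: contraNneq xp => <-; exact: mem_nth.
Qed.

Lemma c_body_BK d x body : all (W d.+1) (wr body) -> dBK d.+1 \notin wr (c_body d x body).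
Proof.
move=> wb; rewrite -[wr _]/([:: dVAL d.+1; dOK d.+1] ++ wr (c_chk d x) ++ (wr (c_upd d x) ++ wr body) ++ [::]).
rewrite !mem_cat in_nil orbF !negb_or; apply/and4P; split=> //.
- have /allP H : all (predC1 (dBK d.+1)) (wr (c_chk d x)) by rewrite wr_seqs; apply/allP.
  by apply/negP => /H /=; rewrite eqxx.
- have /allP H : all (predC1 (dBK d.+1)) (wr (c_upd d x)) by rewrite wr_seqs; apply/allP.
  by apply/negP => /H /=; rewrite eqxx.
- by apply/negP => /(allP wb); rewrite /W /= ltnn andbF.
Qed.

Definition scr (a : nm) := [&& own2 q v a, 20 <= nth 0 a 0 & nth 0 a 0 < 30].

Variables (lam : {set X} -> R) (leaf : cmd) (lc : R) (x0 : X) (Inv : seq asg -> hst R -> Prop).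
Hypothesis lam0 : forall F, F \in E -> (0 <= lam F)%R.
Hypothesis lam1 : forall x, x \in us -> (1 <= \sum_(F in E | x \in F) lam F)%R.
Hypothesis wleaf : all (fun a => own2 q v a && (30 <= nth 0 a 0)) (wr leaf).
Hypothesis InvE : forall dn h h', Inv dn h -> eqoff scr h h' -> Inv dn h'.
Hypothesis lc0 : (0 <= lc)%R.
Hypothesis leaf_ok : forall t dn h, Nd E sz rv us t -> G x0 us t h -> Inv dn h ->
  Inv (rcons dn t) (run leaf h) /\ ((cost leaf h)%:R <= lc)%R.

Definition extl (us' : seq X) t t' := Nd E sz rv us t' && [forall y, (y \notin us') ==> (t' y == t y)].

Lemma extl_cons x us' t t' c : x \notin us' ->
  extl us' (upd t x c) t' = extl (x :: us') t t' && (t' x == c).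
Proof.
move=> xus; rewrite /extl -andbA; congr andb; apply/forallP/andP => [A|[/forallP A /eqP tx] y].
  split; last by have := A x; rewrite xus ffunE eqxx.
  apply/forallP => y; rewrite inE negb_or; apply/implyP => /andP[/negbTE yx yus].
  by have := A y; rewrite yus ffunE yx.
rewrite ffunE; case: (eqVneq y x) => [->|yx]; first by rewrite tx eqxx implybT.
by have := A y; rewrite inE negb_or yx.
Qed.

Lemma wleafW d : all (W d) (wr leaf).
Proof. by apply: sub_all wleaf => a /andP[w1 A]; rewrite /W w1 A. Qed.

Lemma edges_neq0 x : x \in us -> edges x != [::].
Proof.
move=> /lam1; apply: contraTneq => e; rewrite big1 ?lt_geF ?ltr01 // => F /andP[FE xF].
by move: (edgesP F x); rewrite e FE xF.
Qed.

Lemma dfs_ok us' p t h dn : us = p ++ us' -> Nd E sz rv p t -> G x0 p t h -> Inv dn h ->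
  (exists l, [/\ uniq l, forall t', (t' \in l) = extl us' t t' &
     Inv (dn ++ l) (run (dfs (size p) us' leaf) h)]) /\
  ((cost (dfs (size p) us' leaf) h)%:R <= (lc + (size us' * (400 * #|E|.+1))%:R) * Phi E sz rv lam p t)%R.
Proof.
elim: us' p t h dn => [|x us' IH] p t h dn eus Np Gh Ih.
  rewrite cats0 in eus; subst p; have [Il cl] := leaf_ok Np Gh Ih.
  split; last first.
    by rewrite mul0n addr0; apply: le_trans cl _; rewrite ler_peMr // Phi_ge1.
  exists [:: t]; rewrite cats1; split=> // t'; rewrite inE /extl.
  apply/eqP/andP => [->|[_ /forallP A]].
    by split=> //; apply/forallP => y; rewrite eqxx implybT.
  by apply/ffunP => y; apply/eqP; have := A y.
set d := size p.
have xus : x \in us by rewrite eus mem_cat inE eqxx orbT.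
have [xp xus'] : x \notin p /\ x \notin us'.
  move: uus; rewrite eus cat_uniq /= negb_or => /and3P[_ /andP[-> _] /andP[-> _]].
  by [].
have eus' : us = rcons p x ++ us' by rewrite cat_rcons.
have prex : take (index x us) us = p.
  by rewrite eus index_cat (negbTE xp) /= eqxx addn0 take_size_cat.
have gm F c : F \in E -> x \in F -> (c \in g x (key E F p t)) =
   has (fun r => agr rv F p t r && (rv F r x == c)) (iota 0 (sz F)).
  by move=> FE xF; have := g_mem t c xus FE xF; rewrite prex.
have := c_sel_ok (edges_neq0 xus) Gh; rewrite -/d => -[[Fb [FbE xFb eBK mF]] csel].
set h1 := run (c_sel d x) h in eBK.
set cs := g x (key E Fb p t) in mF.
set body := dfs d.+1 us' leaf.
have wb : all (W d.+1) (wr body) by apply: dfs_wr; exact: wleafW.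
have G1 : G x0 p t h1 by apply: G_eq Gh _; apply: eqoff_run; exact: c_sel_wr.
have ucs : uniq cs by case: G1 => -[_ /(_ x (key E Fb p t))[]].
have ebound : evn h1 (Na (T1 q v x) (Nv (dBK d.+1))) = size cs.
  by rewrite /= eBK; case: G1 => -[_ /(_ x (key E Fb p t))[]].
pose I k h' := [/\ G x0 p t h', na h' (dBK d.+1) 0 = key E Fb p t &
  exists l, [/\ uniq l, forall t', (t' \in l) = extl (x :: us') t t' && (t' x \in take k cs) &
     Inv (dn ++ l) h']].
pose C' : R := (lc + (size us' * (400 * #|E|.+1))%:R)%R.
pose ph c : R := if Nd E sz rv (rcons p x) (upd t x c) then
   ((40 * #|E|)%:R + C' * Phi E sz rv lam (rcons p x) (upd t x c))%R else 0%R.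
have scrn k s : 20 <= k < 30 -> scr [:: k, q, v & s].
  by move=> /andP[k1 k2]; rewrite /scr /own2 /own /= !eqxx k1 k2.
have [||[_ _ [l [ul ml Il]]] cl] := @for_rule R I (fun k => (160 + 60 * #|E|)%:R + ph (nth ord0 cs k))%R
   (dK d.+1) (Na (T1 q v x) (Nv (dBK d.+1))) (c_body d x body) h1.
- split=> //; exists [::]; rewrite cats0; split=> // [t'|]; first by rewrite take0 andbF.
  apply: InvE Ih _; apply: eqoff_run.
  rewrite /= scrn //= wr_seqs; apply/allP => F _ /=; by rewrite scrn.
- rewrite ebound => k h' kN [G2 eBK2 [l [ul ml Il]]].
  set c := nth ord0 cs k.
  set h2 := setn h' (dK d.+1) 0 k.
  have G3 : G x0 p t h2.
    apply: G_eq G2 _; apply: (@eqoff_run _ (Cs (dK d.+1) (Nc k))).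
    by rewrite /= /W /own2 /own /= !eqxx ltnSn.
  set h3 := run (c_pick d x) h2.
  have G4 : G x0 p t h3.
    apply: G_eq G3 _; apply: eqoff_run.
    by rewrite /= /W /own2 /own /= !eqxx ltnSn.
  have eV3 : na h3 (dVAL d.+1) 0 = c.
    rewrite /h3 /c_pick /Cs /= !eqxx /= eBK2.
    have [[[eM _] mm] _ _] := G2; rewrite eM.
    by have [_ _ -> //] := mm x (key E Fb p t).
  have eO3 : na h3 (dOK d.+1) 0 = 1 by rewrite /h3 /c_pick /Cs /= !eqxx.
  have [eO4 c4] := c_chk_ok x G4 eV3 eO3.
  set h4 := run (c_chk d x) h3 in eO4.
  have G5 : G x0 p t h4.
    apply: G_eq G4 _; apply: eqoff_run.
    by rewrite wr_seqs; apply/allP => F _ /=; rewrite W_OK.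
  have eV4 : na h4 (dVAL d.+1) 0 = c.
    have [||-> //] := @frameP R (fun a => a != dVAL d.+1) (c_chk d x) h3 (dVAL d.+1) 0.
      by rewrite wr_seqs; apply/allP.
    by rewrite eqxx.
  have allE : all (fun F => c \in g x (key E F p t)) (edges x) = Nd E sz rv (rcons p x) (upd t x c).
    rewrite Nd_upd //; apply/allP/forall_inP => [A F FE|A F].
      by apply/implyP => xF; rewrite -gm // A // edgesP FE.
    by rewrite edgesP => /andP[FE xF]; rewrite gm //; exact: (implyP (A F FE)).
  rewrite allE in eO4.
  have Il4 : Inv (dn ++ l) h4.
    apply: InvE Il _; apply: (@eqoff_trans _ _ h2).
      apply: (@eqoff_run _ (Cs (dK d.+1) (Nc k))); by rewrite /= scrn.
    apply: (@eqoff_trans _ _ h3); apply: eqoff_run.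
      by rewrite /= !scrn.
    by rewrite wr_seqs; apply/allP => F _ /=; rewrite scrn.
  have runE : run (c_body d x body) h2 = if Nd E sz rv (rcons p x) (upd t x c) then run body (run (c_upd d x) h4) else h4.
    rewrite -[LHS]/(if 1 <= na h4 (dOK d.+1) 0 then run body (run (c_upd d x) h4) else h4) eO4.
    by case: Nd.
  have costE : cost (c_body d x body) h2 <= 100 + #|E| * 60 +
     (if Nd E sz rv (rcons p x) (upd t x c) then cost (c_upd d x) h4 + cost body (run (c_upd d x) h4) else 0).
    rewrite -[cost _ _]/(cost (c_pick d x) h2 + (cost (c_chk d x) h3 +
      (1 + 6 + 1 + if 1 <= na h4 (dOK d.+1) 0 then cost (c_upd d x) h4 + cost body (run (c_upd d x) h4) else 0))) eO4.
    rewrite (_ : (1 <= nat_of_bool (Nd E sz rv (rcons p x) (upd t x c))) = Nd E sz rv (rcons p x) (upd t x c)); last by case: Nd.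
    have cp : cost (c_pick d x) h2 <= 80 by [].
    exact: arith_body.
  have eo : eqoff (W d) h2 (run (c_body d x body) h2) by apply: eqoff_run; exact: c_body_wr.
  have BK5 : na (run (c_body d x body) h2) (dBK d.+1) 0 = key E Fb p t.
    by have [-> _] := frame h2 0 (c_body_BK x wb).
  have takeS : take k.+1 cs = rcons (take k cs) c by rewrite (take_nth ord0).
  rewrite -/h2; case: (boolP (Nd E sz rv (rcons p x) (upd t x c))) => [Nc|nNc].
  + have [G6 c6] := c_upd_ok xp G5 eV4.
    set h5 := run (c_upd d x) h4 in G6.
    have Il5 : Inv (dn ++ l) h5.
      apply: InvE Il4 _; apply: eqoff_run.
      by rewrite wr_seqs; apply/allP => F _ /=; rewrite scrn.
    have := IH (rcons p x) (upd t x c) h5 (dn ++ l) eus' Nc G6 Il5.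
    rewrite size_rcons -/d -/body => -[[l' [ul' ml' Il']] c'].
    rewrite Nc in runE costE; split; last first.
      apply: (@le_trans _ _ (100 + #|E| * 60 + (cost (c_upd d x) h4 + cost body h5))%:R%R); first by rewrite ler_nat.
      rewrite /ph Nc; apply: (@le_trans _ _ ((160 + 60 * #|E| + 40 * #|E|)%:R + (cost body h5)%:R)%R).
        by rewrite -natrD ler_nat; exact: arith_upd.
      by rewrite natrD -addrA lerD2l lerD2l.
    split=> //; first exact: G_eq G3 eo.
    exists (l ++ l'); rewrite runE -/h5 catA; split=> //.
    * rewrite cat_uniq ul ul' andbT; apply/hasPn => t'; rewrite ml' extl_cons // ml.
      move=> /andP[_ /eqP->]; apply/nandP; right.
      move: (take_uniq k.+1 ucs); rewrite takeS rcons_uniq => /andP[-> _]; by [].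
    * move=> t'; rewrite mem_cat ml ml' extl_cons // takeS mem_rcons inE.
      by case: extl => //=; rewrite orbC.
  + rewrite (negbTE nNc) in runE costE; split; last first.
      apply: (@le_trans _ _ (100 + #|E| * 60 + 0)%:R%R); first by rewrite ler_nat.
      by rewrite /ph (negbTE nNc) addr0 ler_nat; exact: arith_skip.
    split=> //; first exact: G_eq G3 eo.
    exists l; rewrite runE; split=> // t'; rewrite ml takeS mem_rcons inE.
    case: eqVneq => [tx|_] //=; rewrite andbT.
    case: (boolP (extl (x :: us') t t')) => //= /andP[Nt /forallP A].
    exfalso; move/negP: nNc; apply; rewrite eus' in Nt; have := Nd_cat Nt.
    rewrite (@eq_Nd X E B' sz rv (rcons p x) t' (upd t x c)) //.
    move=> y; rewrite mem_rcons inE ffunE -tx; case: eqVneq => [->//|yx] /= yp.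
    apply/eqP; move: (A y); rewrite inE negb_or yx /= => /implyP; apply.
    by move: uus; rewrite eus cat_uniq => /and3P[_ /hasPn/(_ y) + _]; rewrite inE (negbTE yx) /= => B1; apply/negP => /B1/negP.
rewrite ebound in ml cl.
split.
  exists l; split=> // t'; rewrite ml take_size.
  case: (boolP (extl (x :: us') t t')) => //= /andP[Nt /forallP A].
  rewrite eus' in Nt; have /forall_inP := Nd_cat Nt.
  rewrite gm //; move=> /(_ Fb FbE); rewrite /nF -has_count; apply: sub_has => r.
  rewrite /agr all_rcons xFb /= => /andP[-> B1]; rewrite andbT.
  rewrite -/(agr rv Fb p t r) -(@eq_agr X B' rv Fb p t' t) // => y yp; apply/eqP.
  apply: (implyP (A y)); rewrite inE negb_or; apply/andP; split.
    by apply: contraNneq xp => <-.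
  by move: uus; rewrite eus' cat_uniq => /and3P[_ /hasPn B2 _]; apply/negP => /B2; rewrite mem_rcons inE yp orbT.

have szcs : ((size cs)%:R <= Phi E sz rv lam p t)%R.
  have := @min_le_Phi R X E B' sz rv lam lam0 p x t (size cs) Np (lam1 xus).
  apply => F FE xF; apply: leq_trans (mF F FE xF) _.
  have ug : uniq (g x (key E F p t)) by case: G1 => -[_ /(_ x (key E F p t))[]].
  rewrite /nF -size_filter -(size_map (fun r => rv F r x)).
  apply: uniq_leq_size ug _ => c; rewrite gm // => /hasP[r ri /andP[ag /eqP <-]].
  by apply: map_f; rewrite mem_filter ag.
have C'0 : (0 <= C')%R by rewrite addr_ge0 // ler0n.
have ph0 c : (0 <= ph c)%R.
  rewrite /ph; case: ifP => // Nc; apply: addr_ge0; rewrite ?ler0n //.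
  by apply: mulr_ge0 => //; apply: le_trans (Phi_ge1 lam0 Nc).
have phs : (\sum_(k < size cs) ph (nth ord0 cs k) <= ((40 * #|E|)%:R + C') * Phi E sz rv lam p t)%R.
  rewrite -(big_mkord xpredT (fun k => ph (nth ord0 cs k))) -(big_nth ord0 xpredT ph) big_uniq //=.
  apply: (@le_trans _ _ (\sum_c ph c)%R).
    by rewrite [X in (_ <= X)%R](bigID (fun c => c \in cs)) /= lerDl sumr_ge0.
  apply: le_trans (_ : (((40 * #|E|)%:R + C') * \sum_(c | Nd E sz rv (rcons p x) (upd t x c)) Phi E sz rv lam (rcons p x) (upd t x c) <= _)%R).
    rewrite /ph -big_mkcond mulr_sumr; apply: ler_sum => c Nc.
    rewrite [X in (_ <= X)%R](mulrDl (40 * #|E|)%:R%R C') lerD2r ler_peMr ?ler0n //; exact: Phi_ge1 Nc.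
  apply: ler_wpM2l; first by rewrite addr_ge0 // ler0n.
  exact: agm_step (lam1 xus).
rewrite -[cost _ h]/(cost (c_sel d x) h + cost (Cfor (dK d.+1) (Na (T1 q v x) (Nv (dBK d.+1))) (c_body d x body)) h1).
have -> : ((lc + (size (x :: us') * (400 * #|E|.+1))%:R) = C' + 400 * (#|E|%:R + 1) :> R)%R.
  by rewrite /C' [size _]/= mulSn natrD natr1 -natrM addrAC -addrA.
rewrite natrD; apply: (arith_level (s := (size cs)%:R%R) (z := (\sum_(k < size cs) ph (nth ord0 cs k))%R)).
- by rewrite ler0n.
- exact: C'0.
- exact: Phi_ge1.
- by rewrite ler0n szcs.
- by rewrite -natrM -natrD ler_nat.
- apply: le_trans cl _; rewrite lerD2l.
  under eq_bigr => k _ do rewrite addrA.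
  rewrite big_split /= sumr_const card_ord lerD2r -[X in (X <= _)%R]mulr_natl.
  by rewrite natrD natrM addrA -(natrD _ 5 160).
- by rewrite natrM in phs.
Qed.
End BagDfs.

Lemma arith_leaf s : (60 + 20 * s) + (60 + 20 * s) <= 200 + 60 * s.
Proof. lia. Qed.

Section Bag.
Variables (R : realType) (X : finType) (E : {set {set X}}) (B' : nat).
Local Notation B := B'.+1.
Notation asg := {ffun X -> 'I_B}.
Variables (sz : {set X} -> nat) (rv : {set X} -> nat -> X -> 'I_B) (pos : {set X} -> X -> nat).
Variables (q : nat) (fr : pred X) (ex : X -> nat).
Hypothesis q0 : 0 < q.
Implicit Types (h : hst R) (x : X) (t : asg) (kS : X * seq X).

Definition vx x : nat := (pkX x).+1.
Definition bCNT x : nm := [:: 30; q; vx x].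
Definition bKID x : nm := [:: 31; q; vx x].
Definition bPRES x : nm := [:: 32; q; vx x].
Definition bWV x : nm := [:: 33; q; vx x].
Definition bMS x : nm := [:: 34; q; vx x].

Variables (x : X) (us' : seq X) (ch : seq (X * seq X)).
Local Notation us := (rcons us' x).
Local Notation v := (vx x).
Hypothesis uus : uniq us.
Hypothesis chS : forall kS, kS \in ch -> {subset kS.2 <= us} /\ kS.1 != x.

Definition lOK : nm := [:: 35; q; v].
Definition lCC : nm := [:: 36; q; v].
Definition lKEY : nm := [:: 37; q; v].
Definition lCL : nm := [:: 38; q; v].
Definition lIDX : nm := [:: 39; q; v].
Definition lWT : nm := [:: 40; q; v].

Definition hcode (s : seq X) : nexp :=
  foldl (fun a y => a *! Nv gM +! Nv (dVAL q v (index y us).+1)) (Nc 0) s.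

Definition l_ok kS : cmd :=
  Cseq (Cs lCC (hcode kS.2)) (Cs lOK (Nv lOK *! Na (bCNT kS.1) (Nv lCC))).
Definition l_wt kS : cmd :=
  Cseq (Cs lCC (hcode kS.2)) (CRo RMul lWT (Nc 0) lWT (Nc 0) (bMS kS.1) (Nv lCC)).
Definition bch := [seq kS <- ch | ~~ fr kS.1].

Definition l_init : cmd :=
  seqs [:: Cs lKEY (hcode us'); Cs lCL (Nv (dVAL q v (size us').+1));
           Cs lIDX (Nv lKEY *! Nv gM +! Nv lCL); CRp lWT (Nc 0) gLB (Nv lCL) (ex x)].
Definition l_fin : cmd :=
  seqs [:: CRp (bWV x) (Nv lIDX) lWT (Nc 0) 1;
           CRo RAdd (bMS x) (Nv lKEY) (bMS x) (Nv lKEY) lWT (Nc 0);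
           ins (bCNT x) (bKID x) (bPRES x) lKEY lCL].
Definition leaf : cmd :=
  Cseq (Cs lOK (Nc 1)) (Cseq (seqs (map l_ok ch))
   (Cif (Ble (Nc 1) (Nv lOK)) (Cseq l_init (Cseq (seqs (map l_wt bch)) l_fin)) Cskip)).

Definition bag : cmd := Cseq (trie E pos q v us) (dfs E q v 0 us leaf).

Variable h0 : hst R.
Hypothesis st0 : stat E sz rv pos h0.
Hypothesis fresh : forall a i, own2 q v a -> na h0 a i = 0 /\ ra h0 a i = 0%R.
Hypothesis sz0 : forall F, F \in E -> 0 < sz F.

Definition flag h kS t := 0 < na h (bCNT kS.1) (code kS.2 t).
Definition valid t := all (fun kS => flag h0 kS t) ch.
Definition wt t : R := (ra h0 gLB (t x) ^+ ex x * \prod_(kS <- bch) ra h0 (bMS kS.1) (code kS.2 t))%R.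

Definition inv (dn : seq asg) h := [/\ eqoff (own2 q v) h0 h,
  mmrep (bCNT x) (bKID x) (bPRES x) h (mmfold [seq (code us' t, t x) | t <- dn & valid t]),
  forall t, t \in dn -> valid t -> ra h (bWV x) (code us' t * B + t x) = wt t &
  forall s, ra h (bMS x) s = (\sum_(t <- dn | valid t && (code us' t == s)) wt t)%R].

Lemma own_v k s : own2 q v [:: k, q, v & s]. Proof. by rewrite /own2 /own /= !eqxx. Qed.

Lemma foreign kS : kS \in ch -> forall k, ~~ own2 q v [:: k; q; vx kS.1].
Proof.
move=> /chS[_ kx] k; rewrite /own2 /= (_ : (vx kS.1 == v) = false) ?andbF //.
by apply: contraNF kx => /eqP[] /pkX_inj ->.
Qed.

Lemma hcodeE x0 t h s g : G E sz rv pos q v g x0 us t h -> {subset s <= us} ->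
  evn h (hcode s) = code s t.
Proof.
move=> [[[eM _] _] _ V]; elim/last_ind: s => // s y IH sub.
rewrite /hcode foldl_rcons -/(hcode s) code_rcons /= eM IH; last first.
  by move=> z zs; apply: sub; rewrite mem_rcons inE zs orbT.
have yus : y \in us by apply: sub; rewrite mem_rcons mem_head.
by rewrite V ?index_mem // nth_index.
Qed.

Lemma hcode_nsz s : nsz (hcode s) = 1 + size s * 14.
Proof.
elim/last_ind: s => // s y IH; rewrite /hcode foldl_rcons -/(hcode s) /= IH size_rcons; lia.
Qed.

Lemma wt_eq t t' : {in us, t =1 t'} -> wt t = wt t'.
Proof.
move=> e; rewrite /wt e ?mem_rcons ?mem_head //; congr (_ * _)%R.
rewrite big_seq [RHS]big_seq; apply: eq_bigr => kS; rewrite mem_filter => /andP[_ /chS[sub _]].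
by rewrite (eq_code (t' := t')) // => y /sub /e.
Qed.

Lemma valid_eq t t' : {in us, t =1 t'} -> valid t = valid t'.
Proof.
move=> e; apply: eq_in_all => kS /chS[sub _].
by rewrite /flag (eq_code (t' := t')) // => y /sub /e.
Qed.

Lemma leaf_wr : all (fun a => own2 q v a && (30 <= nth 0 a 0)) (wr leaf).
Proof.
have w k s : 30 <= k -> (own2 q v [:: k, q, v & s]) && (30 <= k) by rewrite own_v.
rewrite -[wr _]/([:: lOK] ++ wr (seqs (map l_ok ch)) ++
  (wr l_init ++ wr (seqs (map l_wt bch)) ++ wr l_fin) ++ [::]).
have wcat (s1 s2 : seq nm) P : all P s1 -> all P s2 -> all P (s1 ++ s2).
  by move=> A1 A2; rewrite all_cat A1.
have H1 : all (fun a => own2 q v a && (30 <= nth 0 a 0)) (wr (seqs (map l_ok ch))).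
  by rewrite wr_seqs; apply/allP => kS _ /=; rewrite !own_v.
have H2 : all (fun a => own2 q v a && (30 <= nth 0 a 0)) (wr (seqs (map l_wt bch))).
  by rewrite wr_seqs; apply/allP => kS _ /=; rewrite !own_v.
apply: (@wcat _ _ _); first by rewrite /= own_v.
apply: (wcat _ _ _ H1); apply: (@wcat _ _ _) => //; apply: (@wcat _ _ _); first by rewrite /= !own_v.
by apply: (wcat _ _ _ H2); rewrite /= !own_v.
Qed.

Definition lcost : nat := 1000 + 30 * size us' + \sum_(kS <- ch) (200 + 60 * size kS.2).

Lemma inv_eq dn h h' : inv dn h -> eqoff (scr q v) h h' -> inv dn h'.
Proof.
move=> [e mm wv ms] e'; split.
- by apply: eqoff_trans e _; apply: eqoff_sub e' => a /and3P[].
- apply: mmrep_eq mm _ => a i; rewrite !inE => A.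
  by have [|->] := e' a i; first by case/or3P: A => /eqP->; rewrite /scr andbF.
- by move=> t td vt; have [|_ ->] := e' (bWV x) (code us' t * B + t x); rewrite ?wv // /scr andbF.
- by move=> s; have [|_ ->] := e' (bMS x) s; rewrite ?ms // /scr andbF.
Qed.

Lemma l_ok_cost kS h : cost (l_ok kS) h <= 60 + 20 * size kS.2.
Proof. by rewrite /l_ok /= hcode_nsz; clear; lia. Qed.

Lemma l_wt_cost kS h : cost (l_wt kS) h <= 60 + 20 * size kS.2.
Proof. by rewrite /l_wt /= hcode_nsz; clear; lia. Qed.

Lemma l_init_cost h : cost l_init h <= 100 + 14 * size us'.
Proof. by rewrite /l_init /= hcode_nsz; clear; lia. Qed.

Lemma leaf_ok x0 g t dn h : G E sz rv pos q v g x0 us t h -> inv dn h ->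
  inv (rcons dn t) (run leaf h) /\ cost leaf h <= lcost.
Proof.
move=> Gh Ih; have [eh mm wv ms] := Ih.
have eqv (c : cmd) h1 : all (fun a => own2 q v a && (30 <= nth 0 a 0)) (wr c) ->
    G E sz rv pos q v g x0 us t h1 -> G E sz rv pos q v g x0 us t (run c h1).
  move=> w G1; apply: (G_eq q0 G1); apply: eqoff_run; apply: sub_all w => a /andP[w1 w2].
  by rewrite /W w1 w2.
have outk kS (c : cmd) h1 i : kS \in ch -> all (own2 q v) (wr c) -> eqoff (own2 q v) h0 h1 ->
    eqoff (own2 q v) h0 (run c h1).
  by move=> _ w e; apply: eqoff_trans e _; exact: eqoff_run.
pose tmp (a : nm) := a \in [:: lOK; lCC; lKEY; lCL; lIDX; lWT].
pose I (pr : seq (X * seq X)) h' := [/\ G E sz rv pos q v g x0 us t h', eqoff tmp h h' &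
  (0 < na h' lOK 0) = all (fun kS => flag h0 kS t) pr].
have tmpo : subpred tmp (own2 q v).
  by move=> a; rewrite /tmp !inE => /orP[/eqP->|/orP[/eqP->|/orP[/eqP->|/orP[/eqP->|/orP[/eqP->|/eqP->]]]]]; rewrite own_v.
have tOK : tmp lOK by rewrite /tmp !inE eqxx.
have tCC : tmp lCC by rewrite /tmp !inE eqxx ?orbT.
have tKEY : tmp lKEY by rewrite /tmp !inE eqxx ?orbT.
have tCL : tmp lCL by rewrite /tmp !inE eqxx ?orbT.
have tIDX : tmp lIDX by rewrite /tmp !inE eqxx ?orbT.
have tWT : tmp lWT by rewrite /tmp !inE eqxx ?orbT.
have h0E h' : eqoff tmp h h' -> eqoff (own2 q v) h0 h'.
  by move=> e; apply: eqoff_trans eh _; apply: eqoff_sub e.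
set h1 := run (Cs lOK (Nc 1)) h.
have I1 : I [::] h1.
  split; [by apply: eqv => //=; rewrite own_v| |by rewrite /h1 /= !eqxx].
  by apply: eqoff_run; rewrite /= tOK.
have [|[G2 e2 ok2] c2] := @seqs_rule R _ l_ok ch I (fun kS => 60 + 20 * size kS.2) h1 I1.
  move=> pr kS post h2 e [G2 e2 ok2].
  have kin : kS \in ch by rewrite e mem_cat inE eqxx orbT.
  have [sub kx] := chS kin.
  split; last exact: l_ok_cost.
  split; first by apply: eqv => //=; rewrite !own_v.
  - by apply: eqoff_trans e2 _; apply: eqoff_run; rewrite /= tOK tCC.
  have := hcodeE G2 sub => hc.
  rewrite all_rcons andbC -ok2 /l_ok /Cs /= !eqxx /= hc.
  have [] := h0E h2 e2 (bCNT kS.1) (code kS.2 t) (foreign kin _) => -> _.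
  by rewrite muln_gt0.
set h2 := run (seqs (map l_ok ch)) h1 in G2 e2 ok2.
have runE : run leaf h = if valid t then run (Cseq l_init (Cseq (seqs (map l_wt bch)) l_fin)) h2 else h2.
  by rewrite -[LHS]/(if 0 < na h2 lOK 0 then _ else _) ok2.
have costE : cost leaf h = cost (Cs lOK (Nc 1)) h + (cost (seqs (map l_ok ch)) h1 + (1 + 6 + 1 +
   if valid t then cost (Cseq l_init (Cseq (seqs (map l_wt bch)) l_fin)) h2 else 0)).
  by rewrite -[LHS]/(cost (Cs lOK (Nc 1)) h + (cost (seqs (map l_ok ch)) h1 + (1 + 6 + 1 +
   if 0 < na h2 lOK 0 then cost (Cseq l_init (Cseq (seqs (map l_wt bch)) l_fin)) h2 else 0))) ok2.

have sumc (F : X * seq X -> nat) : \sum_(kS <- bch) F kS <= \sum_(kS <- ch) F kS.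
  by rewrite big_filter [X in X <= _]big_mkcond /=; apply: leq_sum => kS _; case: ifP.
have sumr_rcons (P : pred asg) (w : asg -> R) :
    (\sum_(t' <- rcons dn t | P t') w t' = \sum_(t' <- dn | P t') w t' + (if P t then w t else 0))%R.
  by rewrite -cats1 big_cat big_cons big_nil /=; case: (P t); rewrite ?addr0.
have ntmp k : 30 <= k <= 34 -> ~~ tmp [:: k; q; v].
  by move=> k34; rewrite /tmp !inE /=; apply/negP => /orP[/eqP[]|/orP[/eqP[]|/orP[/eqP[]|/orP[/eqP[]|/orP[/eqP[]|/eqP[]]]]]] e; rewrite e in k34.
have mm' h' : eqoff tmp h h' -> mmrep (bCNT x) (bKID x) (bPRES x) h'
    (mmfold [seq (code us' t, t x) | t <- dn & valid t]).
  move=> e'; apply: mmrep_eq mm _ => a i; rewrite !inE => A.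
  have [|->//] := e' a i; by case/or3P: A => /eqP->; exact: ntmp.
case: (boolP (valid t)) runE costE => vt runE costE; last first.
  split; last first.
    rewrite costE /lcost addn0 -[cost (Cs lOK (Nc 1)) h]/7.
    have : \sum_(kS <- ch) (60 + 20 * size kS.2) <= \sum_(kS <- ch) (200 + 60 * size kS.2).
      by apply: leq_sum => kS _; exact: leq_trans (leq_addr _ _) (arith_leaf _).
    move: c2; move: (cost _ _) (\sum_(_ <- _) _) (\sum_(_ <- _) _) (size us'); clear; lia.
  rewrite runE; split.
  - exact: h0E.
  - by rewrite filter_rcons (negbTE vt); exact: mm'.
  - move=> t'; rewrite mem_rcons inE => /orP[/eqP->|t'd] vt'; first by rewrite vt' in vt.
    by have [|_ ->] := e2 (bWV x) (code us' t' * B + t' x); rewrite ?wv ?ntmp.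
  - move=> s; rewrite sumr_rcons (negbTE vt) /= addr0 -ms.
    by have [|_ ->] := e2 (bMS x) s; rewrite ?ntmp.
set h3 := run l_init h2 in runE costE.
have [subx subus'] : x \in us /\ {subset us' <= us}.
  by rewrite mem_rcons mem_head; split=> // y; rewrite mem_rcons inE orbC => ->.
have vE : na h2 (dVAL q v (size us').+1) 0 = t x.
  by have [_ _ ->] := G2; rewrite ?size_rcons ?nth_rcons ?ltnn ?eqxx.
have gM2 : na h2 gM 0 = B by case: G2 => -[[]].
have e3 : eqoff tmp h2 h3.
  by apply: eqoff_run; rewrite /= tKEY tCL tIDX tWT.
have K3 : na h3 lKEY 0 = code us' t by rewrite /h3 /l_init /Cs /= !eqxx /= (hcodeE G2 subus').
have C3 : na h3 lCL 0 = t x by rewrite /h3 /l_init /Cs /= !eqxx /= vE.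
have X3 : na h3 lIDX 0 = code us' t * B + t x.
  by rewrite /h3 /l_init /Cs /= !eqxx /= (hcodeE G2 subus') vE gM2.
have LB2 i : ra h2 gLB i = ra h0 gLB i by have [|_ ->] := h0E h2 e2 gLB i.
have W3 : ra h3 lWT 0 = (ra h0 gLB (t x) ^+ ex x)%R.
  by rewrite /h3 /l_init /Cs /= !eqxx /= vE LB2.
have G3 : G E sz rv pos q v g x0 us t h3.
  by apply: eqv G2; rewrite /= !own_v.
pose J (pr : seq (X * seq X)) h' := [/\ G E sz rv pos q v g x0 us t h', eqoff (fun a => a \in [:: lCC; lWT]) h3 h' &
  ra h' lWT 0 = (ra h0 gLB (t x) ^+ ex x * \prod_(kS <- pr) ra h0 (bMS kS.1) (code kS.2 t))%R].
have J3 : J [::] h3 by split; rewrite ?big_nil ?mulr1.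
have tmp2 : subpred (fun a => a \in [:: lCC; lWT]) tmp.
  by move=> a; rewrite !inE => /orP[] /eqP->.
have [|[G4 e4 W4] c4] := @seqs_rule R _ l_wt bch J (fun kS => 60 + 20 * size kS.2) h3 J3.
  move=> pr kS post h' e [G' e' W'].
  have kin : kS \in ch.
    by have : kS \in bch; [rewrite e mem_cat inE eqxx orbT|rewrite mem_filter => /andP[]].
  have [sub kx] := chS kin.
  split; last exact: l_wt_cost.
  split; first by apply: eqv => //=; rewrite !own_v.
  - by apply: eqoff_trans e' _; apply: eqoff_run; rewrite /= !inE !eqxx orbT.
  have eh' : eqoff tmp h h'.
    by apply: eqoff_trans e2 _; apply: eqoff_trans e3 _; apply: eqoff_sub e'.
  rewrite -cats1 big_cat big_seq1 mulrA -W' /l_wt /Cs /= !eqxx /= (hcodeE G' sub).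
  by have [_ ->] := h0E h' eh' (bMS kS.1) (code kS.2 t) (foreign kin _).
set h4 := run (seqs (map l_wt bch)) h3 in G4 e4 W4 c4.
have {}W4 : ra h4 lWT 0 = wt t by [].
have K4 : na h4 lKEY 0 = code us' t by have [->] := e4 lKEY 0 isT.
have C4 : na h4 lCL 0 = t x by have [->] := e4 lCL 0 isT.
have X4 : na h4 lIDX 0 = code us' t * B + t x by have [->] := e4 lIDX 0 isT.
have e4' : eqoff tmp h h4.
  by apply: eqoff_trans e2 _; apply: eqoff_trans e3 _; apply: eqoff_sub e4.
set h6 := run (Cseq (CRp (bWV x) (Nv lIDX) lWT (Nc 0) 1)
           (CRo RAdd (bMS x) (Nv lKEY) (bMS x) (Nv lKEY) lWT (Nc 0))) h4.
have mm6 : mmrep (bCNT x) (bKID x) (bPRES x) h6 (mmfold [seq (code us' t, t x) | t <- dn & valid t]).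
  exact: mm' e4'.
have WV6 i : ra h6 (bWV x) i = if i == code us' t * B + t x then wt t else ra h (bWV x) i.
  rewrite /h6 /= !eqxx /= X4 W4 expr1.
  by have [_ ->] := e4' (bWV x) i (ntmp 33 isT).
have MS6 i : ra h6 (bMS x) i = if i == code us' t then (ra h (bMS x) i + wt t)%R else ra h (bMS x) i.
  rewrite /h6 /= !eqxx /= K4 W4; by case: eqP => [->|_]; rewrite (e4' (bMS x) _ (ntmp 34 isT)).2.
have fI a i : a \notin [:: bPRES x; bKID x; bCNT x] -> ra (run (ins (bCNT x) (bKID x) (bPRES x) lKEY lCL) h6) a i = ra h6 a i.
  by move=> aw; have [] := @frame R (ins (bCNT x) (bKID x) (bPRES x) lKEY lCL) h6 a i aw.
have runE' : run leaf h = run (ins (bCNT x) (bKID x) (bPRES x) lKEY lCL) h6 by rewrite runE.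
split; last first.
  rewrite costE /lcost.
  have ci := l_init_cost h2.
  have cf : cost l_fin h4 <= 300.
    rewrite -[cost _ _]/(nsz (Nv lIDX) + 1 + 11 + (nsz (Nv lKEY) + nsz (Nv lKEY) + 1 + 16 +
      (cost (ins (bCNT x) (bKID x) (bPRES x) lKEY lCL) h6 + 0))).
    by have := @ins_cost R (bCNT x) (bKID x) (bPRES x) h6 lKEY lCL; set u := cost (ins _ _ _ _ _) _; move: u => u; clear; rewrite /=; lia.
  have := leq_trans c4 (sumc _); move: c2.
  rewrite -[cost (Cseq l_init _) h2]/(cost l_init h2 + (cost (seqs (map l_wt bch)) h3 + cost l_fin h4)).
  rewrite -[cost (Cs lOK (Nc 1)) h]/7.
  have : \sum_(kS <- ch) (60 + 20 * size kS.2) + \sum_(kS <- ch) (60 + 20 * size kS.2) <=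
    \sum_(kS <- ch) (200 + 60 * size kS.2).
    by rewrite -big_split /=; apply: leq_sum => kS _; exact: arith_leaf.
  move: ci cf.
  move: (cost l_init h2) (cost l_fin h4) (cost (seqs (map l_wt bch)) h3) (cost (seqs (map l_ok ch)) h1).
  move: (\sum_(_ <- _) _) (\sum_(_ <- _) _) (size us'); clear; lia.
rewrite runE'; split.
- apply: eqoff_trans (h0E _ e4') _; apply: (@eqoff_trans _ _ _ h6).
    by apply: eqoff_run; rewrite /= !own_v.
  by apply: eqoff_run; rewrite /= !own_v.
- rewrite filter_rcons vt map_rcons mmfold_rcons -K4.
  have -> : na h4 lKEY 0 = na h6 lKEY 0 by [].
  by apply: ins_ok => //; case: G4 => -[[]].
- move=> t' t'd vt'; rewrite fI // WV6 idx_eq //.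
  case: andP => [[/eqP cc /eqP tx]|ne].
    apply: wt_eq => y; rewrite mem_rcons inE => /orP[/eqP->|yus]; first exact/esym/val_inj.
    by move/eqP: cc; rewrite code_inj => /allP/(_ y yus)/eqP.
  rewrite -wv //; move: t'd; rewrite mem_rcons inE => /orP[/eqP tt|//].
  by case: ne; rewrite tt !eqxx.
- move=> s; rewrite fI // MS6 sumr_rcons vt /= -ms eq_sym.
  by case: ifP; rewrite ?addr0.
Qed.

Lemma trie_wr20 : all (fun a => nth 0 a 0 < 20) (wr (trie E pos q v us)).
Proof.
rewrite wr_seqs; apply/allP => F _ /=.
by rewrite wr_seqs; apply/allP.
Qed.

Hypothesis cov : forall y, y \in us -> exists2 F, F \in E & y \in F.

Definition t0 : asg := [ffun=> ord0].

Lemma bag_dfs (lam : {set X} -> R) : (forall F, F \in E -> (0 <= lam F)%R) ->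
  (forall y, y \in us -> (1 <= \sum_(F in E | y \in F) lam F)%R) ->
  (exists l, [/\ uniq l, forall t', (t' \in l) = extl E sz rv us us t0 t' & inv l (run bag h0)]) /\
  ((cost bag h0)%:R <= (\sum_(F <- enum E) (20 + sz F * (105 + size us * 300)))%:R +
     (lcost%:R + (size us * (400 * #|E|.+1))%:R) * Phi E sz rv lam [::] t0)%R.
Proof.
move=> lam0 lam1.
have tn : tinv E sz rv pos q v us [::] h0.
  split=> // y; apply: mmrep0 => a i; rewrite !inE => A.
  have [|->//] := fresh (a := a) i.
  by case/or3P: A => /eqP->; exact: own_v.
have [[S1 mm1] ct] := trie_inv q0 uus tn.
set h1 := run _ h0 in S1 mm1.
pose g y := mmfold (items E rv us y (Ltrie E sz us)).
have lo a i : 20 <= nth 0 a 0 -> na h1 a i = na h0 a i /\ ra h1 a i = ra h0 a i.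
  by move=> a20; apply: frameP trie_wr20 _; rewrite -leqNgt.
have G1 : G E sz rv pos q v g x [::] t0 h1.
  split=> //= F FE; have [-> _] := lo (dCODE q v 0 F) 0 isT.
  by have [] := fresh (a := dCODE q v 0 F) 0 (own_v _ _).
have I1 : inv [::] h1.
  split=> //.
  - by apply: eqoff_run; exact: trie_wr.
  - apply: mmrep0 => a i A; have [|-> _] := lo a i.
      by move: A; rewrite !inE => /or3P[] /eqP->.
    have [|->//] := fresh (a := a) i.
    by move: A; rewrite !inE => /or3P[] /eqP->; exact: own_v.
  - move=> s; rewrite big_nil; have [|_ ->] := lo (bMS x) s; first by [].
    by have [|_ ->] := fresh (a := bMS x) s; first exact: own_v.
have N0 : Nd E sz rv [::] t0.
  by apply/forall_inP => F FE; rewrite /nF count_predT size_iota sz0.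
have lok t dn h : Nd E sz rv us t -> G E sz rv pos q v g x us t h -> inv dn h ->
    inv (rcons dn t) (run leaf h) /\ ((cost leaf h)%:R <= (lcost%:R : R))%R.
  by move=> _ Gt It; have [A C] := leaf_ok Gt It; split=> //; rewrite ler_nat.
have := @dfs_ok R X E B' sz rv pos q v q0 us g uus _ lam leaf lcost%:R%R x inv lam0 lam1 leaf_wr inv_eq
  (ler0n _ _) lok us [::] t0 h1 [::] (erefl us) N0 G1 I1.
move=> /(_ _)[|[l [ul ml Il]] cl]; first by move=> y F t c yus FE yF; exact: mem_items.
split; first by exists l.
rewrite -[cost bag h0]/(cost (trie E pos q v us) h0 + cost (dfs E q v 0 us leaf) h1) natrD.
by apply: lerD => //; rewrite ler_nat.
Qed.

Definition nrm t : asg := [ffun y => if y \in us then t y else ord0].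

Lemma bag_ok : let h' := run bag h0 in exists f : nat -> seq 'I_B, [/\
  eqoff (own2 q v) h0 h',
  mmrep (bCNT x) (bKID x) (bPRES x) h' f,
  forall t c, (c \in f (code us' t)) = Nd E sz rv us (upd t x c) && valid (upd t x c),
  forall t, Nd E sz rv us t -> valid t -> ra h' (bWV x) (code us' t * B + t x) = wt t &
  forall t, ra h' (bMS x) (code us' t) =
    (\sum_(c | Nd E sz rv us (upd t x c) && valid (upd t x c)) wt (upd t x c))%R].
Proof.
have [||[l [ul ml [e mm wv ms]]] _] := @bag_dfs (fun=> 1%R).
- by move=> F _; rewrite ler01.
- move=> y /cov[F FE yF]; rewrite (bigD1 F) /= ?FE ?yF // lerDl.
  by apply: sumr_ge0 => F' _; exact: ler01.
have eN (t t' : asg) : {in us, t =1 t'} -> Nd E sz rv us t = Nd E sz rv us t'.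
  exact: eq_Nd.
have nrmE t : {in us, nrm t =1 t} by move=> y yus; rewrite ffunE yus.
have nrm_in t : Nd E sz rv us t -> nrm t \in l.
  move=> N; rewrite ml /extl (eN _ _ (nrmE t)) N /=; apply/forallP => y.
  by rewrite !ffunE; case: ifP => //; rewrite eqxx.
have l_nrm t : t \in l -> Nd E sz rv us t /\ nrm t = t.
  rewrite ml => /andP[N /forallP A]; split=> //; apply/ffunP => y; rewrite ffunE.
  by case: ifP => // /negbT yus; have := A y; rewrite yus ffunE => /eqP.
have xus' : x \notin us' by move: uus; rewrite rcons_uniq => /andP[].
have sub' : {subset us' <= us} by move=> y; rewrite mem_rcons inE orbC => ->.
have xin : x \in us by rewrite mem_rcons mem_head.
have upd_us' t c : {in us', upd t x c =1 t}.
  move=> y yus; rewrite ffunE (_ : (y == x) = false) //.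
  by apply: contraNF xus' => /eqP <-.
set f := mmfold _ in mm; exists f; split=> //.
- move=> t c; rewrite mem_mmfold; apply/mapP/andP => [[t' ]|[N V]].
    rewrite mem_filter => /andP[V /l_nrm[N _]] [/eqP].
    rewrite code_inj => /allP A cx.
    have e' : {in us, t' =1 upd t x c}.
      move=> y; rewrite mem_rcons inE ffunE => /orP[/eqP->|yus]; first by rewrite eqxx.
      by rewrite (_ : (y == x) = false); [apply/eqP; rewrite eq_sym; exact: A|apply: contraNF xus' => /eqP <-].
    by rewrite -(eN _ _ e') -(valid_eq e').
  exists (nrm (upd t x c)).
    by rewrite mem_filter (valid_eq (nrmE _)) V nrm_in.
  rewrite nrmE // ffunE eqxx; congr (_, _); apply: eq_code => y yus.
  by rewrite nrmE ?sub' // upd_us'.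
- move=> t N V; have := wv (nrm t) (nrm_in _ N).
  rewrite (valid_eq (nrmE _)) (wt_eq (nrmE _)) nrmE // => <- //.
  by rewrite (eq_code (t' := t)) // => y /sub'/nrmE.
- move=> t; rewrite ms big_mkcond big_uniq //= -big_mkcondr /=.
  rewrite (reindex_onto (fun c => nrm (upd t x c)) (fun t' : asg => t' x)) /=; last first.
    move=> t' /andP[/l_nrm[_ tn] /andP[_]]; rewrite code_inj => /allP A.
    apply/ffunP => y; rewrite -[in RHS]tn !ffunE; case: ifP => // yus.
    case: eqP => [->//|/eqP yx]; move: yus; rewrite mem_rcons inE (negbTE yx) /= => /A /eqP.
    by [].
  apply: eq_big => [c|c /andP[/andP[_ /andP[_ _]] _]]; last by rewrite (wt_eq (nrmE _)).
  rewrite nrmE // ffunE eqxx eqxx andbT (valid_eq (nrmE _)).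
  have -> : code us' (nrm (upd t x c)) == code us' t.
    by rewrite code_inj; apply/allP => y yus; rewrite nrmE ?sub' // upd_us'.
  rewrite andbT; congr andb; apply/idP/idP => [/l_nrm[]|/nrm_in//].
  by rewrite (eN _ _ (nrmE _)).
Qed.
End Bag.

Lemma arith_bags (K : realFieldType) (b1 b2 w c p s : nat) (A : K) :
  (b1%:R + (b2 + c * w)%:R * A + ((s * b1)%:R + (s * b2)%:R * A + ((p.+1 + s) * w)%:R * A) =
  (s.+1 * b1)%:R + (s.+1 * b2)%:R * A + ((c + p + s.+1) * w)%:R * A)%R.
Proof. by rewrite -[p.+1]addn1 -[s.+1]addn1 !(natrD, natrM); ring. Qed.

Lemma sum_seq_const (T : Type) (s : seq T) c : \sum_(x <- s) c = size s * c.
Proof. by rewrite big_const_seq count_predT iter_addn_0 mulnC. Qed.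

Section Elim.
Variables (R : realType) (X : finType) (E : {set {set X}}) (B' : nat).
Local Notation B := B'.+1.
Notation asg := {ffun X -> 'I_B}.
Variables (sz : {set X} -> nat) (rv : {set X} -> nat -> X -> 'I_B) (pos : {set X} -> X -> nat).
Variables (q : nat) (fr : pred X) (ex : X -> nat) (LB : nat -> R).
Hypothesis q0 : 0 < q.
Hypothesis sz0 : forall F, F \in E -> 0 < sz F.
Implicit Types (h : hst R) (x v : X) (t : asg) (kS : X * seq X) (F U : {set X}) (rs us : seq X) (c : 'I_B).

Definition Dp t := Nd E sz rv (enum X) t.
Definition Dext rs t := [exists t' : asg, all (fun y => t' y == t y) rs && Dp t'].
Definition cons F t := 0 < nF sz rv F (enum F) t.
Definition gx x c : R := (LB c ^+ ex x)%R.
Definition SumK rs t : R := (\sum_(t' : asg | all (fun y => t' y == t y) rs && Dp t') \prod_x gx x (t' x))%R.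

Lemma agr_sub F p t r : {subset F <= p} -> agr rv F p t r = agr rv F (enum F) t r.
Proof.
move=> s; apply/allP/allP => A y yp; last by apply/implyP => yF; apply: (implyP (A y _)) => //; rewrite mem_enum.
by apply: A; apply: s; rewrite mem_enum in yp.
Qed.

Lemma DpE t : Dp t = [forall F in E, cons F t].
Proof.
apply: eq_forallb => F; case: (F \in E) => //=; congr (0 < _); apply: eq_count => r.
by apply: agr_sub => y _; rewrite mem_enum.
Qed.

Lemma eq_cons F t t' : {in F, t =1 t'} -> cons F t = cons F t'.
Proof.
by move=> e; congr (0 < _); apply: eq_nF => y; rewrite mem_enum; exact: e.
Qed.

Lemma Nd_cons us F t : F \in E -> {subset F <= us} -> Nd E sz rv us t -> cons F t.
Proof.
move=> FE s /forall_inP /(_ F FE) /leq_trans; apply.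
by apply: sub_count => r; rewrite agr_sub.
Qed.

Lemma all_eqP rs t t' : reflect {in rs, t' =1 t} (all (fun y => t' y == t y) rs).
Proof. by apply: (iffP allP) => A y yr; apply/eqP/A. Qed.

Lemma DextP rs t : reflect (exists2 t' : asg, {in rs, t' =1 t} & Dp t') (Dext rs t).
Proof.
by apply: (iffP existsP) => [[t' /andP[/all_eqP A D]]|[t' A D]]; exists t' => //; rewrite D andbT; apply/all_eqP.
Qed.

Lemma eq_Dext rs t t' : {in rs, t =1 t'} -> Dext rs t = Dext rs t'.
Proof.
move=> e; apply: eq_existsb => s; congr andb; apply: eq_in_all => y yr; by rewrite e.
Qed.

Lemma Dext_mem rs rs' t : rs =i rs' -> Dext rs t = Dext rs' t.
Proof. by move=> e; apply: eq_existsb => s; rewrite (eq_all_r e). Qed.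

Lemma SumK_mem rs rs' t : rs =i rs' -> SumK rs t = SumK rs' t.
Proof. by move=> e; apply: eq_bigl => s; rewrite (eq_all_r e). Qed.

Lemma Dext_sub rs rs' t : {subset rs' <= rs} -> Dext rs t -> Dext rs' t.
Proof. by move=> s /DextP[t' A D]; apply/DextP; exists t' => // y /s/A. Qed.

Lemma Dext_Nd rs us t : {subset us <= rs} -> Dext rs t -> Nd E sz rv us t.
Proof.
move=> s /DextP[t' A /forall_inP D]; apply/forall_inP => F FE.
apply: leq_trans (D F FE) _; apply: sub_count => r /allP C; apply/allP => y yus.
by apply/implyP => yF; rewrite -A ?s //; apply: (implyP (C y _)) => //; rewrite mem_enum.
Qed.

Lemma Dext_cons F rs t : F \in E -> {subset F <= rs} -> Dext rs t -> cons F t.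
Proof. by move=> FE s D; apply: (Nd_cons FE s); apply: Dext_Nd D. Qed.

Lemma Dext_split rs v t : v \notin rs -> Dext rs t = [exists c, Dext (v :: rs) (upd t v c)].
Proof.
move=> vr; have nv y : y \in rs -> (y == v) = false by move=> yr; apply: contraNF vr => /eqP<-.
apply/DextP/existsP => [[t' A D]|[c /DextP[t' A D]]].
  exists (t' v); apply/DextP; exists t' => // y; rewrite inE ffunE => /orP[/eqP->|yr].
    by rewrite eqxx.
  by rewrite nv // A.
by exists t' => // y yr; rewrite A ?inE ?yr ?orbT // ffunE nv.
Qed.

Lemma SumK_split rs v t : v \notin rs -> SumK rs t = (\sum_c SumK (v :: rs) (upd t v c))%R.
Proof.
move=> vr; have nv y : y \in rs -> (y == v) = false by move=> yr; apply: contraNF vr => /eqP<-.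
rewrite /SumK (partition_big (fun t' : asg => t' v) xpredT) //=; apply: eq_bigr => c _.
apply: eq_bigl => t'; rewrite ffunE eqxx andbC andbA; congr (_ && _ && _).
by apply: eq_in_all => y yr; rewrite ffunE nv.
Qed.

Lemma SumK0 rs t : ~~ Dext rs t -> SumK rs t = 0%R.
Proof.
by move=> D; rewrite /SumK big1 // => t' A; case/negP: D; apply/existsP; exists t'.
Qed.

Definition flg := @flag R X B' q.
Definition msg h kS t : R := if fr kS.1 then 1%R else ra h (bMS q kS.1) (code kS.2 t).
Definition wv h kS t : R := ra h (bWV q kS.1) (code kS.2 t * B + t kS.1).
Definition consall rs t := [forall F in E, (F \subset rs) ==> cons F t].

Definition fok h kS rk := [/\ {subset kS.2 <= rk}, kS.1 \notin rk & exists f : nat -> seq 'I_B,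
  mmrep (bCNT q kS.1) (bKID q kS.1) (bPRES q kS.1) h f /\
  forall t c, Dext rk t -> (c \in f (code kS.2 t)) = Dext (kS.1 :: rk) (upd t kS.1 c)].
Fixpoint foks h rk (fd : seq (X * seq X)) : Prop :=
  if fd is kS :: fd' then fok h kS rk /\ foks h (kS.1 :: rk) fd' else True.

Definition Kl rs (fd : seq (X * seq X)) := rs ++ map fst fd.

Definition hyp (H : {set {set X}}) (pend : seq (X * seq X)) rs := [/\ uniq rs,
  forall F, F \in H -> {subset F <= rs},
  forall F, F \in E -> F \subset rs -> F \in H,
  forall x, x \in rs -> exists2 F, F \in H & x \in F &
  forall kS, kS \in pend -> [set x in kS.2]%SET \in H /\ kS.1 \notin rs].

Definition qinv h pend fd rs := [/\ stat E sz rv pos h /\ (forall i, ra h gLB i = LB i),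
  forall x a i, x \in rs -> own2 q (vx x) a -> na h a i = 0 /\ ra h a i = 0%R,
  forall t, Dext rs t = consall rs t && all (fun kS => flg h kS t) pend,
  forall t, Dext (Kl rs fd) t -> SumK (Kl rs fd) t =
    ((\prod_(x <- rs) gx x (t x)) * (\prod_(kS <- fd) wv h kS t) * \prod_(kS <- pend) msg h kS t)%R &
  foks h rs fd].

Definition elU (H : {set {set X}}) v : {set X} := (\bigcup_(F in H | v \in F) F)%SET.

Fixpoint bags (H : {set {set X}}) (pend fd : seq (X * seq X)) rs : cmd * (seq (X * seq X) * seq (X * seq X)) :=
  if rs is v :: rs' then
    let us' := [seq x <- rev rs' | x \in elU H v] in
    let r := bags ((elU H v :\ v) |: [set F in H | v \notin F])%SET
      ((v, us') :: [seq kS <- pend | v \notin kS.2])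
      (if fr v then (v, us') :: fd else fd) rs' in
    (Cseq (bag E pos q fr ex v us' [seq kS <- pend | v \in kS.2]) r.1, r.2)
  else (Cskip, (pend, fd)).

Lemma hyp_step H pend v rs' : hyp H pend (v :: rs') ->
  let us' := [seq x <- rev rs' | x \in elU H v] in
  let ch := [seq kS <- pend | v \in kS.2] in
  [/\ hyp ((elU H v :\ v) |: [set F in H | v \notin F])%SET ((v, us') :: [seq kS <- pend | v \notin kS.2]) rs',
   rcons us' v =i elU H v, uniq (rcons us' v) &
   forall kS, kS \in ch -> {subset kS.2 <= rcons us' v} /\ kS.1 != v].
Proof.
move=> hh us' ch; have [/andP[vr ur] sH EH cov pH] := hh.
have vU : v \in elU H v.
  have [F FH vF] := cov v (mem_head _ _).
  by apply/bigcupP; exists F; rewrite ?FH.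
have UE : rcons us' v =i elU H v.
  move=> x; rewrite mem_rcons inE mem_filter mem_rev.
  case: eqVneq => [->|xv] /=; first by rewrite vU.
  case: (boolP (x \in elU H v)) => //= /bigcupP[F /andP[FH vF] xF].
  by have := sH F FH x xF; rewrite inE (negbTE xv).
have us'U : [set x in us']%SET = (elU H v :\ v)%SET.
  apply/setP => x; rewrite !inE -UE mem_rcons inE.
  by case: eqVneq => [->|//]; rewrite mem_filter mem_rev (negbTE vr) andbF.
split=> //.
- split=> //.
  + move=> F; rewrite !inE => /orP[/eqP-> x|/andP[FH vF] x xF].
      by rewrite -us'U inE mem_filter mem_rev => /andP[].
    have := sH F FH x xF; rewrite inE => /orP[/eqP xv|//]; by rewrite -xv xF in vF.
  + move=> F FE Fr; rewrite !inE.
    have vF : v \notin F by apply: contra vr => /(fintype.subsetP Fr).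
    rewrite vF andbT; apply/orP; right; apply: EH => //.
    by apply/fintype.subsetP => x /(fintype.subsetP Fr); rewrite inE orbC => ->.
  + move=> x xr; have xv : x != v by apply: contraNneq vr => <-.
    have [|F FH xF] := cov x; first by rewrite inE xr orbT.
    case: (boolP (v \in F)) => vF; last by exists F; rewrite // !inE FH vF orbT.
    exists (elU H v :\ v)%SET; first by rewrite !inE eqxx.
    by rewrite !inE xv; apply/bigcupP; exists F; rewrite ?FH.
  + move=> kS; rewrite inE => /orP[/eqP->|].
      by rewrite us'U !inE eqxx.
    rewrite mem_filter => /andP[vk /pH[kH]]; rewrite inE negb_or => /andP[_ ->]; split=> //.
    by rewrite !inE kH /= vk orbT.
- rewrite rcons_uniq filter_uniq ?rev_uniq // andbT.
  by rewrite mem_filter mem_rev (negbTE vr) andbF.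
- move=> kS; rewrite mem_filter => /andP[vk /pH[kH]]; rewrite inE negb_or => /andP[kv _]; split=> // x xk.
  by rewrite UE; apply/bigcupP; exists [set x in kS.2]%SET; rewrite ?kH !inE.
Qed.

Lemma Dext_step H pend v rs' h t : hyp H pend (v :: rs') ->
  (forall t, Dext (v :: rs') t = consall (v :: rs') t && all (fun kS => flg h kS t) pend) ->
  let us := rcons [seq x <- rev rs' | x \in elU H v] v in
  let vld t := all (fun kS => flg h kS t) [seq kS <- pend | v \in kS.2] in
  (forall c, Dext rs' t -> Dext (v :: rs') (upd t v c) = Nd E sz rv us (upd t v c) && vld (upd t v c)) /\
  Dext rs' t = [&& consall rs' t, [exists c, Nd E sz rv us (upd t v c) && vld (upd t v c)] &
     all (fun kS => flg h kS t) [seq kS <- pend | v \notin kS.2]].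
Proof.
move=> hh DE us vld; have [hh' UE uus chs] : [/\ _, _, _ & _] := hyp_step hh.
have [/= /andP[vr ur] sH EH cov pH] := hh.
have nv y : y \in rs' -> (y == v) = false by move=> yr; apply: contraNF vr => /eqP<-.
have usr : {subset us <= v :: rs'}.
  by move=> x; rewrite UE => /bigcupP[F /andP[FH _] xF]; exact: sH FH _ xF.
have eqo kS c c' : kS \in pend -> v \notin kS.2 -> flg h kS (upd t v c) = flg h kS t.
  move=> kp vk; rewrite /flg /flag (eq_code (t' := t)) // => y yk; rewrite ffunE.
  by rewrite (_ : (y == v) = false) //; apply: contraNF vk => /eqP <-.
have allsplit (P : pred (X * seq X)) : all P pend =
   all P [seq kS <- pend | v \in kS.2] && all P [seq kS <- pend | v \notin kS.2].
  by elim: pend {hh DE vld hh' chs pH eqo} => //= kS l ->; case: (v \in kS.2) => /=; [rewrite andbA|rewrite andbCA].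
have othE c : all (fun kS => flg h kS (upd t v c)) [seq kS <- pend | v \notin kS.2] =
   all (fun kS => flg h kS t) [seq kS <- pend | v \notin kS.2].
  by apply: eq_in_all => kS; rewrite mem_filter => /andP[vk kp]; exact: eqo.
have consE c : consall (v :: rs') (upd t v c) -> consall rs' t.
  move=> /forall_inP C; apply/forall_inP => F FE; apply/implyP => Fr.
  have := C F FE; rewrite (_ : F \subset v :: rs') /=; last first.
    by apply/fintype.subsetP => y /(fintype.subsetP Fr) yr; rewrite inE yr orbT.
  rewrite (eq_cons (t' := t)) // => y /(fintype.subsetP Fr) yr; by rewrite ffunE nv.
have consE' c : consall rs' t -> Nd E sz rv us (upd t v c) -> consall (v :: rs') (upd t v c).
  move=> /forall_inP C N; apply/forall_inP => F FE; apply/implyP => Fr.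
  case: (boolP (v \in F)) => vF.
    apply: (Nd_cons FE _ N) => y yF; rewrite UE; apply/bigcupP; exists F => //.
    by rewrite vF andbT; exact: EH.
  have Fr' : F \subset rs'.
    apply/fintype.subsetP => y yF; have := fintype.subsetP Fr y yF; rewrite inE => /orP[/eqP yv|//].
    by rewrite -yv yF in vF.
  have := C F FE; rewrite Fr' /= (eq_cons (t' := upd t v c)) // => y /(fintype.subsetP Fr') yr.
  by rewrite ffunE nv.
have fwd c : Dext (v :: rs') (upd t v c) -> [/\ Nd E sz rv us (upd t v c), vld (upd t v c), consall rs' t &
    all (fun kS => flg h kS t) [seq kS <- pend | v \notin kS.2]].
  move=> D; have := D; rewrite DE allsplit othE => /and3P[/consE cc va oa]; split=> //.
  exact: Dext_Nd D.
have main : Dext rs' t = [&& consall rs' t, [exists c, Nd E sz rv us (upd t v c) && vld (upd t v c)] &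
     all (fun kS => flg h kS t) [seq kS <- pend | v \notin kS.2]].
  rewrite (Dext_split _ vr); apply/existsP/and3P => [[c /fwd[N va cc oa]]|[cc /existsP[c /andP[N va]] oa]].
    by split=> //; apply/existsP; exists c; rewrite N va.
  by exists c; rewrite DE allsplit othE oa andbT consE' //=; exact: va.
split=> // c D; apply/idP/andP => [/fwd[]//|[N va]].
move: D; rewrite main => /and3P[cc _ oa].
by rewrite DE allsplit othE oa andbT consE' //=; exact: va.
Qed.

Lemma stat_off h h' : stat E sz rv pos h -> eqoff (own q) h h' -> stat E sz rv pos h'.
Proof.
have nq : (0 == q) = false by case: (q) q0.
move=> S e; apply: stat_eq S _ _ _ => [a i|F|F].
- by rewrite !inE => /orP[/eqP->|/eqP->]; [have [] := e gM i isT|have [] := e gID i isT].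
- by have [] := e (gSZ F) 0; rewrite // /own /= nq.
- by have [] := e (gOFF F) 0; rewrite // /own /= nq.
Qed.

Lemma foks_neq h rk fd kS x : foks h rk fd -> kS \in fd -> x \in rk -> kS.1 != x.
Proof.
elim: fd rk => //= k0 fd IH rk [[_ k0r _] fo]; rewrite inE => /orP[/eqP->|kin] xr.
  by apply: contraNneq k0r => ->.
by apply: (IH _ fo kin); rewrite inE xr orbT.
Qed.

Lemma foks_eq h h' rk fd : foks h rk fd ->
  (forall kS k i, kS \in fd -> na h' [:: k; q; vx kS.1] i = na h [:: k; q; vx kS.1] i) -> foks h' rk fd.
Proof.
elim: fd rk => //= k0 fd IH rk [[s k0r [f [mm fE]]] fo] e; split; last first.
  by apply: IH fo _ => kS k i kin; rewrite e // inE kin orbT.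
split=> //; exists f; split=> //; apply: mmrep_eq mm _ => a i.
by rewrite !inE => /or3P[] /eqP->; rewrite e ?mem_head.
Qed.

Hypothesis covE : forall x, exists2 F, F \in E & x \in F.

Lemma qinv_step H pend fd v rs' h : hyp H pend (v :: rs') -> qinv h pend fd (v :: rs') ->
  (~~ fr v -> fd = [::]) ->
  let us' := [seq x <- rev rs' | x \in elU H v] in
  let h1 := run (bag E pos q fr ex v us' [seq kS <- pend | v \in kS.2]) h in
  qinv h1 ((v, us') :: [seq kS <- pend | v \notin kS.2]) (if fr v then (v, us') :: fd else fd) rs' /\
  eqoff (own q) h h1.
Proof.
move=> hh [[st LBE] fresh DE SE fo] frv us' h1.
have [hh' UE uus chs] : [/\ _, _, _ & _] := hyp_step hh.
have [/andP[vr ur] sH EH cov pH] := hh.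
have fresh' a i : own2 q (vx v) a -> na h a i = 0 /\ ra h a i = 0%R by apply: fresh; rewrite mem_head.
have [f [e mm A Bv C]] := bag_ok (x := v) (us' := us') fr ex q0 uus chs st fresh' sz0 (fun y _ => covE y).
rewrite -/h1 in e mm Bv C.
set ch := [seq kS <- pend | v \in kS.2] in chs h1 e mm A Bv C *.
have VF t := (Dext_step t hh DE).1.
have VD t := (Dext_step t hh DE).2.
have eo : eqoff (own q) h h1 by apply: eqoff_sub e => a /andP[].
have off x k i : x != v -> na h1 [:: k; q; vx x] i = na h [:: k; q; vx x] i /\ ra h1 [:: k; q; vx x] i = ra h [:: k; q; vx x] i.
  move=> xv; apply: e; rewrite /own2 /= (_ : (vx x == vx v) = false) ?andbF //.
  by apply: contraNF xv => /eqP[] /pkX_inj ->.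
have pv kS : kS \in pend -> kS.1 != v.
  by move=> /pH[_]; rewrite inE negb_or => /andP[].
have flE kS t : kS \in pend -> flg h1 kS t = flg h kS t.
  by move=> /pv kv; rewrite /flg /flag (off kS.1 30 _ kv).1.
have msE kS t : kS \in pend -> msg h1 kS t = msg h kS t.
  by move=> /pv kv; rewrite /msg (off kS.1 34 _ kv).2.
have LBh i : ra h gLB i = LB i by [].
have wtE t : wt q fr ex v ch h t = (gx v (t v) * \prod_(kS <- ch) msg h kS t)%R.
  rewrite /wt LBh /gx; congr (_ * _)%R; rewrite /bch big_filter big_mkcond /=.
  by apply: eq_bigr => kS _; rewrite /msg; case: (fr kS.1).
have flv t : flg h1 (v, us') t = [exists c, Nd E sz rv (rcons us' v) (upd t v c) && all (fun kS => flg h kS (upd t v c)) ch].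
  rewrite /flg /flag /=; have [_ -> _ _] := mm (code us' t).
  apply/idP/existsP => [|[c]]; last by rewrite -A; case: (f _).
  by case E0 : (f (code us' t)) => [//|c l] _; exists c; rewrite -A E0 mem_head.
have us'r : {subset us' <= rs'} by move=> y; rewrite mem_filter mem_rev => /andP[].
have eqo kS c t : v \notin kS.2 -> msg h kS (upd t v c) = msg h kS t.
  move=> vk; rewrite /msg (eq_code (t' := t)) // => y yk; rewrite ffunE.
  by rewrite (_ : (y == v) = false) //; apply: contraNF vk => /eqP <-.
have prodsplit (w : X * seq X -> R) : (\prod_(kS <- pend) w kS =
   (\prod_(kS <- ch) w kS) * \prod_(kS <- [seq kS <- pend | v \notin kS.2]) w kS)%R.
  by rewrite (bigID (fun kS => v \in kS.2)) /= !big_filter.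
have prodo t : (\prod_(kS <- [seq kS <- pend | v \notin kS.2]) msg h1 kS t =
    \prod_(kS <- [seq kS <- pend | v \notin kS.2]) msg h kS t)%R.
  by rewrite big_seq [RHS]big_seq; apply: eq_bigr => kS; rewrite mem_filter => /andP[_ /msE->].
split=> //; split.
- by split=> [|i]; [exact: stat_off eo|have [_ ->] := eo gLB i isT].
- move=> x a i xr oa; have [|-> ->] := e a i; last by apply: fresh oa; rewrite inE xr orbT.
  apply: contraL oa => /andP[_ /eqP E1]; rewrite /own2 E1 negb_and; apply/orP; right.
  by apply: contraNneq vr => -[] /pkX_inj ->.
- move=> t; rewrite VD /= flv; congr [&& _, _ & _].
  by apply: eq_in_all => kS; rewrite mem_filter => /andP[_ /flE->].
- move=> t; case: (boolP (fr v)) => [fv|nfv].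
    move=> D; have DK : Dext (Kl (v :: rs') fd) t.
      by rewrite (@Dext_mem _ (Kl rs' ((v, us') :: fd))) // => y; rewrite /Kl /= !(mem_cat, inE) orbCA.
    rewrite (@SumK_mem _ (Kl (v :: rs') fd)); last by move=> y; rewrite /Kl /= !(mem_cat, inE) orbCA.
    rewrite SE // !big_cons /= prodsplit.
    have Dv : Dext (v :: rs') t by apply: Dext_sub DK => y; rewrite /Kl mem_cat => ->.
    have Nus : Nd E sz rv (rcons us' v) t.
      by apply: Dext_Nd Dv => y; rewrite mem_rcons !inE => /orP[->//|/us'r ->]; rewrite orbT.
    have vld : all (fun kS => flg h kS t) ch.
      by move: Dv; rewrite DE => /andP[_ /allP al]; apply/allP => kS; rewrite mem_filter => /andP[_ /al].
    have -> : wv h1 (v, us') t = wt q fr ex v ch h t by rewrite -Bv.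
    have -> : msg h1 (v, us') t = 1%R by rewrite /msg /= fv.
    rewrite wtE prodo mul1r.
    have -> : (\prod_(kS <- fd) wv h1 kS t = \prod_(kS <- fd) wv h kS t)%R.
      rewrite big_seq [RHS]big_seq; apply: eq_bigr => kS kf.
      by rewrite /wv (off kS.1 33 _ _).2 //; apply: foks_neq fo kf (mem_head _ _).
    by ring.
  have fd0 := frv nfv; subst fd; rewrite /Kl /= cats0 => D.
  rewrite (SumK_split _ vr) !big_cons !big_nil mulr1 prodo /msg /= (negbTE nfv) C -/(msg _ _ _).
  rewrite mulrCA mulr_suml (bigID (fun c => Dext (v :: rs') (upd t v c))) /= addrC big1 ?add0r; last first.
    by move=> c; exact: SumK0.
  apply: eq_big => [c|c Dc]; first exact: VF.
  have := SE (upd t v c); rewrite /Kl /= cats0 => -> //.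
  rewrite big_cons big_nil mulr1 prodsplit wtE ffunE eqxx.
  rewrite [X in (_ * X * _)%R](_ : _ = \prod_(x <- rs') gx x (t x))%R; last first.
    rewrite big_seq [RHS]big_seq; apply: eq_bigr => y yr; rewrite ffunE.
    by rewrite (_ : (y == v) = false) //; apply: contraNF vr => /eqP<-.
  rewrite [X in (_ * (_ * X))%R](_ : _ = \prod_(kS <- [seq kS <- pend | v \notin kS.2]) msg h kS t)%R; last first.
    rewrite big_seq [RHS]big_seq; apply: eq_bigr => kS; rewrite mem_filter => /andP[vk _]; exact: eqo.
  by rewrite - !mulrA; congr (_ * _)%R; rewrite mulrCA.
- have fo' : foks h1 (v :: rs') fd.
    apply: (foks_eq fo) => kS k i kf; apply: (off kS.1 k i _).1.
    by apply: foks_neq fo kf (mem_head _ _).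
  case: ifP => fv; last by rewrite (frv (negbT fv)).
  split=> //; split=> //; exists f; split=> // t c D.
  by rewrite A VF.
Qed.

Variable N : nat.
Hypothesis szN : forall F, F \in E -> sz F <= N.
Local Notation n := #|X|.

Definition bnd (U : {set X}) (A : R) := forall T C : R, (0 <= C)%R ->
  (forall lam : {set X} -> R, (forall F, F \in E -> (0 <= lam F)%R) ->
     (forall y, y \in U -> (1 <= \sum_(F in E | y \in F) lam F)%R) ->
     (T <= C * N%:R `^ (\sum_(F in E) lam F))%R) -> (T <= C * A)%R.

Definition base1 : nat := #|E| * (20 + N * (105 + n * 300)).
Definition base2 : nat := 1000 + 30 * n + n * (400 * #|E|.+1).

Lemma size_uniq_le (s : seq X) : uniq s -> size s <= n.
Proof. by move=> /card_uniqP <-; exact: max_card. Qed.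

Lemma bag_cost H pend v rs' h A : hyp H pend (v :: rs') -> stat E sz rv pos h ->
  (forall a i, own2 q (vx v) a -> na h a i = 0 /\ ra h a i = 0%R) ->
  all (fun kS => uniq kS.2) pend -> bnd (elU H v) A ->
  ((cost (bag E pos q fr ex v [seq x <- rev rs' | x \in elU H v] [seq kS <- pend | v \in kS.2]) h)%:R <=
    base1%:R + (base2 + size [seq kS <- pend | v \in kS.2] * (200 + 60 * n))%:R * A)%R.
Proof.
move=> hh st fresh upend bA.
set us' := [seq x <- rev rs' | x \in elU H v].
set ch := [seq kS <- pend | v \in kS.2].
have [hh' UE uus chs] : [/\ _, _, _ & _] := hyp_step hh.
rewrite -/us' in UE uus chs.
have szus : size (rcons us' v) <= n by exact: size_uniq_le.
have lc : lcost us' ch + size (rcons us' v) * (400 * #|E|.+1) <= base2 + size ch * (200 + 60 * n).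
  rewrite /lcost /base2 addnAC leq_add //.
    rewrite leq_add ?leq_mul // leq_add2l leq_mul //.
    by apply: leq_trans szus; rewrite size_rcons.
  rewrite -(sum_seq_const ch) /= big_seq [X in _ <= X]big_seq.
  apply: leq_sum => kS; rewrite mem_filter => /andP[_ kp]; rewrite leq_add2l leq_mul //.
  by apply: size_uniq_le; exact: (allP upend).
have tr : \sum_(F <- enum E) (20 + sz F * (105 + size (rcons us' v) * 300)) <= base1.
  rewrite /base1 cardE -(sum_seq_const (enum E)) big_seq [X in _ <= X]big_seq.
  apply: leq_sum => F; rewrite mem_enum => FE.
  by rewrite leq_add2l leq_mul ?szN // leq_add2l leq_mul.
rewrite -lerBlDl; apply: bA; first exact: ler0n.
move=> lam lam0 lam1; rewrite lerBlDl.
have [|_ c] := @bag_dfs R X E B' sz rv pos q fr ex q0 v us' ch uus chs h st fresh sz0 lam lam0.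
  by move=> y; rewrite UE; exact: lam1.
apply: le_trans c _; apply: lerD; first by rewrite ler_nat.
apply: ler_pM => //.
- by apply: le_trans (Phi_ge1 lam0 _); rewrite ?ler01 //; apply/forall_inP => F FE; rewrite /nF count_predT size_iota sz0.
- by rewrite -natrD ler_nat.
- by apply: Phi0_le => // F FE; rewrite sz0 ?szN.
Qed.

Lemma bags_ok rs H pend fd h A : (0 <= A)%R -> hyp H pend rs -> qinv h pend fd rs ->
  pairwise (fun x y => fr x ==> fr y) rs -> (fd != [::] -> all fr rs) ->
  all (fun kS => uniq kS.2) pend -> all (fun kS => uniq kS.2) fd ->
  (forall U, U \in elim_sets H rs -> bnd U A) ->
  let r := bags H pend fd rs in let h' := run r.1 h in
  [/\ qinv h' r.2.1 r.2.2 [::], eqoff (own q) h h',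
    map fst r.2.2 = rev [seq x <- rs | fr x] ++ map fst fd,
    [/\ exists H', hyp H' r.2.1 [::], all (fun kS => uniq kS.2) r.2.2 & size r.2.1 <= size pend + size rs] &
    ((cost r.1 h)%:R <= (size rs * base1)%:R + (size rs * base2)%:R * A +
       ((size pend + size rs) * (200 + 60 * n))%:R * A)%R].
Proof.
move=> A0; elim: rs H pend fd h => [|v rs' IH] H pend fd h hh qi pw ff up uf bU /=.
  by split=> //; [split=> //; [exists H|rewrite addn0]|rewrite mul0n mul0r !add0r mulr_ge0 ?ler0n].
have [hh' UE uus chs] : [/\ _, _, _ & _] := hyp_step hh.
have frv : ~~ fr v -> fd = [::].
  by move=> nf; apply/eqP; apply: contraNT nf => /ff /andP[].
have [qi' eo] := qinv_step hh qi frv.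
have bc := @bag_cost H pend v rs' h A hh _ _ up (bU _ (mem_head _ _)).
set us' := [seq x <- rev rs' | x \in elU H v] in hh' qi' eo bc *.
set ch := [seq kS <- pend | v \in kS.2] in hh' qi' eo bc *.
set h1 := run _ h in qi' eo.
move: pw => /= /andP[pv pw].
have up' : all (fun kS => uniq kS.2) ((v, us') :: [seq kS <- pend | v \notin kS.2]).
  rewrite /= all_filter; apply/andP; split.
    by move: uus; rewrite rcons_uniq => /andP[].
  by apply: sub_all up => kS /= uk; apply/implyP.
have ff' : (if fr v then (v, us') :: fd else fd) != [::] -> all fr rs'.
  case: ifP => [fv _|/negbT/frv->//].
  by apply: sub_all pv => y; rewrite fv.
have uf' : all (fun kS => uniq kS.2) (if fr v then (v, us') :: fd else fd).
  by case: ifP => //= _; rewrite uf andbT; move: uus; rewrite rcons_uniq => /andP[].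
have [Q1 Q2 Q3 [Q5 Q6 Q7] Q4] := IH _ _ _ h1 hh' qi' pw ff' up' uf' (fun U Ui => bU U (@mem_behead _ (_ :: _) U Ui)).
split=> //.
- exact: eqoff_trans eo Q2.
- rewrite Q3; case: (fr v) => //=; first by rewrite rev_cons cat_rcons.
- split=> //; apply: leq_trans Q7 _; rewrite /= addSnnS leq_add2r size_filter; exact: count_size.
have szp : size ch + size [seq kS <- pend | v \notin kS.2] = size pend.
  by rewrite !size_filter -(count_predC (fun kS => v \in kS.2)).
rewrite natrD; apply: le_trans (lerD (bc _ _) Q4) _.
- by case: qi => -[].
- by move=> a i; case: qi => _ fresh _ _ _; apply: fresh; rewrite mem_head.
by rewrite - szp le_eqVlt -(arith_bags base1 base2 (200 + 60 * n) (size ch)) eqxx.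
Qed.
End Elim.

Lemma arith_out1 a s s' D c : 0 < s' -> c <= s' * D -> a <= 3 + s * (100 + D) ->
  a + (5 + (69 + c)) <= 3 + (s + s') * (100 + D).
Proof. nia. Qed.

Lemma arith_out2 m k s c lc f : 0 < s -> m <= k -> c <= 3 + s * (100 + (lc + f * (200 + 20 * k))) ->
  1 + (1 + m * 14) + 5 + 10 + c <= s * (lc + f.+1 * (200 + 20 * k)).
Proof. nia. Qed.

Section Output.
Variables (R : realType) (X : finType) (E : {set {set X}}) (B' : nat).
Local Notation B := B'.+1.
Notation asg := {ffun X -> 'I_B}.
Variables (sz : {set X} -> nat) (rv : {set X} -> nat -> X -> 'I_B) (pos : {set X} -> X -> nat).
Variables (q : nat) (fr : pred X) (ex : X -> nat) (LB : nat -> R).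
Hypothesis q0 : 0 < q.
Implicit Types (h : hst R) (x : X) (t : asg) (kS : X * seq X) (c : 'I_B).
Local Notation n := #|X|.
Local Notation Dext := (Dext E sz rv).
Local Notation wv := (wv q).
Local Notation msg := (msg q fr).

Definition oKEY d : nm := [:: 21; q; 0; d].
Definition oK d : nm := [:: 22; q; 0; d].
Definition oVAL d : nm := [:: 23; q; 0; d].
Definition oACC d : nm := [:: 25; q; 0; d].
Definition oOK : nm := [:: 26; q; 0; 0].

Definition ohcode (vs s : seq X) : nexp :=
  foldl (fun a y => a *! Nv gM +! Nv (oVAL (index y vs).+1)) (Nc 0) s.

Definition o_pick d (k : X) : cmd :=
  Cseq (Cs (oVAL d.+1) (Na (bKID q k) (Nv (oKEY d.+1) *! Nv gM +! Nv (oK d.+1))))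
       (CRo RMul (oACC d.+1) (Nc 0) (oACC d) (Nc 0) (bWV q k) (Nv (oKEY d.+1) *! Nv gM +! Nv (oVAL d.+1))).

Fixpoint odfs (vs : seq X) d (fd : seq (X * seq X)) (leaf : cmd) : cmd :=
  if fd is kS :: fd' then
    Cseq (Cs (oKEY d.+1) (ohcode vs kS.2))
         (Cfor (oK d.+1) (Na (bCNT q kS.1) (Nv (oKEY d.+1))) (Cseq (o_pick d kS.1) (odfs vs d.+1 fd' leaf)))
  else leaf.

Variable LW : pred nm.
Hypothesis LWn : forall a, LW a -> ~~ own q a && (a != gM).

Definition OW d (a : nm) := [&& own2 q 0 a, 20 <= nth 0 a 0, nth 0 a 0 < 30 & d < nth 0 a 3] || LW a.

Lemma OW_sub d : subpred (OW d.+1) (OW d).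
Proof.
by move=> a /orP[/and4P[A C D e]|L]; apply/orP; [left; rewrite A C D ltnW|right].
Qed.

Lemma odfs_wr vs d fd leaf : all LW (wr leaf) -> all (OW d) (wr (odfs vs d fd leaf)).
Proof.
move=> wl; elim: fd d => [|kS fd IH] d; first by apply: sub_all wl => a La; rewrite /OW La orbT.
have w k s : 20 <= k < 30 -> OW d [:: k, q, 0, d.+1 & s].
  by move=> /andP[k1 k2]; rewrite /OW /own2 /own /= !eqxx k1 k2 ltnSn.
rewrite -[wr _]/[:: oKEY d.+1, oK d.+1, oVAL d.+1, oACC d.+1 & wr (odfs vs d.+1 fd leaf)].
rewrite -[all _ _]/[&& _, _, _, _ & _]; apply/and5P; split; try exact: w.
by apply: sub_all (IH d.+1); exact: OW_sub.
Qed.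

Variables (hq : hst R) (fd0 pend : seq (X * seq X)).
Hypothesis gMq : na hq gM 0 = B.
Hypothesis fdok : foks E sz rv q hq [::] fd0.
Hypothesis pend0 : forall kS, kS \in pend -> kS.2 = [::].
Local Notation vs := (map fst fd0).
Hypothesis uvs : uniq vs.

Definition root t : R := (\prod_(kS <- pend) msg hq kS t)%R.
Definition acc (p : seq (X * seq X)) t : R := (root t * \prod_(kS <- p) wv hq kS t)%R.
Definition SO (a : nm) := own2 q 0 a || LW a.

Definition OG x0 p t h := [/\ eqoff SO hq h,
  forall i, i < size p -> na h (oVAL i.+1) 0 = t (nth x0 (map fst p) i) &
  ra h (oACC (size p)) 0 = acc p t].

Lemma OW_SO d : subpred (OW d) SO.
Proof. by move=> a /orP[/and4P[A _ _ _]|L]; rewrite /SO ?A ?L ?orbT. Qed.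

Lemma nOW k s d : 20 <= k < 30 -> nth 0 s 0 <= d -> ~~ OW d [:: k, q, 0 & s].
Proof.
move=> /andP[k1 k2] sd; rewrite /OW negb_or /= [d < _]ltnNge sd !andbF /=.
by apply/negP => /LWn; rewrite /own /= eqxx.
Qed.

Lemma OG_eq x0 p t h h' : OG x0 p t h -> eqoff (OW (size p)) h h' -> OG x0 p t h'.
Proof.
move=> [e V A] e'; split.
- by apply: eqoff_trans e _; apply: eqoff_sub e'; exact: OW_SO.
- by move=> i ip; have [|->] := e' (oVAL i.+1) 0; [exact: nOW|rewrite V].
- by have [|_ ->] := e' (oACC (size p)) 0; [exact: nOW|].
Qed.

Lemma foks_sub h rk p fd : foks E sz rv q h rk (p ++ fd) ->
  forall kS, kS \in p -> {subset kS.2 <= rk ++ map fst p}.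
Proof.
elim: p rk => //= k0 p IH rk [[s _ _] fo] kS; rewrite inE => /orP[/eqP->|kp] y ys.
  by rewrite mem_cat s.
by have := IH _ fo kS kp y ys; rewrite !(mem_cat, inE) orbCA orbA orbC orbA orbAC => ->; rewrite ?orbT.
Qed.

Lemma foks_at h rk p kS fd : foks E sz rv q h rk (p ++ kS :: fd) -> fok E sz rv q h kS (rev (map fst p) ++ rk).
Proof.
elim: p rk => [rk []//|k0 p IH rk /= [_ /IH]].
by rewrite rev_cons cat_rcons.
Qed.

Lemma ohcodeE x0 p t h s : na h gM 0 = B -> (forall i, i < size p -> na h (oVAL i.+1) 0 = t (nth x0 (map fst p) i)) ->
  (exists fd, fd0 = p ++ fd) -> {subset s <= map fst p} -> evn h (ohcode vs s) = code s t.
Proof.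
move=> eM V [fd efd]; elim/last_ind: s => // s y IH sub.
rewrite /ohcode foldl_rcons -/(ohcode vs s) code_rcons /= eM IH; last first.
  by move=> z zs; apply: sub; rewrite mem_rcons inE zs orbT.
have yp : y \in map fst p by apply: sub; rewrite mem_rcons mem_head.
have iE : index y vs = index y (map fst p) by rewrite efd map_cat index_cat yp.
by rewrite iE V ?nth_index // -(size_map fst) index_mem.
Qed.

Lemma ohcode_nsz s : nsz (ohcode vs s) = 1 + size s * 14.
Proof.
elim/last_ind: s => // s y IH; rewrite /ohcode foldl_rcons -/(ohcode vs s) /= IH size_rcons; lia.
Qed.

Variables (leaf : cmd) (lc : nat) (x0 : X) (Inv : seq asg -> hst R -> Prop).
Hypothesis wleaf : all LW (wr leaf).
Hypothesis InvE : forall dn h h', Inv dn h -> eqoff (own2 q 0) h h' -> Inv dn h'.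
Hypothesis leaf_ok : forall t dn h, Dext vs t -> OG x0 fd0 t h -> Inv dn h ->
  Inv (rcons dn t) (run leaf h) /\ cost leaf h <= lc.
Hypothesis szS : forall kS, kS \in fd0 -> size kS.2 <= n.

Definition extd (fd : seq (X * seq X)) t t' := Dext vs t' && [forall y, (y \notin map fst fd) ==> (t' y == t y)].

Lemma extd_cons kS fd t t' c : kS.1 \notin map fst fd ->
  extd fd (upd t kS.1 c) t' = extd (kS :: fd) t t' && (t' kS.1 == c).
Proof.
move=> xus; rewrite /extd -andbA; congr andb; apply/forallP/andP => [A|[/forallP A /eqP tx] y].
  split; last by have := A kS.1; rewrite xus ffunE eqxx.
  apply/forallP => y; rewrite inE negb_or; apply/implyP => /andP[/negbTE yx yus].
  by have := A y; rewrite yus ffunE yx.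
rewrite ffunE; case: (eqVneq y kS.1) => [->|yx]; first by rewrite tx eqxx implybT.
by have := A y; rewrite inE negb_or yx.
Qed.

Lemma odfs_ok fd p t h dn : fd0 = p ++ fd -> Dext (map fst p) t -> OG x0 p t h -> Inv dn h ->
  exists l, [/\ uniq l, forall t', (t' \in l) = extd fd t t', Inv (dn ++ l) (run (odfs vs (size p) fd leaf) h),
    0 < size l & cost (odfs vs (size p) fd leaf) h <= size l * (lc + size fd * (200 + 20 * n))].
Proof.
elim: fd p t h dn => [|kS fd IH] p t h dn efd Dp0 Gh Ih.
  rewrite cats0 in efd; subst p; have [Il cl] := leaf_ok Dp0 Gh Ih.
  exists [:: t]; rewrite cats1 mul1n mul0n addn0; split=> // t'; rewrite inE /extd.
  apply/eqP/andP => [->|[_ /forallP A]].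
    by split=> //; apply/forallP => y; rewrite eqxx implybT.
  by apply/ffunP => y; apply/eqP; have := A y.
set d := size p; set k := kS.1.
have efd' : fd0 = rcons p kS ++ fd by rewrite cat_rcons.
have [eh V AC] := Gh.
have fo := fdok; rewrite efd in fo.
have [sS kp [f [mm fE]]] := foks_at fo.
rewrite cats0 in sS kp fE.
have kvs : k \notin map fst fd.
  by have := uvs; rewrite efd map_cat cat_uniq /= => /and3P[_ _ /andP[]].
have {}kp : k \notin map fst p by rewrite -mem_rev.
have {}sS : {subset kS.2 <= map fst p} by move=> y /sS; rewrite mem_rev.
have {}fE c : (c \in f (code kS.2 t)) = Dext (map fst (rcons p kS)) (upd t k c).
  rewrite fE; last by rewrite (@Dext_mem _ _ _ _ _ _ (map fst p)) // => y; rewrite mem_rev.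
  by apply: Dext_mem => y; rewrite map_rcons mem_rcons !inE mem_rev.
have nSO j (s : X) : ~~ SO [:: j; q; vx s].
  rewrite /SO negb_or; apply/andP; split; first by rewrite /own2 /= andbF.
  by apply/negP => /LWn; rewrite /own /= eqxx.
have nSOM : ~~ SO gM by rewrite /SO /=; apply/negP => /LWn; rewrite eqxx andbF.
set cs := f (code kS.2 t) in fE.
have [ucs eCNT eKID _] := mm (code kS.2 t); rewrite -/cs in ucs eCNT eKID.
have wO j s : 20 <= j < 30 -> OW d [:: j, q, 0, d.+1 & s].
  by move=> /andP[k1 k2]; rewrite /OW /own2 /own /= !eqxx k1 k2 ltnSn.
set h1 := run (Cs (oKEY d.+1) (ohcode vs kS.2)) h.
have G1 : OG x0 p t h1 by apply: (OG_eq Gh); apply: eqoff_run; rewrite /= wO.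
have K1 : na h1 (oKEY d.+1) 0 = code kS.2 t.
  rewrite /h1 /Cs /= !eqxx /=; apply: (ohcodeE _ V) => //; last by exists (kS :: fd).
  by have [-> _] := eh gM 0 nSOM.
have ebound : evn h1 (Na (bCNT q k) (Nv (oKEY d.+1))) = size cs.
  by rewrite -[LHS]/(na h1 (bCNT q k) (na h1 (oKEY d.+1) 0)) K1; case: G1 => e1 _ _; have [-> _] := e1 (bCNT q k) (code kS.2 t) (nSO 30 k).
set body := odfs vs d.+1 fd leaf.
have wb : all (OW d.+1) (wr body) by exact: odfs_wr.
have wbody : all (OW d) (wr (Cseq (o_pick d k) body)).
  rewrite -[wr _]/[:: oVAL d.+1, oACC d.+1 & wr body] -[all _ _]/[&& _, _ & _].
  by apply/and3P; split; [exact: wO|exact: wO|apply: sub_all wb; exact: OW_sub].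
pose kk := 200 + 20 * n.
pose I j h' := [/\ OG x0 p t h', na h' (oKEY d.+1) 0 = code kS.2 t &
  exists l, [/\ uniq l, forall t', (t' \in l) = extd (kS :: fd) t t' && (t' k \in take j cs),
     Inv (dn ++ l) h', j <= size l &
     cost (Cfor (oK d.+1) (Nc j) (Cseq (o_pick d k) body)) h1 + 0 <= 3 + size l * (100 + (lc + size fd * kk)) /\
     h' = run (Cfor (oK d.+1) (Nc j) (Cseq (o_pick d k) body)) h1]].
have Il1 : Inv dn h1.
  by apply: (InvE Ih); apply: eqoff_run; rewrite /= /own2 /own /= !eqxx.
have : I (size cs) (run (Cfor (oK d.+1) (Nc (size cs)) (Cseq (o_pick d k) body)) h1).
  have := leqnn (size cs); move: {1 3 4}(size cs) => j; elim: j => [_|j IHj js].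
    split=> //; exists [::]; rewrite cats0; split=> //; first by move=> t'; rewrite take0 andbF.
    by split; rewrite //= big_ord0.
  have {IHj} [G2 K2 [l [ul ml Il jl [cl _]]]] := IHj (ltnW js).
  set h2 := run (Cfor _ (Nc j) _) h1 in G2 K2 Il *.
  have runS : run (Cfor (oK d.+1) (Nc j.+1) (Cseq (o_pick d k) body)) h1 =
    run (Cseq (o_pick d k) body) (setn h2 (oK d.+1) 0 j) by [].
  have costS : cost (Cfor (oK d.+1) (Nc j.+1) (Cseq (o_pick d k) body)) h1 =
    cost (Cfor (oK d.+1) (Nc j) (Cseq (o_pick d k) body)) h1 + (5 + cost (Cseq (o_pick d k) body) (setn h2 (oK d.+1) 0 j)).
    by rewrite /= big_ord_recr /= addnA.
  set c := nth ord0 cs j.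
  set h3 := setn h2 (oK d.+1) 0 j in runS costS *.
  have cin : c \in cs by exact: mem_nth.
  have G3 : OG x0 p t h3.
    by apply: (OG_eq G2); apply: (@eqoff_run _ _ (Cs (oK d.+1) (Nc j))); rewrite /= wO.
  set h4 := run (o_pick d k) h3.
  have [e3 V3 A3] := G3.
  have gM3 : na h3 gM 0 = B by have [-> _] := e3 gM 0 nSOM.
  have K3 : na h3 (oKEY d.+1) 0 = code kS.2 t by rewrite -K2.
  have V4 : na h4 (oVAL d.+1) 0 = c.
    rewrite /h4 /o_pick /Cs /= !eqxx /= K2 (_ : na h2 gM 0 = B) //.
    by rewrite -eKID // -(e3 (bKID q k) (code kS.2 t * B + j) (nSO 31 k)).1.
  have G4 : OG x0 p t h4.
    by apply: (OG_eq G3); apply: eqoff_run; rewrite /= !wO.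
  have eqp kS' : kS' \in p -> wv hq kS' (upd t k c) = wv hq kS' t.
    move=> kp'; have sub := foks_sub fo kp'.
    have nk y : y \in map fst p -> (y == k) = false by move=> yp; apply: contraNF kp => /eqP<-.
    rewrite /wv ffunE nk ?map_f // (eq_code (t' := t)) // => y /sub yp.
    by rewrite ffunE nk.
  have eqroot : root (upd t k c) = root t.
    rewrite /root big_seq [RHS]big_seq; apply: eq_bigr => kS' /pend0 e0.
    by rewrite /msg e0.
  have A4 : ra h4 (oACC d.+1) 0 = acc (rcons p kS) (upd t k c).
    rewrite /acc eqroot -cats1 big_cat big_seq1 mulrA.
    have -> : (root t * \prod_(i <- p) wv hq i (upd t k c) = ra h3 (oACC d) 0)%R.
      rewrite A3 /acc; congr (_ * _)%R; rewrite big_seq [RHS]big_seq; exact: eq_bigr.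
    have -> : wv hq kS (upd t k c) = ra h3 (bWV q k) (code kS.2 t * B + c).
      have [_ ->] := e3 (bWV q k) (code kS.2 t * B + c) (nSO 33 k).
      rewrite /wv -/k ffunE eqxx (eq_code (t' := t)) // => y /sS yp; rewrite ffunE.
      by rewrite (_ : (y == k) = false) //; apply: contraNF kp => /eqP<-.
    by rewrite - V4 /h4 /o_pick /Cs /= !eqxx /= K2 (_ : na h2 gM 0 = B) //.
  have G5 : OG x0 (rcons p kS) (upd t k c) h4.
    have [e4 V4' _] := G4; split=> //; rewrite ?size_rcons // => i.
    rewrite ltnS leq_eqVlt map_rcons nth_rcons size_map => /orP[/eqP->|ip].
      by rewrite ltnn eqxx ffunE eqxx.
    rewrite ip V4' // ffunE (_ : (_ == k) = false) //.
    by apply/negbTE; apply: contraNneq kp => <-; rewrite mem_nth ?size_map.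
  have Il4 : Inv (dn ++ l) h4.
    apply: (InvE Il); apply: (@eqoff_trans _ _ _ h3).
      by apply: (@eqoff_run _ _ (Cs (oK d.+1) (Nc j))); rewrite /= /own2 /own /= !eqxx.
    by apply: eqoff_run; rewrite /= /own2 /own /= !eqxx.
  have Dc : Dext (map fst (rcons p kS)) (upd t k c) by rewrite -fE.
  have [l' [ul' ml' Il' l'0 cl']] := IH _ _ _ _ efd' Dc G5 Il4.
  rewrite size_rcons -/d -/body -catA in Il' cl'.
  have takeS : take j.+1 cs = rcons (take j cs) c by rewrite (take_nth ord0).
  split.
  - by rewrite runS; apply: (OG_eq G3); exact: eqoff_run.
  - rewrite runS; have [||-> //] := @frameP R (fun a => a != oKEY d.+1) (Cseq (o_pick d k) body) h3 (oKEY d.+1) 0; last by rewrite eqxx.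
    rewrite -[wr _]/[:: oVAL d.+1, oACC d.+1 & wr body] -[all _ _]/[&& true, true & _] /=.
    by apply/allP => a /(allP wb); apply: contraTneq => ->; exact: nOW.
  exists (l ++ l'); rewrite runS; split=> //.
  - rewrite cat_uniq ul ul' andbT; apply/hasPn => t'; rewrite ml' extd_cons // ml.
    move=> /andP[_ /eqP->]; apply/nandP; right.
    by move: (take_uniq j.+1 ucs); rewrite takeS rcons_uniq => /andP[-> _].
  - move=> t'; rewrite mem_cat ml ml' extd_cons // takeS mem_rcons inE.
    by case: extd => //=; rewrite orbC.
  - by rewrite size_cat -addn1 leq_add.
  - split=> //; rewrite size_cat addn0 costS.
    rewrite -[cost (Cseq (o_pick d k) body) h3]/(69 + cost body h4).
    by apply: arith_out1 l'0 cl' _; move: cl; rewrite addn0.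
move=> [G2 K2 [l [ul ml Il cl [cst _]]]].
have runE : run (odfs vs d (kS :: fd) leaf) h = run (Cfor (oK d.+1) (Nc (size cs)) (Cseq (o_pick d k) body)) h1.
  by rewrite -[LHS]/(iteri (evn h1 (Na (bCNT q k) (Nv (oKEY d.+1)))) (fun j h => run (Cseq (o_pick d k) body) (setn h (oK d.+1) 0 j)) h1) ebound.
have costE : cost (odfs vs d (kS :: fd) leaf) h = 1 + (1 + size kS.2 * 14) + 5 + 10 +
    cost (Cfor (oK d.+1) (Nc (size cs)) (Cseq (o_pick d k) body)) h1.
  rewrite -[LHS]/(1 + nsz (ohcode vs kS.2) + 5 + (11 + 2 + \sum_(j < evn h1 (Na (bCNT q k) (Nv (oKEY d.+1))))
    (5 + cost (Cseq (o_pick d k) body) (setn (iteri j (fun j h => run (Cseq (o_pick d k) body) (setn h (oK d.+1) 0 j)) h1) (oK d.+1) 0 j)))) ebound ohcode_nsz.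
  by rewrite - !addnA; congr (_ + (_ + (_ + (_ + _)))).
have l0 : 0 < size l.
  apply: leq_trans cl; move: Dp0; rewrite (Dext_split E sz rv _ kp) => /existsP[c].
  rewrite (@Dext_mem _ _ _ _ _ _ (map fst (rcons p kS))) -?fE; last by move=> y; rewrite map_rcons mem_rcons.
  by case: cs {G2 K2 ml Il ebound runE costE cst ucs eCNT eKID fE I}.
exists l; rewrite runE; split=> //.
  move=> t'; rewrite ml take_size; case: (boolP (extd (kS :: fd) t t')) => //= /andP[D /forallP Ag].
  rewrite fE; have := @Dext_sub _ E _ sz rv vs (map fst (rcons p kS)) t' _ D.
  rewrite (@eq_Dext _ E _ sz rv (map fst (rcons p kS)) t' (upd t k (t' k))).
    by apply=> y; rewrite efd' map_cat mem_cat => ->.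
  move=> y; rewrite map_rcons mem_rcons inE ffunE; case: (eqVneq y k) => [->//|yk] /= yp.
  apply/eqP; apply: (implyP (Ag y)); rewrite inE negb_or yk /=.
  by have := uvs; rewrite efd map_cat cat_uniq /= => /and3P[_ /norP[_ /hasPn H] _]; apply/negP => /H; rewrite yp.
rewrite costE; apply: arith_out2 l0 _ _; last by rewrite addn0 in cst; exact: cst.
by apply: szS; rewrite efd mem_cat mem_head orbT.
Qed.
End Output.

Lemma arith_query n b1 b2 l0 L c1 (K : realFieldType) (A : K) (l p : nat) : p <= n -> c1 <= 100 + p * 60 + l * L ->
  ((n * b1)%:R + (n * b2)%:R * A + ((0 + n) * l0)%:R * A + c1%:R <=
  (n * b1 + 100 + 60 * n + l * L)%:R + (n * b2 + n * l0)%:R * A)%R.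
Proof.
move=> pn c; rewrite add0n [X in (_ <= _ + X * _)%R]natrD mulrDl.
have : (c1%:R <= (100 + 60 * n + l * L)%:R :> K)%R by rewrite ler_nat; nia.
rewrite -[n * b1 + 100 + _ + _]addnA -[n * b1 + 100 + _]addnA natrD [(n * b1 + _)%:R%R]natrD; lra.
Qed.

Section Query.
Variables (R : realType) (X : finType) (E : {set {set X}}) (B' : nat).
Local Notation B := B'.+1.
Notation asg := {ffun X -> 'I_B}.
Variables (sz : {set X} -> nat) (rv : {set X} -> nat -> X -> 'I_B) (pos : {set X} -> X -> nat).
Variables (q : nat) (fr : pred X) (ex : X -> nat) (LB : nat -> R) (o : seq X).
Hypothesis q0 : 0 < q.
Hypothesis sz0 : forall F, F \in E -> 0 < sz F.
Hypothesis covE : forall x : X, exists2 F, F \in E & x \in F.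
Hypotheses (uo : uniq o) (eo : forall x, x \in o).
Hypothesis fro : pairwise (fun x y => fr x ==> fr y) (rev o).
Implicit Types (h : hst R) (x : X) (t : asg) (kS : X * seq X) (c : 'I_B).
Local Notation n := #|X|.
Local Notation Dext := (Dext E sz rv).
Local Notation vs := [seq x <- o | fr x].

Definition q_ok kS : cmd := Cs (oOK q) (Nv (oOK q) *! Na (bCNT q kS.1) (Nc 0)).
Definition q_ms kS : cmd := CRo RMul (oACC q 0) (Nc 0) (oACC q 0) (Nc 0) (bMS q kS.1) (Nc 0).
Definition q_out (pend fd : seq (X * seq X)) (leaf : cmd) : cmd :=
  Cseq (Cs (oOK q) (Nc 1)) (Cseq (seqs (map q_ok pend))
   (Cif (Ble (Nc 1) (Nv (oOK q))) (Cseq (CRc (oACC q 0) (Nc 0) 1)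
     (Cseq (seqs (map q_ms [seq kS <- pend | ~~ fr kS.1])) (odfs q vs 0 fd leaf))) Cskip)).
Definition query (leaf : cmd) : cmd :=
  let r := bags E pos q fr ex E [::] [::] (rev o) in Cseq r.1 (q_out r.2.1 r.2.2 leaf).

Variables (LW : pred nm) (leaf : cmd) (lc : nat) (x0 : X) (Inv : seq asg -> hst R -> Prop) (h : hst R).
Hypothesis LWn : forall a, LW a -> ~~ own q a && (a != gM).
Hypothesis wleaf : all LW (wr leaf).
Hypothesis Ih : Inv [::] h.
Hypothesis InvE : forall dn h h', Inv dn h -> eqoff (own q) h h' -> Inv dn h'.
Hypothesis st : stat E sz rv pos h.
Hypothesis LBE : forall i, ra h gLB i = LB i.
Hypothesis fresh : forall a i, own q a -> na h a i = 0 /\ ra h a i = 0%R.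
Hypothesis leaf_ok : forall t dn h', Dext vs t ->
  (forall i, i < size vs -> na h' (oVAL q i.+1) 0 = t (nth x0 vs i)) ->
  ra h' (oACC q (size vs)) 0 = SumK E sz rv ex LB vs t ->
  eqoff (fun a => own q a || LW a) h h' -> Inv dn h' ->
  Inv (rcons dn t) (run leaf h') /\ cost leaf h' <= lc.
Variables (N : nat) (A : R).
Hypothesis szN : forall F, F \in E -> sz F <= N.
Hypothesis A0 : (0 <= A)%R.
Hypothesis bU : forall U, U \in elim_sets E (rev o) -> bnd E N U A.

Lemma Dext_full t : Dext (rev o) t = Dp E sz rv t.
Proof.
apply/DextP/idP => [[t' e D]|D]; last by exists t.
suff -> : t = t' by [].
by apply/ffunP => y; rewrite e // mem_rev.
Qed.

Lemma hyp_init : hyp E E [::] (rev o).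
Proof.
split=> //.
- by rewrite rev_uniq.
- by move=> F _ y _; rewrite mem_rev.
Qed.

Lemma qinv_init : qinv E sz rv pos q fr ex LB h [::] [::] (rev o).
Proof.
split=> //.
- by move=> x a i _ /andP[oa _]; exact: fresh.
- move=> t; rewrite Dext_full DpE andbT; apply: eq_forallb => F.
  by rewrite (_ : F \subset rev o) //; apply/fintype.subsetP => y _; rewrite mem_rev.
- move=> t; rewrite /Kl cats0 Dext_full => D.
  rewrite !big_nil !mulr1 /SumK (bigD1 t) /=; last by rewrite D andbT; apply/allP.
  rewrite [X in (_ + X)%R]big1 ?addr0 => [|t' /andP[/andP[ta' _] /eqP tt]].
    rewrite [RHS](perm_big (enum X)) /= ?big_enum //.
    by apply: uniq_perm; rewrite ?enum_uniq ?rev_uniq // => y; rewrite mem_enum mem_rev eo.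
  by case: tt; apply/ffunP => y; apply/eqP; apply: (allP ta'); rewrite mem_rev.
Qed.

Lemma query_ok : exists l, [/\ uniq l,
  forall t', (t' \in l) = Dext vs t' && [forall y, (y \notin vs) ==> (t' y == ord0)],
  Inv l (run (query leaf) h) &
  ((cost (query leaf) h)%:R <= (n * base1 E N + 100 + 60 * n + size l * (lc + n * (200 + 20 * n)))%:R +
     (n * base2 E + n * (200 + 60 * n))%:R * A)%R].
Proof.
have szo : size (rev o) = n.
  rewrite size_rev -(card_uniqP uo); apply: eq_card => y; by rewrite eo.
have [] := bags_ok q0 sz0 covE szN A0 hyp_init qinv_init fro _ _ _ bU => //.
rewrite /query; set r := bags _ _ _ _ _ _ _ _ _; set hq := run r.1 h.
move=> [[stq LBq] _ DE SE fok'] eq1 fstE [[H' hH'] ufd szp] cb.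
set pend := r.2.1 in DE SE hH' szp; set fd := r.2.2 in SE fok' fstE ufd.
have vsE : map fst fd = vs by rewrite fstE cats0 filter_rev revK.
have pend0 kS : kS \in pend -> kS.2 = [::].
  case: hH' => _ sH _ _ pH /pH[/sH s _]; case: (kS.2) s => // a s /(_ a).
  by rewrite !inE eqxx => /(_ isT).
have uvs : uniq (map fst fd) by rewrite vsE filter_uniq.
have gMq : na hq gM 0 = B by case: stq.
have szS kS : kS \in fd -> size kS.2 <= n by move=> /(allP ufd); exact: size_uniq_le.
have cE t : consall E sz rv [::] t.
  apply/forall_inP => F FE; apply/implyP => /fintype.subsetP F0.
  rewrite /cons /nF (_ : enum F = [::]) ?count_predT ?size_iota ?sz0 //.
  by case EF : (enum F) => [//|a s]; have : a \in F by [rewrite -mem_enum EF mem_head]; move/F0.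
pose S1 (a : nm) := a \in [:: oOK q; oACC q 0].
have S1o : subpred S1 (own2 q 0) by move=> a; rewrite /S1 !inE => /orP[] /eqP->; rewrite /own2 /own /= !eqxx.
have bag_nS j (s : X) i h' : eqoff S1 hq h' -> na h' [:: j; q; vx s] i = na hq [:: j; q; vx s] i /\ ra h' [:: j; q; vx s] i = ra hq [:: j; q; vx s] i.
  by move=> e; apply: e; rewrite /S1 !inE /oOK /oACC !eqseq_cons /= !andbF.
pose I1 (pr : seq (X * seq X)) h' := eqoff S1 hq h' /\ (0 < na h' (oOK q) 0) = all (fun kS => flg q hq kS (t0 X B')) pr.
set h1 := run (Cs (oOK q) (Nc 1)) hq.
have i1 : I1 [::] h1.
  split; first by apply: eqoff_run; rewrite /= /S1 inE eqxx.
  by rewrite /h1 /= !eqxx.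
have [|[e2 ok2] c2] := @seqs_rule R _ q_ok pend I1 (fun=> 20) h1 i1.
  move=> pr kS post h2 e [e2 ok2]; split; last by [].
  have kin : kS \in pend by rewrite e mem_cat inE eqxx orbT.
  split; first by apply: eqoff_trans e2 _; apply: eqoff_run; rewrite /= /S1 inE eqxx.
  rewrite all_rcons andbC -ok2 /flg /flag (pend0 _ kin) /q_ok /Cs /= !eqxx /=.
  by rewrite (bag_nS _ _ _ _ e2).1 muln_gt0.
set h2 := run (seqs (map q_ok pend)) h1 in e2 ok2.
have okE : (0 < na h2 (oOK q) 0) = Dext [::] (t0 X B').
  by rewrite ok2 DE cE.
have runE : run (Cseq r.1 (q_out pend fd leaf)) h = if Dext [::] (t0 X B') then
   run (Cseq (CRc (oACC q 0) (Nc 0) 1)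
     (Cseq (seqs (map q_ms [seq kS <- pend | ~~ fr kS.1])) (odfs q vs 0 fd leaf))) h2 else h2.
  by rewrite -[LHS]/(if 0 < na h2 (oOK q) 0 then _ else _) okE.
have costE : cost (Cseq r.1 (q_out pend fd leaf)) h = cost r.1 h + (7 + (cost (seqs (map q_ok pend)) h1 + (8 +
  if Dext [::] (t0 X B') then
   cost (Cseq (CRc (oACC q 0) (Nc 0) 1)
     (Cseq (seqs (map q_ms [seq kS <- pend | ~~ fr kS.1])) (odfs q vs 0 fd leaf))) h2 else 0))).
  by rewrite -[LHS]/(cost r.1 h + (7 + (cost (seqs (map q_ok pend)) h1 + (8 + if 0 < na h2 (oOK q) 0 then _ else _)))) okE.
rewrite sum_seq_const in c2.
have Inv2 : Inv [::] h2.
  apply: (InvE Ih); apply: eqoff_trans eq1 _; apply: eqoff_sub e2 => a /S1o /andP[]; by [].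
rewrite szo in cb szp.
case: (boolP (Dext [::] (t0 X B'))) runE costE => [D0|nD0] runE costE; last first.
  exists [::]; split=> // [t'||].
  - apply/esym/negbTE; apply: contra nD0 => /andP[D _].
    rewrite (@eq_Dext _ E _ sz rv [::] _ t') //; exact: Dext_sub D.
  - by rewrite runE; exact: Inv2.
  - rewrite costE natrD; apply: le_trans (lerD cb (lexx _)) _.
    apply: (@arith_query _ _ _ _ _ _ _ _ 0 (size pend)) => //.
    by move: c2; move: (cost _ _) (size pend); clear; lia.
set h3 := run (CRc (oACC q 0) (Nc 0) 1) h2 in runE costE.
pose I2 (pr : seq (X * seq X)) h' := eqoff S1 hq h' /\ ra h' (oACC q 0) 0 = (\prod_(kS <- pr) ra hq (bMS q kS.1) 0)%R.
have i3 : I2 [::] h3.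
  split; first by apply: eqoff_trans e2 _; apply: eqoff_run; rewrite /= /S1 !inE eqxx orbT.
  by rewrite big_nil /h3 /= !eqxx.
have [|[e4 A4] c4] := @seqs_rule R _ q_ms [seq kS <- pend | ~~ fr kS.1] I2 (fun=> 20) h3 i3.
  move=> pr kS post h' e [e' A']; split; last by [].
  split; first by apply: eqoff_trans e' _; apply: eqoff_run; rewrite /= /S1 !inE eqxx orbT.
  rewrite -cats1 big_cat big_seq1 -A' /q_ms /= !eqxx /=.
  by rewrite (bag_nS _ _ _ _ e').2.
set h4 := run (seqs _) h3 in e4 A4.
have rootE t : root q fr hq pend t = ra h4 (oACC q 0) 0.
  rewrite A4 big_filter big_mkcond /root big_seq [RHS]big_seq; apply: eq_bigr => kS kp.
  by rewrite /msg (pend0 _ kp); case: (fr kS.1).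
have G4 : OG q fr LW hq pend x0 [::] (t0 X B') h4.
  split=> //; first by apply: eqoff_sub e4 => a /S1o; rewrite /SO => ->.
  by rewrite /acc big_nil mulr1 rootE.
have Inv4 : Inv [::] h4.
  apply: (InvE Ih); apply: eqoff_trans eq1 _; apply: eqoff_sub e4 => a /S1o /andP[]; by [].
have InvE' dn h5 h6 : Inv dn h5 -> eqoff (own2 q 0) h5 h6 -> Inv dn h6.
  by move=> i5 e; apply: (InvE i5); apply: eqoff_sub e => a /andP[].
have szfd : size vs = size fd by rewrite -vsE size_map.
have lok t dn h' : Dext (map fst fd) t -> OG q fr LW hq pend x0 fd t h' -> Inv dn h' ->
   Inv (rcons dn t) (run leaf h') /\ cost leaf h' <= lc.
  move=> D [e V AC] Id; apply: leaf_ok => //.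
  - by rewrite -vsE.
  - by rewrite szfd -vsE => i; exact: V.
  - rewrite szfd AC -vsE -[map fst fd]/(Kl [::] fd) SE // big_nil mul1r mulrC.
    by [].
  - apply: (@eqoff_trans _ _ _ hq); first by apply: eqoff_sub eq1 => a ->.
    by apply: eqoff_sub e => a /orP[/andP[-> _]//|->]; rewrite orbT.
have := @odfs_ok R X E B' sz rv q fr q0 LW LWn hq fd pend gMq fok' pend0 uvs leaf lc x0 Inv wleaf InvE' lok szS
  fd [::] (t0 X B') h4 [::] (erefl _) D0 G4 Inv4.
rewrite vsE => -[l [ul ml Il l0 cl]]; exists l; split=> //.
- by move=> t'; rewrite ml /extd vsE; congr andb; apply: eq_forallb => y; rewrite ffunE.
- by rewrite runE.
- rewrite costE natrD; apply: le_trans (lerD cb (lexx _)) _.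
  apply: (@arith_query _ _ _ _ _ _ _ _ (size l) (size pend)) => //.
  rewrite -[cost (Cseq _ _) h2]/(7 + (cost (seqs (map q_ms [seq kS <- pend | ~~ fr kS.1])) h3 + cost (odfs q vs 0 fd leaf) h4)).
  have szfe : size fd <= n by rewrite -(size_map fst) vsE size_uniq_le // filter_uniq.
  have c4' : cost (seqs (map q_ms [seq kS <- pend | ~~ fr kS.1])) h3 <= size pend * 20.
    by apply: leq_trans c4 _; rewrite sum_seq_const leq_mul2r size_filter count_size orbT.
  have cl' : cost (odfs q vs 0 fd leaf) h4 <= size l * (lc + n * (200 + 20 * n)).
    by apply: leq_trans cl _; rewrite leq_mul2l leq_add2l leq_mul2r szfe !orbT.
  move: c2 c4' cl'; move: (cost _ _) (cost _ _) (cost _ _) (size pend) (size l * _); clear; lia.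
Qed.
End Query.

Section Tensors.
Local Open Scope ring_scope.
Variables (R : realType) (X : finType) (E : {set {set X}}) (I : Defs.instance R E).
Variable jl : seq (full_tuple R X).
Hypotheses (ujl : uniq jl) (mjl : forall t, (t \in jl) <-> Defs.join I t).
Implicit Types (t : full_tuple R X) (L S : {set X}).

Lemma join_finite : finite_set (Defs.join I).
Proof. by apply: sub_finite_set (finite_seq jl) => t /mjl. Qed.

Lemma join_sizeE : join_size I = size jl.
Proof.
rewrite /join_size; apply: perm_size; apply: uniq_perm => // t.
rewrite in_fset_set; last exact: join_finite.
apply/idP/idP => [|/mjl tj].
  by rewrite inE => /mjl.
by rewrite inE.
Qed.

Lemma join_sum (f : full_tuple R X -> R) : (\sum_(t \in Defs.join I) f t) = \sum_(t <- jl) f t.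
Proof.
apply: fsbig_fwiden => //; first by move=> t /mjl.
by move=> t [/= /mjl tj] [].
Qed.

Definition ws L (e : X -> nat) (z : tuple_over R L) : R :=
  (size jl)%:R^-1 * \sum_(t <- jl | proj_on L t == z) \prod_x t x ^+ e x.

Lemma faq_ws L (e : X -> nat) (z : tuple_over R L) :
  faq I (fun x r => r ^+ e x) z = ws e z.
Proof.
rewrite /faq /ws join_sizeE; congr (_ * _).
have indE t : \prod_(F in E) ((proj_on F t \in I F)%:R : R) = (t \in jl)%:R.
  case: (boolP (t \in jl)) => [/mjl tj|tj].
    by rewrite big1 // => F FE; rewrite tj.
  have [F FE nF] : exists2 F, F \in E & proj_on F t \notin I F.
    apply/exists_inP; rewrite -negb_forall_in; apply: contra tj => /forall_inP A.
    by apply/mjl => F /A.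
  by rewrite (bigD1 F) //= (negbTE nF) mul0r.
rewrite -[RHS]big_filter.
apply: etrans.
  apply: esym; apply: (fsbig_widen ([set t | proj_on L t = z] `&` [set` jl])%classic).
    by move=> t [].
  by move=> t [/= tz ntj]; rewrite indE; case: (boolP (t \in jl)) => tj; [case: ntj|rewrite mulr0].
apply: etrans.
  apply: (@fsbig_fwiden _ _ _ _ [seq t <- jl | proj_on L t == z]); rewrite ?filter_uniq //.
  - by move=> t [/= tz tj]; rewrite mem_filter tz eqxx.
  - by move=> t [/=]; rewrite mem_filter => /andP[/eqP tz tj] [].
rewrite big_seq [RHS]big_seq; apply: eq_bigr => t; rewrite mem_filter => /andP[_ tj].
  by rewrite indE tj mulr1.
Qed.

Lemma tensor_ind S (t t' : full_tuple R X) :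
  tensor_of_vectors (fun f => one_hot (t' f)) (proj_on S t) = (proj_on S t' == proj_on S t)%:R :> R.
Proof.
rewrite /tensor_of_vectors /one_hot.
case: eqP => [e|ne].
  rewrite big1 // => f _; have := congr1 (fun g : tuple_over R S => g f) e.
  by rewrite !ffunE => ->; rewrite eqxx.
have [f nf] : exists f : {x : X | x \in S}, proj_on S t f != t' (val f).
  apply/existsP; rewrite -negb_forall; apply/negP => /forallP A; apply: ne.
  by apply/ffunP => f; rewrite [LHS]ffunE; apply/esym/eqP/A.
by rewrite (bigD1 f) //= (negbTE nf) mul0r.
Qed.

Lemma proj_eq S (t t' : full_tuple R X) :
  (proj_on S t == proj_on S t') = [forall x in S, t x == t' x].
Proof.
apply/eqP/forall_inP => [e x xS|A].
  by have := congr1 (fun g : tuple_over R S => g (exist _ x xS)) e; rewrite !ffunE => /= ->.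
by apply/ffunP => f; rewrite !ffunE; apply/eqP/A; exact: valP.
Qed.

Lemma proj_eqU S S' (t t' : full_tuple R X) :
  (proj_on (S :|: S')%SET t == proj_on (S :|: S')%SET t') =
  (proj_on S t == proj_on S t') && (proj_on S' t == proj_on S' t').
Proof.
rewrite !proj_eq; apply/forall_inP/andP => [A|[/forall_inP A /forall_inP A'] x].
  by split; apply/forall_inP => x xS; apply: A; rewrite inE xS ?orbT.
by rewrite inE => /orP[/A|/A'].
Qed.

Definition exps (V C : {set X}) (a : X -> nat) (x : X) : nat :=
  if x \in (feat_vars V a :\: feat_cats V C a)%SET then a x else 0%N.

Lemma prod_exps V C a t : \prod_(f in (feat_vars V a :\: feat_cats V C a)%SET) t f ^+ a f =
  \prod_x t x ^+ exps V C a x.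
Proof.
rewrite big_mkcond /=; apply: eq_bigr => x _; rewrite /exps.
by case: ifP => // _; rewrite expr0.
Qed.

Lemma sigma_ws V C a b t : sigma_tensor V C a b I (sigma_idx (feat_cats V C a) (feat_cats V C b) t) =
  ws (fun x => exps V C a x + exps V C b x)%N (proj_on (feat_cats V C a :|: feat_cats V C b)%SET t).
Proof.
rewrite /sigma_tensor /ws join_sizeE; congr (_ * _); rewrite join_sum [RHS]big_mkcond /=.
apply: eq_bigr => t' _; rewrite /tensor_prod /feature_map /= !tensor_ind !prod_exps proj_eqU.
rewrite mulrACA -natrM mulnb -big_split /=.
under eq_bigr => x _ do rewrite -exprD.
by case: ifP; rewrite ?mulr1 ?mulr0.
Qed.

Lemma sigma_supp V C a b p : sigma_tensor V C a b I p != 0 ->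
  exists2 t, Defs.join I t & p = sigma_idx (feat_cats V C a) (feat_cats V C b) t.
Proof.
move=> nz; have [t tj nt] : exists2 t, t \in jl & tensor_prod (feature_map V C a t) (feature_map V C b t) p != 0.
  apply/hasP; apply: contraNT nz => /hasPn A.
  rewrite /sigma_tensor join_sum big_seq big1 ?mulr0 // => t /A /=; by rewrite negbK => /eqP.
exists t; first exact/mjl.
case: p nz nt => p1 p2 _; rewrite /tensor_prod /= mulf_eq0 negb_or => /andP[n1 n2].
have key S (al : tuple_over R S) : tensor_of_vectors (fun f => one_hot (t f)) al != 0 -> al = proj_on S t.
  move=> /prodf_neq0 A; apply/ffunP => f; rewrite ffunE.
  by have := A f isT; rewrite /one_hot; rewrite pnatr_eq0 eqb0 negbK => /eqP.
move: n1 n2; rewrite /feature_map !mulf_eq0 !negb_or => /andP[_ /key ->] /andP[_ /key ->].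
by [].
Qed.

Lemma c_ws (V C : {set X}) (y : X) a t : c_tensor V C y a I (proj_on (feat_cats V C a) t) =
  ws (fun x => exps V C a x + (x == y))%N (proj_on (feat_cats V C a) t).
Proof.
rewrite /c_tensor /ws join_sizeE; congr (_ * _); rewrite join_sum [RHS]big_mkcond /=.
apply: eq_bigr => t' _; rewrite /feature_map tensor_ind prod_exps mulrA.
have -> : t' y * \prod_x t' x ^+ exps V C a x = \prod_x t' x ^+ (exps V C a x + (x == y)).
  under [RHS]eq_bigr => x _ do rewrite exprD.
  rewrite big_split /= mulrC; congr (_ * _).
  by rewrite (bigD1 y) //= eqxx expr1 big1 ?mulr1 // => x /negbTE->; rewrite expr0.
by case: eqP; rewrite ?mulr1 ?mulr0.
Qed.

Lemma c_supp V C y a p : c_tensor V C y a I p != 0 ->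
  exists2 t, Defs.join I t & p = proj_on (feat_cats V C a) t.
Proof.
move=> nz; have [t tj nt] : exists2 t, t \in jl & t y * feature_map V C a t p != 0.
  apply/hasP; apply: contraNT nz => /hasPn A.
  rewrite /c_tensor join_sum big_seq big1 ?mulr0 // => t /A /=; by rewrite negbK => /eqP.
exists t; first exact/mjl.
move: nt; rewrite mulf_eq0 negb_or => /andP[_]; rewrite /feature_map mulf_eq0 negb_or => /andP[_].
move=> /prodf_neq0 A; apply/ffunP => f; rewrite ffunE.
by have := A f isT; rewrite /one_hot; rewrite pnatr_eq0 eqb0 negbK => /eqP.
Qed.

Lemma sparse_of L (T : Type) (idx : full_tuple R X -> T) (A : T -> R) e (s : table R L) :
  (forall t, A (idx t) = ws e (proj_on L t)) ->
  (forall p, A p != 0 -> exists2 t, Defs.join I t & p = idx t) ->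
  uniq (unzip1 s) -> (forall z, z \in unzip1 s <-> exists2 t, Defs.join I t & z = proj_on L t) ->
  (forall z v, (z, v) \in s -> v = ws e z) ->
  sparse_rep I idx A s.
Proof.
move=> AE sup us ms vs; split=> // t tj.
have : proj_on L t \in unzip1 s by apply/ms; exists t.
by move=> /mapP[[z v] zs /= e1]; rewrite AE e1 -(vs _ _ zs).
Qed.

Lemma table_exists L e : exists s : table R L, [/\ uniq (unzip1 s),
  forall z, z \in unzip1 s <-> exists2 t, Defs.join I t & z = proj_on L t &
  forall z v, (z, v) \in s -> v = ws e z].
Proof.
exists [seq (z, ws e z) | z <- undup [seq proj_on L t | t <- jl]].
have -> : unzip1 [seq (z, ws e z) | z <- undup [seq proj_on L t | t <- jl]] = undup [seq proj_on L t | t <- jl].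
  by rewrite /unzip1 -map_comp map_id.
split; first exact: undup_uniq.
- move=> z; rewrite mem_undup; split=> [/mapP[t /mjl tj ->]|[t /mjl tj ->]]; first by exists t.
  exact: map_f.
- by move=> z v /mapP[z' _ [-> ->]].
Qed.
End Tensors.

Lemma nth_flatten_take (T : Type) (d : T) (ss : seq (seq T)) k p :
  p < size (nth [::] ss k) ->
  nth d (flatten ss) (sumn (map size (take k ss)) + p) = nth d (nth [::] ss k) p.
Proof.
elim: ss k => [|s ss IH] [|k] //= lt; rewrite nth_cat ?lt //.
by rewrite -addnA ltnNge leq_addr /= addKn; exact: IH.
Qed.

Section Ids.
Variables (R : realType) (X : finType) (E : {set {set X}}) (I : Defs.instance R E) (dl : seq R) (B' : nat).
Local Notation asg := {ffun X -> 'I_B'.+1}.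
Hypotheses (udl : uniq dl) (sdl : size dl <= B'.+1).
Hypothesis dlI : forall F t u, F \in E -> t \in I F -> (t : tuple_over R F) u \in dl.
Hypothesis covE : forall x : X, exists2 F : {set X}, F \in E & x \in F.
Implicit Types (F L : {set X}) (x : X) (t : asg).

Definition ext F (t : tuple_over R F) x : R := if insub x is Some u then t u else 0%R.
Definition posI F x : nat := if insub x is Some u then index u (enum {: {x : X | x \in F}}) else 0.
Definition szI F := size (I F).
Definition t00 F : tuple_over R F := [ffun=> 0%R].
Definition rvI F r x : 'I_B'.+1 := inord (index (ext (nth (t00 F) (I F) r) x) dl).
Definition flat : seq R := flatten [seq flatten (map (@row_of R X F) (I F)) | F <- enum E].
Definition offI F := sumn [seq size (I F') * #|F'| | F' <- take (index F (enum E)) (enum E)].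

Lemma card_F F : #|{: {x : X | x \in F}}| = #|F|.
Proof. by rewrite card_sig. Qed.

Lemma size_row F (t : tuple_over R F) : size (row_of t) = #|F|.
Proof. by rewrite size_map -cardE card_F. Qed.

Lemma size_rel F : size (flatten (map (@row_of R X F) (I F))) = size (I F) * #|F|.
Proof.
rewrite size_flatten /shape -map_comp; elim: (I F : seq _) => //= t s ->.
by rewrite size_row mulSn.
Qed.

Lemma flatE F r x : F \in E -> r < szI F -> x \in F ->
  nth 0%R flat (offI F + (r * #|F| + posI F x)) = ext (nth (t00 F) (I F) r) x.
Proof.
move=> FE lr xF.
have iF : index F (enum E) < size (enum E) by rewrite index_mem mem_enum.
have lp : posI F x < #|F|.
  by rewrite /posI insubT -card_F cardE index_mem mem_enum.
have lrp : r * #|F| + posI F x < szI F * #|F|.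
  by apply: (@leq_trans (r.+1 * #|F|)); [rewrite mulSn addnC ltn_add2r|rewrite leq_mul2r lr orbT].
have -> : offI F = sumn (map size (take (index F (enum E)) [seq flatten (map (@row_of R X F) (I F)) | F <- enum E])).
  by rewrite /offI -map_take -map_comp; congr sumn; apply: eq_map => F' /=; rewrite size_rel.
rewrite nth_flatten_take.
  rewrite (nth_map F) // nth_index ?mem_enum //.
  have -> : r * #|F| = sumn (map size (take r (map (@row_of R X F) (I F)))).
    have -> : map size (take r (map (@row_of R X F) (I F))) = nseq r #|F|.
      apply: (@eq_from_nth _ 0).
        by rewrite size_map size_nseq size_takel // size_map ltnW.
      move=> i; rewrite size_map size_takel ?size_map ?(ltnW lr) // => ir.
      rewrite nth_nseq ir (nth_map [::]) ?size_takel ?size_map ?(ltnW lr) //.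
      by rewrite nth_take // (nth_map (t00 F)) ?(ltn_trans ir) // size_row.
    by rewrite sumn_nseq mulnC.
  rewrite nth_flatten_take; rewrite (nth_map (t00 F)) // ?size_row //.
  rewrite /posI /ext insubT (nth_map (Sub x xF)) ?nth_index ?mem_enum //.
  by rewrite index_mem mem_enum.
by rewrite (nth_map F) // nth_index ?mem_enum // size_rel.
Qed.

Lemma rvIE F r u : F \in E -> r < szI F ->
  nth 0%R dl (rvI F r (val u)) = nth (t00 F) (I F) r u /\ rvI F r (val u) < size dl.
Proof.
move=> FE lr; rewrite /rvI /ext valK.
have i : index (nth (t00 F) (I F) r u) dl < size dl by rewrite index_mem dlI // mem_nth.
by rewrite inordK ?nth_index -?index_mem //; apply: leq_trans i _.
Qed.

Local Notation Dp := (Dp E szI rvI).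
Definition labt t : full_tuple R X := [ffun x => nth 0%R dl (t x)].

Lemma DpP t : reflect (forall F, F \in E -> exists2 r, r < szI F & forall x, x \in F -> rvI F r x = t x) (Dp t).
Proof.
apply: (iffP idP); rewrite DpE.
  move=> /forall_inP A F /A; rewrite /cons -has_count => /hasP[r]; rewrite mem_iota add0n => lr /allP a.
  by exists r => // x xF; apply/eqP; move: (a x); rewrite mem_enum xF; apply.
move=> A; apply/forall_inP => F /A[r lr e]; rewrite /cons -has_count; apply/hasP; exists r.
  by rewrite mem_iota.
by apply/allP => x _; apply/implyP => /e->.
Qed.

Lemma Dp_join t : Dp t -> Defs.join I (labt t).
Proof.
move=> /DpP A F FE; have [r lr e] := A F FE.
suff -> : proj_on F (labt t) = nth (t00 F) (I F) r by apply: mem_nth.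
by apply/ffunP => u; rewrite !ffunE -e ?(valP u) // (rvIE u FE lr).1.
Qed.

Lemma Dp_lt t x : Dp t -> t x < size dl.
Proof.
move=> /DpP A; have [F FE xF] := covE x; have [r lr e] := A F FE.
by rewrite -e // (rvIE (exist _ x xF) FE lr).2.
Qed.

Lemma join_Dp (f : full_tuple R X) : Defs.join I f -> exists2 t, Dp t & labt t = f.
Proof.
move=> J.
have fd x : f x \in dl.
  have [F FE xF] := covE x; have := dlI (exist _ x xF) FE (J F FE); by rewrite ffunE.
have ii x : index (f x) dl < B'.+1 by apply: leq_trans sdl; rewrite index_mem.
exists [ffun x => inord (index (f x) dl)]; last first.
  by apply/ffunP => x; rewrite !ffunE inordK // nth_index.
apply/DpP => F FE; exists (index (proj_on F f) (I F)); first by rewrite index_mem J.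
move=> x xF; rewrite ffunE /rvI nth_index ?J // /ext insubT ffunE //.
Qed.

Lemma labt_inj t t' x : Dp t -> Dp t' -> labt t x = labt t' x -> t x = t' x.
Proof.
move=> D D'; rewrite !ffunE => /eqP; rewrite nth_uniq ?Dp_lt // => /eqP e.
exact: val_inj.
Qed.

Definition jlI : seq (full_tuple R X) := [seq labt t | t <- enum [pred t | Dp t]].

Lemma jlI_uniq : uniq jlI.
Proof.
rewrite map_inj_in_uniq ?enum_uniq // => t t'; rewrite !mem_enum !inE => D D' e.
by apply/ffunP => x; apply: labt_inj; rewrite // e.
Qed.

Lemma jlI_mem f : f \in jlI <-> Defs.join I f.
Proof.
split=> [/mapP[t]|/join_Dp[t D <-]]; first by rewrite mem_enum inE => /Dp_join J ->.
by apply: map_f; rewrite mem_enum.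
Qed.

Section Tab.
Variables (L : {set X}) (vs : seq X) (e : X -> nat).
Hypothesis vL : vs =i L.
Local Notation SK := (SumK E szI rvI e (nth 0%R dl) vs).
Local Notation Dext := (Dext E szI rvI vs).

Lemma projE t t' : Dp t -> Dext t' -> (proj_on L (labt t) == proj_on L (labt t')) = all (fun y => t y == t' y) vs.
Proof.
move=> D /DextP[t2 e2 D2].
rewrite proj_eq; apply/forall_inP/all_eqP => [A x xv|A x].
  rewrite -e2 //; apply: labt_inj => //; have xL : x \in L by rewrite -vL.
  by rewrite (eqP (A x xL)) !ffunE e2.
by rewrite -vL => xv; rewrite !ffunE A.
Qed.

Lemma SumK_ws t' : Dext t' -> ws jlI e (proj_on L (labt t')) = ((size jlI)%:R^-1 * SK t')%R.
Proof.
move=> D'; rewrite /ws; congr (_ * _)%R; rewrite big_map /SumK big_enum_cond /=.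
apply: eq_big => t.
  by rewrite inE andbC; case D: (Dp t); rewrite ?andbF ?andbT //= projE.
by move=> _; apply: eq_bigr => x _; rewrite ffunE.
Qed.

Variables (x0 : R) (l : seq asg).
Hypotheses (ul : uniq l) (ml : forall t', (t' \in l) = Dext t' && [forall y, (y \notin vs) ==> (t' y == ord0)]).

Definition tabI : table R L := [seq (proj_on L (labt t), ((size jlI)%:R^-1 * SK t)%R) | t <- l].

Lemma tabI_ok : [/\ uniq (unzip1 tabI),
  forall z, z \in unzip1 tabI <-> exists2 t, Defs.join I t & z = proj_on L t &
  forall z v, (z, v) \in tabI -> v = ws jlI e z].
Proof.
have u1 : unzip1 tabI = [seq proj_on L (labt t) | t <- l] by rewrite /unzip1 -map_comp.
have key t t' : t \in l -> t' \in l -> proj_on L (labt t) = proj_on L (labt t') -> t = t'.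
  rewrite !ml => /andP[/DextP[t2 e2 D2] /forallP Z] /andP[D' /forallP Z'] ee.
  have : proj_on L (labt t2) == proj_on L (labt t').
    by rewrite -ee proj_eq; apply/forall_inP => x; rewrite -vL => xv; rewrite !ffunE e2.
  rewrite projE // => /all_eqP A; apply/ffunP => y.
  case: (boolP (y \in vs)) => yv; first by rewrite -e2 // A.
  by move: (Z y) (Z' y); rewrite yv /= => /eqP-> /eqP->.
rewrite u1; split.
- by rewrite map_inj_in_uniq.
- move=> z; split=> [/mapP[t]|[f /join_Dp[t D <-] ->]].
    rewrite ml => /andP[/DextP[t2 e2 D2] _ ->]; exists (labt t2); first exact: Dp_join.
    by apply/eqP; rewrite proj_eq; apply/forall_inP => x; rewrite -vL => xv; rewrite !ffunE e2.
  set t1 : asg := [ffun y => if y \in vs then t y else ord0].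
  have e1 : {in vs, t1 =1 t} by move=> y yv; rewrite ffunE yv.
  apply/mapP; exists t1.
    rewrite ml (eq_Dext _ _ _ e1); apply/andP; split; first by apply/DextP; exists t.
    by apply/forallP => y; apply/implyP => /negbTE n; rewrite ffunE n.
  by apply/eqP; rewrite proj_eq; apply/forall_inP => x; rewrite -vL => xv; rewrite !ffunE xv.
- move=> z v /mapP[t]; rewrite ml => /andP[D _] [-> ->]; by rewrite SumK_ws.
Qed.
End Tab.

Lemma size_jlI t : ((size jlI)%:R = SumK E szI rvI (fun=> 0) (nth 0 dl) [::] t :> R)%R.
Proof.
rewrite /jlI size_map -cardE /SumK -sum1_card natr_sum; apply: eq_bigr => t' _.
by rewrite big1 // => x _; rewrite /gx expr0.
Qed.
End Ids.

Lemma labels_exist (R : realType) (X : finType) (E : {set {set X}}) (I : Defs.instance R E) :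
  exists2 dl : seq R, uniq dl & forall F t u, F \in E -> t \in I F -> (t : tuple_over R F) u \in dl.
Proof.
exists (undup (flat I)); first exact: undup_uniq.
move=> F t u FE tI; rewrite mem_undup; apply/flatten_mapP; exists F; rewrite ?mem_enum //.
by apply/flatten_mapP; exists t => //; apply: map_f; rewrite mem_enum.
Qed.

Definition gOUT : nm := [:: 0; 20].
Definition gOLEN : nm := [:: 0; 21].
Definition gTOT : nm := [:: 0; 22].
Definition gNE : nm := [:: 0; 23].
Definition gROWS (k : nat) : nm := [:: 18; 0; k].
Definition gST (k : nat) : nm := [:: 19; 0; k].

Section TableQuery.
Variables (R : realType) (X : finType) (E : {set {set X}}) (B' : nat) (sz : {set X} -> nat)
  (rv : {set X} -> nat -> X -> 'I_B'.+1) (pos : {set X} -> X -> nat) (LB : nat -> R) (tot : R).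
Local Notation asg := {ffun X -> 'I_B'.+1}.
Local Notation hst := (hst R).
Local Notation n := #|X|.
Variables (k : nat) (L : {set X}) (ex : X -> nat) (o : seq X).
Local Notation q := k.+2.
Local Notation vs := [seq x <- o | x \in L].
Definition cols : seq X := [seq val x | x <- enum {: {x : X | x \in L}}].

Lemma size_cols : size cols = #|L|.
Proof. by rewrite size_map -cardE card_sig. Qed.

Fixpoint emit (j : nat) (cs : seq X) : cmd :=
  if cs is x :: cs' then
    Cseq (CRp gOUT (Nv gOLEN +! Nc j) gLB (Nv (oVAL q (index x vs).+1)) 1) (emit j.+1 cs')
  else Cskip.

Definition tpost : cmd :=
  (Cseq (CRo RDiv gOUT (Nv gOLEN +! Nc #|L|) (oACC q (size vs)) (Nc 0) gTOT (Nc 0))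
  (Cseq (Cs gOLEN (Nv gOLEN +! Nc #|L|.+1)) (Cs (gROWS k) (Nv (gROWS k) +! Nc 1)))).
Definition tleaf : cmd := Cseq (emit 0 cols) tpost.

Lemma emit_ok (h : hst) j cs : let h' := run (emit j cs) h in
  [/\ na h' = na h, forall a i, a != gOUT -> ra h' a i = ra h a i &
  forall i, ra h' gOUT i = if i < na h gOLEN 0 + j then ra h gOUT i
    else nth (ra h gOUT i) [seq ra h gLB (na h (oVAL q (index x vs).+1) 0) | x <- cs] (i - (na h gOLEN 0 + j))].
Proof.
elim: cs j h => [|x cs IH] j h.
  by split=> // i; rewrite /= nth_nil if_same.
rewrite [run _ _]/(run (emit j.+1 cs) _); set h1 := setr _ _ _ _.
have [e1 e2 e3] := IH j.+1 h1; split; first by rewrite e1.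
  by move=> a i na; rewrite e2 // /= (negbTE na).
have nh : na h1 = na h by [].
move=> i; rewrite e3 nh.
have -> : [seq ra h1 gLB (na h (oVAL q (index x0 vs).+1) 0) | x0 <- cs] =
   [seq ra h gLB (na h (oVAL q (index x0 vs).+1) 0) | x0 <- cs] by apply: eq_map.
have ro i' : ra h1 gOUT i' = if i' == na h gOLEN 0 + j then ra h gLB (na h (oVAL q (index x vs).+1) 0) else ra h gOUT i'.
  by rewrite /h1 /= expr1.
rewrite ro addnS; case: (ltngtP i (na h gOLEN 0 + j)) => c.
- by rewrite ltnS ltnW.
- by rewrite ltnS leqNgt c /= subnS; move: c; rewrite -subn_gt0; case: (i - _).
- by rewrite c ltnSn subnn.
Qed.

Lemma emit_wr j cs : all (pred1 gOUT) (wr (emit j cs)).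
Proof. by elim: cs j => //= x cs IH j; rewrite IH. Qed.

Lemma emit_cost j cs (h : hst) : cost (emit j cs) h = size cs * 25.
Proof. by elim: cs j h => // x cs IH j h; rewrite [cost _ _]/(25 + cost (emit j.+1 cs) _) IH. Qed.

Definition LWk (a : nm) := a \in [:: gOUT; gOLEN; gROWS k].

Lemma tleaf_wr : all LWk (wr tleaf).
Proof.
rewrite /= all_cat /= /LWk !inE !eqxx !orbT /= andbT.
by apply: sub_all (emit_wr 0 cols) => a /eqP->; rewrite !inE eqxx.
Qed.

Definition outs (s : seq R) (h : hst) := na h gOLEN 0 = size s /\
  forall i, i < size s -> ra h gOUT i = nth 0%R s i.

Lemma tleaf_ok s (h : hst) (t : asg) (v : R) r : outs s h ->
  (forall x, x \in L -> ra h gLB (na h (oVAL q (index x vs).+1) 0) = LB (t x)) ->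
  (ra h (oACC q (size vs)) 0 / ra h gTOT 0 = v)%R -> na h (gROWS k) 0 = r ->
  outs (s ++ rcons [seq LB (t x) | x <- cols] v) (run tleaf h) /\ na (run tleaf h) (gROWS k) 0 = r.+1.
Proof.
move=> [es ss] eLB ev er.
rewrite [run tleaf h]/(run tpost (run (emit 0 cols) h)).
have [e1 e2 e3] := emit_ok h 0 cols; set h1 := run (emit _ _) h in e1 e2 e3 *.
have sz1 : size (rcons [seq LB (t x) | x <- cols] v) = #|L|.+1 by rewrite size_rcons size_map size_cols.
have mc : [seq ra h gLB (na h (oVAL q (index x vs).+1) 0) | x <- cols] = [seq LB (t x) | x <- cols].
  by apply/eq_in_map => x /mapP[u _ ->]; apply: eLB; exact: valP.
split; last by rewrite /= e1 er addn1 eqxx.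
split; first by rewrite /= e1 es size_cat sz1.
move=> i; rewrite size_cat sz1 => li.
have -> : ra (run tpost h1) gOUT i =
    if i == size s + #|L| then v else ra h1 gOUT i.
  by rewrite /= e1 es (e2 (oACC q (size vs))) // (e2 gTOT) // ev.
rewrite e3 mc es addn0 nth_cat nth_rcons size_map size_cols.
case: (ltnP i (size s)) => c.
  by rewrite ss //; case: eqP => // e; move: c; rewrite e ltnNge leq_addr.
case: (ltnP (i - size s) #|L|) => d.
  rewrite -(subnKC c) eqn_add2l addKn; case: eqP => [e|_]; first by move: d; rewrite e ltnn.
  by apply: set_nth_default; rewrite size_map size_cols.
have -> : i = size s + #|L| by apply/eqP; rewrite eqn_leq -ltnS -addnS li /= -leq_subRL.
by rewrite addKn !eqxx.
Qed.

Lemma tleaf_cost (h : hst) : cost tleaf h = #|L| * 25 + 54.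
Proof. by rewrite [cost _ _]/(cost (emit 0 cols) h + 54) emit_cost size_cols. Qed.

Definition ostr (l : seq asg) : seq R :=
  flatten [seq rcons [seq LB ((t : asg) x) | x <- cols] (SumK E sz rv ex LB vs t / tot)%R | t <- l].

Lemma size_ostr l : size (ostr l) = size l * #|L|.+1.
Proof. by elim: l => //= t l IH; rewrite size_cat IH size_rcons size_map size_cols mulSn. Qed.

Definition tq : cmd := Cseq (Cs (gST k) (Nv gOLEN)) (query E pos q (mem L) ex o tleaf).

Definition wset (a : nm) := own q a || (a \in [:: gOUT; gOLEN; gROWS k; gST k]).

Definition lspec (l : seq asg) := uniq l /\ forall t', (t' \in l) =
   Dext E sz rv vs t' && [forall y, (y \notin vs) ==> (t' y == ord0)].

Variables (x0 : X) (s : seq R) (h : hst) (N : nat) (A : R).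
Hypotheses (sz0 : forall F, F \in E -> 0 < sz F) (covE : forall x : X, exists2 F : {set X}, F \in E & x \in F)
  (uo : uniq o) (eo : forall x, x \in o)
  (fro : pairwise (fun x y => (x \in L) ==> (y \in L)) (rev o)) (st : stat E sz rv pos h)
  (LBE : forall i, ra h gLB i = LB i) (eT : ra h gTOT 0 = tot)
  (fresh : forall a i, own q a -> na h a i = 0 /\ ra h a i = 0%R)
  (r0 : na h (gROWS k) 0 = 0) (os : outs s h)
  (szN : forall F, F \in E -> sz F <= N) (A0 : (0 <= A)%R)
  (bU : forall U, U \in elim_sets E (rev o) -> bnd E N U A).

Lemma tq_ok : exists l, [/\ lspec l, outs (s ++ ostr l) (run tq h), eqoff wset h (run tq h),
   na (run tq h) (gROWS k) 0 = size l /\ na (run tq h) (gST k) 0 = size s &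
   ((cost tq h)%:R <= 12 + (n * base1 E N + 100 + 60 * n + size l * ((25 * n + 60) + n * (200 + 20 * n)))%:R +
     (n * base2 E + n * (200 + 60 * n))%:R * A)%R].
Proof.
pose h1 := setn h (gST k) 0 (na h gOLEN 0).
have ownk a : own q a -> a != gST k.
  by move=> oa; apply: contraTN oa => /eqP->.
have nown a : a \in [:: gOUT; gOLEN; gROWS k] -> ~~ own q a.
  by rewrite !inE => /or3P[] /eqP->.
pose Inv (dn : seq asg) (h' : hst) := [/\ eqoff (fun a => own q a || LWk a) h1 h',
   outs (s ++ ostr dn) h' & na h' (gROWS k) 0 = size dn].
have st1 : stat E sz rv pos h1.
  by apply: (stat_eq st) => [a i||]; rewrite //= !inE => /orP[] /eqP->.
have I0 : Inv [::] h1.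
  by split; [move=> a i _|rewrite /ostr cats0|].
have InvE dn h2 h3 : Inv dn h2 -> eqoff (own q) h2 h3 -> Inv dn h3.
  move=> [i1 [i2 i3] i4] e; split.
  - by apply: eqoff_trans i1 _; apply: eqoff_sub e => a ->.
  - split; first by rewrite (e gOLEN 0 _).1 // nown.
    by move=> i li; rewrite (e gOUT i _).2 ?nown // i3.
  - by rewrite (e (gROWS k) 0 _).1 // nown // !inE eqxx !orbT.
have LWn a : LWk a -> ~~ own q a && (a != gM).
  by move=> La; rewrite nown //; move: La; rewrite /LWk !inE => /or3P[] /eqP->.
have fr1 a i : own q a -> na h1 a i = 0 /\ ra h1 a i = 0%R.
  by move=> oa; rewrite /= (negbTE (ownk a oa)); exact: fresh.
have xL x i : x \in L -> i = index x vs -> i < size vs /\ nth x vs i = x.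
  by move=> xL ->; rewrite index_mem nth_index ?mem_filter ?xL ?eo.
have lok t dn h' : Dext E sz rv vs t ->
    (forall i, i < size vs -> na h' (oVAL q i.+1) 0 = t (nth x0 vs i)) ->
    ra h' (oACC q (size vs)) 0 = SumK E sz rv ex LB vs t ->
    eqoff (fun a => own q a || LWk a) h1 h' -> Inv dn h' ->
    Inv (rcons dn t) (run tleaf h') /\ cost tleaf h' <= 25 * n + 60.
  move=> D vv va e [i1 i2 i3]; split; last first.
    rewrite tleaf_cost mulnC; apply: leq_add => //; by rewrite leq_mul2l max_card orbT.
  have [||o1 o2] := @tleaf_ok _ h' t (SumK E sz rv ex LB vs t / tot)%R (size dn) i2 _ _ i3.
  - move=> x xl; have [li nx] := xL x _ xl erefl.
    rewrite vv // (set_nth_default x) // nx.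
    by rewrite (e gLB _ _).2 // LBE.
  - by rewrite va (e gTOT 0 _).2 //= eT.
  split; last by rewrite size_rcons.
    apply: eqoff_trans e _; apply: eqoff_sub (eqoff_run _ tleaf_wr) => a ->; by rewrite orbT.
  by rewrite /ostr map_rcons flatten_rcons catA.
have [l [ul ml [i1 i2 i3] cl]] := query_ok (isT : 0 < q) sz0 covE uo eo fro LWn tleaf_wr I0 InvE st1 LBE fr1 lok szN A0 bU.
exists l; rewrite [run tq h]/(run (query E pos q (mem L) ex o tleaf) h1); split=> //.
- move=> a i; rewrite /wset negb_or !inE !negb_or => /andP[nao /and4P[n1 n2 n3 n4]].
  have [-> ->] : na (run (query E pos q (mem L) ex o tleaf) h1) a i = na h1 a i /\
     ra (run (query E pos q (mem L) ex o tleaf) h1) a i = ra h1 a i.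
    by apply: i1; rewrite (negbTE nao) /LWk !inE !negb_or n1 n2.
  by rewrite /= (negbTE n4).
- split=> //; rewrite (i1 (gST k) 0 _).1 //= ?eqxx; by case: os.
- have -> : cost tq h = 12 + cost (query E pos q (mem L) ex o tleaf) h1 by [].
  by rewrite natrD -[leRHS]addrA lerD2l.
Qed.
End TableQuery.

Lemma wset_rows j k : wset j (gROWS k) = (k == j).
Proof. by rewrite /wset /own /= !inE /gROWS /gST !eqseq_cons ?andbT ?orbF. Qed.
Lemma wset_st j k : wset j (gST k) = (k == j).
Proof. by rewrite /wset /own /= !inE /gROWS /gST !eqseq_cons ?andbT ?orbF. Qed.

Section Main.
Variables (R : realType) (X : finType) (E : {set {set X}}) (B' : nat) (sz : {set X} -> nat)
  (rv : {set X} -> nat -> X -> 'I_B'.+1) (pos : {set X} -> X -> nat) (LB : nat -> R).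
Local Notation asg := {ffun X -> 'I_B'.+1}.
Local Notation hst := (hst R).
Local Notation n := #|X|.
Variables (x0 : X) (N : nat).
Hypotheses (sz0 : forall F, F \in E -> 0 < sz F) (covE : forall x : X, exists2 F : {set X}, F \in E & x \in F)
  (szN : forall F, F \in E -> sz F <= N).

Definition goodo (L : {set X}) (o : seq X) (A : R) := [/\ uniq o, forall x, x \in o,
   pairwise (fun x y => (x \in L) ==> (y \in L)) (rev o), (0 <= A)%R &
   forall U, U \in elim_sets E (rev o) -> bnd E N U A].

Definition ct : cmd := CRp gTOT (Nc 0) (oACC 1 0) (Nc 0) 1.
Definition cq (o : seq X) : cmd := query E pos 1 pred0 (fun=> 0) o ct.
Definition qcost (r w : nat) (A : R) : R := ((n * base1 E N + 100 + 60 * n + r * (w + n * (200 + 20 * n)))%:R +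
     (n * base2 E + n * (200 + 60 * n))%:R * A)%R.
Definition tot : R := SumK E sz rv (fun=> 0) LB [::] [ffun=> ord0].

Lemma cq_ok (o : seq X) L A (h : hst) : goodo L o A -> stat E sz rv pos h ->
  (forall i, ra h gLB i = LB i) -> ra h gTOT 0 = 0%R ->
  (forall a i, own 1 a -> na h a i = 0 /\ ra h a i = 0%R) ->
  [/\ ra (run (cq o) h) gTOT 0 = tot, eqoff (fun a => own 1 a || (a == gTOT)) h (run (cq o) h) &
    ((cost (cq o) h)%:R <= qcost 1 13 A)%R].
Proof.
move=> [uo eo fo A0 bU] st LBE T0 fresh.
have vs0 : [seq x <- o | pred0 x] = [::] by rewrite filter_pred0.
pose Inv (dn : seq asg) (h' : hst) := eqoff (fun a => own 1 a || (a == gTOT)) h h' /\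
   ra h' gTOT 0 = (if dn is [::] then 0 else tot)%R.
have fr : pairwise (fun x y : X => pred0 x ==> pred0 y) (rev o).
  by elim: (rev o) => //= x s ->; rewrite andbT; apply/allP.
have I0 : Inv [::] h by split.
have InvE dn h1 h2 : Inv dn h1 -> eqoff (own 1) h1 h2 -> Inv dn h2.
  move=> [i1 i2] e; split; last by rewrite (e gTOT 0 _).2.
  by apply: eqoff_trans i1 _; apply: eqoff_sub e => a ->.
have LWn (a : nm) : pred1 gTOT a -> ~~ own 1 a && (a != gM) by move=> /eqP->.
have wl : all (pred1 gTOT) (wr ct) by [].
have lok (t : asg) dn (h' : hst) : Dext E sz rv [seq x <- o | pred0 x] t ->
    (forall i, i < size [seq x <- o | pred0 x] -> na h' (oVAL 1 i.+1) 0 = t (nth x0 [seq x <- o | pred0 x] i)) ->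
    ra h' (oACC 1 (size [seq x <- o | pred0 x])) 0 = SumK E sz rv (fun=> 0) LB [seq x <- o | pred0 x] t ->
    eqoff (fun a => own 1 a || (a == gTOT)) h h' -> Inv dn h' ->
    Inv (rcons dn t) (run ct h') /\ cost ct h' <= 13.
  rewrite vs0 => _ _ va e [i1 i2]; split=> //; split.
    by apply: eqoff_trans e _; apply: eqoff_sub (eqoff_run _ wl) => a /eqP->; rewrite eqxx orbT.
  have -> : ra (run ct h') gTOT 0 = ra h' (oACC 1 0) 0 by rewrite /= expr1.
  by rewrite va; case: (dn).
have [l [ul ml [i1 i2] cl]] := query_ok (isT : 0 < 1) sz0 covE uo eo fr LWn wl I0 InvE st LBE fresh lok szN A0 bU.
have le1 : size l <= 1.
  rewrite leqNgt; apply/negP => l2.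
  have key t : t \in l -> t = [ffun=> ord0].
    by rewrite ml vs0 => /andP[_ /forallP Z]; apply/ffunP => y; rewrite ffunE; apply/eqP/Z.
  case: (l) ul l2 key => [|a [|b l']] //= /andP[]; rewrite inE negb_or => /andP[/eqP ab _] _ _ key; apply: ab.
  have bin : b \in [:: a, b & l'] by rewrite in_cons mem_head orbT.
  exact: etrans (key a (mem_head _ _)) (esym (key b bin)).
split=> //.
  rewrite i2; case: l ml {ul i1 i2 cl le1} => [|//] ml.
  rewrite /tot /SumK big_pred0 // => t /=; apply/negP => D.
  have := ml [ffun=> ord0]; rewrite vs0 in_nil => /esym/negbT/negP; apply; apply/andP; split.
    by apply/existsP; exists t.
  by apply/forallP => y; rewrite ffunE eqxx implybT.
apply: le_trans cl _; rewrite /qcost lerD2r ler_nat leq_add2l; apply: leq_mul => //.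
Qed.

Variables (Lk : nat -> {set X}) (exk : nat -> X -> nat) (ok : nat -> seq X) (Ak : nat -> R).
Hypothesis gok : forall k, goodo (Lk k) (ok k) (Ak k).
Local Notation tqk k := (tq E pos k (Lk k) (exk k) (ok k)).
Local Notation vsk k := [seq x <- ok k | x \in Lk k].
Local Notation ostrk k := (ostr E sz rv LB tot (Lk k) (exk k) (ok k)).

Definition tqs T : cmd := seqs [seq tqk k | k <- iota 0 T].

Lemma seqs_rcons (l : seq cmd) c (h : hst) : run (seqs (rcons l c)) h = run c (run (seqs l) h) /\
  cost (seqs (rcons l c)) h = cost (seqs l) h + cost c (run (seqs l) h).
Proof.
elim: l h => [|a l IH] h; first by split=> //; rewrite /= addn0.
have [e1 e2] := IH (run a h); rewrite rcons_cons !run_cons !cost_cons e1 e2; split=> //.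
by rewrite addnA.
Qed.

Variable h2 : hst.
Hypotheses (st2 : stat E sz rv pos h2) (LB2 : forall i, ra h2 gLB i = LB i) (T2 : ra h2 gTOT 0 = tot)
  (fresh : forall k a i, own k.+2 a -> na h2 a i = 0 /\ ra h2 a i = 0%R)
  (rows0 : forall k, na h2 (gROWS k) 0 = 0) (out0 : na h2 gOLEN 0 = 0).

Definition tspec T (ls : nat -> seq asg) (s : seq R) (h : hst) :=
  [/\ forall k, k < T -> lspec E sz rv (Lk k) (ok k) (ls k), outs s h,
    forall k, k < T -> na h (gROWS k) 0 = size (ls k) /\
      exists p p', s = p ++ ostrk k (ls k) ++ p' /\ na h (gST k) 0 = size p &
    size s = \sum_(k < T) size (ls k) * #|Lk k|.+1].

Lemma tqs_ok T : exists ls s, [/\ tspec T ls s (run (tqs T) h2),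
   eqoff (fun a => has (fun k => wset k a) (iota 0 T)) h2 (run (tqs T) h2) &
   ((cost (tqs T) h2)%:R <= \sum_(k < T) (12 + qcost (size (ls k)) (25 * n + 60) (Ak k)))%R].
Proof.
elim: T => [|T [ls [s [[l1 os l3 l4] eo co]]]].
  by exists (fun=> [::]), [::]; split; rewrite ?big_ord0 //; split=> //; rewrite ?big_ord0.
have -> : tqs T.+1 = seqs (rcons [seq tqk k | k <- iota 0 T] (tqk T)).
  by rewrite /tqs -addn1 iotaD map_cat cats1.
have [-> ->] := seqs_rcons [seq tqk k | k <- iota 0 T] (tqk T) h2.
rewrite -/(tqs T); set h := run (tqs T) h2 in os l3 eo co *.
have old a i : size a <= 2 -> a \notin [:: gOUT; gOLEN] -> na h a i = na h2 a i /\ ra h a i = ra h2 a i.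
  move=> sa na; apply: eo; apply/hasPn => k _; rewrite /wset /own ltnNge sa /=.
  by apply: contra na; rewrite !inE => /or4P[->|->|/eqP e|/eqP e] //; rewrite ?orbT //; move: sa; rewrite e.
have gsz (x y : nat) i : x != 18 -> x != 19 -> na h [:: x; 0; y] i = na h2 [:: x; 0; y] i.
  move=> a b; apply: (eo _ _ _).1; apply/hasPn => k _; rewrite /wset /own /= !inE /gROWS /gST !eqseq_cons.
  by rewrite (negbTE a) (negbTE b) !andbF.
have st : stat E sz rv pos h.
  apply: (stat_eq st2) => [a i|F|F]; [|by apply: gsz..].
  by rewrite !inE => /orP[] /eqP->; rewrite (old _ i _ _).1.
have LBh i : ra h gLB i = LB i by rewrite (old gLB i _ _).2.
have Th : ra h gTOT 0 = tot by rewrite (old gTOT 0 _ _).2.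
have fr a i : own T.+2 a -> na h a i = 0 /\ ra h a i = 0%R.
  move=> oa; have [-> ->] : na h a i = na h2 a i /\ ra h a i = ra h2 a i; last exact: (@fresh T _ _ oa).
  apply: eo; apply/hasPn => k; rewrite mem_iota add0n => kT; rewrite /wset negb_or; apply/andP; split.
    move: oa; rewrite /own => /andP[-> /eqP->] /=; by rewrite eqSS eqSS gtn_eqF.
  by apply: contraTN oa; rewrite !inE => /or4P[] /eqP->.
have nK k : T <= k -> na h (gROWS k) 0 = 0.
  move=> Tk; apply: etrans _ (rows0 k); apply: (eo _ _ _).1; apply/hasPn => j; rewrite mem_iota add0n => jT.
  by rewrite wset_rows gtn_eqF // (leq_trans jT).
have [uo eok fo A0 bU] := gok T.
have [l [sl o' e' [r' g'] c']] := tq_ok (exk T) x0 sz0 covE uo eok fo st LBh Th fr (nK T (leqnn _)) os szN A0 bU.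
have kp k : k < T -> na (run (tqk T) h) (gROWS k) 0 = na h (gROWS k) 0 /\ na (run (tqk T) h) (gST k) 0 = na h (gST k) 0.
  move=> kT; split; apply: (e' _ _ _).1; by rewrite ?wset_rows ?wset_st ltn_eqF.
pose ls' k := if k == T then l else ls k.
have lsk k : k < T -> ls' k = ls k by move=> kT; rewrite /ls' ltn_eqF.
have lsT : ls' T = l by rewrite /ls' eqxx.
exists ls', (s ++ ostrk T l); split; [split|..].
- move=> k; rewrite ltnS leq_eqVlt => /orP[/eqP->|kT]; first by rewrite lsT.
  by rewrite lsk //; exact: l1.
- exact: o'.
- move=> k; rewrite ltnS leq_eqVlt => /orP[/eqP->|kT].
    by rewrite lsT; split=> //; exists s, [::]; rewrite cats0.
  have [-> ->] := kp k kT; rewrite lsk //; have [-> [p [p' [e ->]]]] := l3 k kT; split=> //.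
  by exists p, (p' ++ ostrk T l); rewrite e - !catA.
- rewrite size_cat l4 big_ord_recr /= lsT size_ostr; congr (_ + _).
  by apply: eq_bigr => k _; rewrite lsk.
- apply: eqoff_trans (eqoff_sub _ eo) (eqoff_sub _ e') => a wa;
  by rewrite -addn1 iotaD has_cat /= orbF wa ?orbT.
- rewrite natrD big_ord_recr /= lsT; apply: lerD.
    apply: le_trans co _; rewrite le_eqVlt; apply/orP; left; apply/eqP.
    by apply: eq_bigr => k _; rewrite lsk.
  by apply: le_trans c' _; rewrite /qcost addrA.
Qed.
End Main.

Lemma flatten_take_lt (T : Type) (ss : seq (seq T)) k p :
  p < size (nth [::] ss k) -> sumn (map size (take k ss)) + p < size (flatten ss).
Proof.
elim: ss k => [|s ss IH] [|k] //= lt; rewrite size_cat.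
  by rewrite add0n ltn_addr.
by rewrite -addnA ltn_add2l IH.
Qed.

Lemma arith_main (K : numDomainType) (a b d D : nat) (B C : K) : a <= D -> (b%:R <= B)%R -> (d%:R <= C)%R ->
  ((8 + (a + (b + d)))%:R <= (10 + D)%:R + B + C)%R.
Proof.
move=> aD bB dC; rewrite !addnA !natrD; apply: lerD => //; apply: lerD => //.
by rewrite - !natrD ler_nat leq_add.
Qed.

Section HLMain.
Variables (R : realType) (X : finType) (E : {set {set X}}) (I : Defs.instance R E) (B' : nat).
Local Notation asg := {ffun X -> 'I_B'.+1}.
Local Notation hst := (hst R).
Local Notation n := #|X|.
Local Notation M := B'.+1.
Hypothesis sM : size (flat I) = M.
Hypothesis covE : forall x : X, exists2 F : {set X}, F \in E & x \in F.
Variables (x0 : X) (N : nat).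
Hypothesis szN : forall F, F \in E -> size (I F) <= N.
Variables (Lk : nat -> {set X}) (exk : nat -> X -> nat) (ok : nat -> seq X) (Ak : nat -> R).
Hypothesis gok : forall k, goodo E N (Lk k) (ok k) (Ak k).
Variables (T : nat) (h0 : hst).
Hypotheses (hM : na h0 gM 0 = M) (hI : forall j, ra h0 gINP j = nth 0%R (flat I) j)
  (hS : forall F, F \in E -> na h0 (gSZ F) 0 = size (I F)) (hO : forall F, F \in E -> na h0 (gOFF F) 0 = offI I F)
  (hN : na h0 gNE 0 = \prod_(F in E) size (I F))
  (zn : forall a i, a \notin [:: gM; gNE] -> ~~ ((nth 0 a 1 == 0) && (nth 0 a 0 \in [:: 16; 17])) -> na h0 a i = 0)
  (zr : forall a i, a != gINP -> ra h0 a i = 0%R).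

Definition main : cmd := Cif (Ble (Nc 1) (Nv gNE))
  (Cseq dict (Cseq (cq E (@posI X) (ok 0)) (tqs E (@posI X) Lk exk ok T))) Cskip.

Definition tstr (L : {set X}) (tb : table R L) : seq R := flatten [seq rcons (row_of r.1) r.2 | r <- tb].

Definition mainpost (h : hst) (c : nat) := exists jl (ts : forall k, table R (Lk k)) s,
  [/\ uniq jl /\ (forall t, (t \in jl) <-> Defs.join I t),
   forall k, k < T -> [/\ uniq (unzip1 (ts k)),
      forall z, z \in unzip1 (ts k) <-> exists2 t, Defs.join I t & z = proj_on (Lk k) t &
      forall z v, (z, v) \in ts k -> v = ws jl (exk k) z],
   outs s h /\ size s = \sum_(k < T) size (ts k) * #|Lk k|.+1,
   forall k, k < T -> na h (gROWS k) 0 = size (ts k) /\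
      exists p p', s = p ++ tstr (ts k) ++ p' /\ na h (gST k) 0 = size p &
   (c%:R <= (10 + 2000 * (M * (2 + trunc_log 2 M)))%:R + qcost E N 1 13 (Ak 0) +
      \sum_(k < T) (12 + qcost E N (size (ts k)) (25 * n + 60) (Ak k)))%R].

Lemma flat_lt F r x : F \in E -> r < szI I F -> x \in F ->
  offI I F + (r * #|F| + posI F x) < M.
Proof.
move=> FE lr xF; rewrite -sM /flat.
have lp : posI F x < #|F| by rewrite /posI insubT -card_F cardE index_mem mem_enum.
have iF : index F (enum E) < size (enum E) by rewrite index_mem mem_enum.
have -> : offI I F = sumn (map size (take (index F (enum E)) [seq flatten (map (@row_of R X F) (I F)) | F <- enum E])).
  by rewrite /offI -map_take -map_comp; congr sumn; apply: eq_map => F' /=; rewrite size_rel.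
apply: flatten_take_lt; rewrite (nth_map F) // nth_index ?mem_enum // size_rel.
by apply: (@leq_trans (r.+1 * #|F|)); [rewrite mulSn addnC ltn_add2r|rewrite leq_mul2r lr orbT].
Qed.

Lemma mem_flat F (t : tuple_over R F) u : F \in E -> t \in I F -> t u \in flat I.
Proof.
move=> FE tI; apply/flatten_mapP; exists F; rewrite ?mem_enum //.
by apply/flatten_mapP; exists t => //; apply: map_f; rewrite mem_enum.
Qed.

Section Relabel.
Variables (dl : seq R) (LB : nat -> R).
Hypotheses (udl : uniq dl) (sdl : size dl <= M)
  (dlI : forall F t u, F \in E -> t \in I F -> (t : tuple_over R F) u \in dl)
  (LBd : forall i, i < size dl -> LB i = nth 0%R dl i).
Local Notation rv := (rvI I dl B').

Lemma SumK_relabel ex rs (t : asg) : SumK E (szI I) rv ex LB rs t = SumK E (szI I) rv ex (nth 0%R dl) rs t.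
Proof.
apply: eq_bigr => t' /andP[_ D]; apply: eq_bigr => x _; rewrite /gx LBd //.
exact: (Dp_lt sdl dlI covE).
Qed.

Lemma tstr_ostr L ex o (l : seq asg) : (forall x, x \in o) -> lspec E (szI I) rv L o l ->
  tstr (tabI I dl L [seq x <- o | x \in L] ex l) = ostr E (szI I) rv LB (tot E (szI I) rv LB) L ex o l.
Proof.
move=> eo [_ ml]; rewrite /tstr /ostr /tabI -map_comp; congr flatten; apply/eq_in_map => t.
rewrite ml => /andP[/DextP[t2 e2 D2] _] /=; congr rcons.
  rewrite /row_of /cols -map_comp; apply: eq_map => u /=; rewrite !ffunE LBd //.
  rewrite -e2 ?mem_filter ?eo ?(valP u) //; exact: (Dp_lt sdl dlI covE).
rewrite SumK_relabel mulrC; congr (_ / _)%R.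
by rewrite /tot SumK_relabel; apply: size_jlI.
Qed.
End Relabel.

Lemma main_empty : \prod_(F in E) size (I F) = 0 -> forall t, ~ Defs.join I t.
Proof.
move=> p0 t J; suff: 0 < \prod_(F in E) size (I F) by rewrite p0.
by apply: prodn_cond_gt0 => F FE; rewrite -has_predT; apply/hasP; exists (proj_on F t) => //; exact: J.
Qed.

Lemma main_ok : mainpost (run main h0) (cost main h0).
Proof.
have cE : cost main h0 = 8 + (if 1 <= na h0 gNE 0 then
   cost (Cseq dict (Cseq (cq E (@posI X) (ok 0)) (tqs E (@posI X) Lk exk ok T))) h0 else 0) by [].
have rE : run main h0 = if 1 <= na h0 gNE 0 then
   run (Cseq dict (Cseq (cq E (@posI X) (ok 0)) (tqs E (@posI X) Lk exk ok T))) h0 else h0 by [].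
have q0 r w k : (0 <= qcost E N r w (Ak k))%R.
  by have [_ _ _ A0 _] := gok k; rewrite addr_ge0 ?mulr_ge0.
rewrite cE rE; case: ifP => [N1|N0]; last first.
  have nj : forall t, ~ Defs.join I t.
    by apply: main_empty; rewrite -hN; apply/eqP; rewrite -leqn0 leqNgt N0.
  exists [::], (fun=> [::]), [::]; split.
  - by split=> // t; split=> [//|/nj].
  - by move=> k _; split=> // z; split=> [//|[t /nj]].
  - split; last by rewrite big1.
    by split=> //=; apply: zn.
  - move=> k _; split; first by apply: zn.
    by exists [::], [::]; split=> //; apply: zn.
  - rewrite addn0 -addrA; apply: le_trans (_ : ((10 + 2000 * (M * (2 + trunc_log 2 M)))%:R <= _)%R).
      by rewrite ler_nat; apply: leq_trans (leq_addr _ _).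
    rewrite lerDl addr_ge0 // sumr_ge0 // => k _; by rewrite addr_ge0.
have sz0 F : F \in E -> 0 < szI I F.
  by move=> FE; move: N1; rewrite hN (bigD1 F) //= muln_gt0 => /andP[].
set inp := nth 0%R (flat I).
have pre : dict_pre M inp h0 by split=> //; apply: zn.
have [[dl [udl sdl dle LBd IDd]] cd] := dict_ok (ltn0Sn B') pre.
set h1 := run dict h0 in LBd IDd.
have dlF : dl =i flat I.
  move=> z; rewrite dle -[flat I](mkseq_nth 0%R) sM; by [].
have dlI F t u : F \in E -> t \in I F -> (t : tuple_over R F) u \in dl.
  by move=> FE tI; rewrite dlF mem_flat.
pose LB := ra h1 gLB; pose rv := rvI I dl B'.
have e1 : eqoff (mem dict_names) h0 h1 by apply: eqoff_run; exact: dict_wr.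
have st1 : stat E (szI I) rv (@posI X) h1.
  split; first by rewrite (e1 gM 0 _).1.
  move=> F FE; rewrite (e1 (gSZ F) 0 _).1 // (e1 (gOFF F) 0 _).1 // hS // hO //; split=> // r x lr xF.
  rewrite -addnA IDd ?flat_lt // /inp flatE // /rv /rvI inordK //.
  apply: leq_trans sdl; rewrite index_mem /ext insubT; apply: dlI => //; exact: mem_nth.
have nsz (a b : nm) : 2 < size a -> size b <= 2 -> a != b.
  by move=> sa sb; apply: contraTneq sa => ->; rewrite -leqNgt.
have z1 a i : 2 < size a -> ~~ ((nth 0 a 1 == 0) && (nth 0 a 0 \in [:: 16; 17])) -> na h1 a i = 0 /\ ra h1 a i = 0%R.
  move=> sa a1; have na0 : a \notin dict_names by rewrite !inE !negb_or !nsz.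
  by have [-> ->] := e1 a i na0; rewrite zn ?zr // ?nsz // !inE negb_or !nsz.
have frs q a i : own q.+1 a -> na h1 a i = 0 /\ ra h1 a i = 0%R.
  by move=> /andP[sa /eqP a1]; apply: z1 => //; rewrite a1.
have T1 : ra h1 gTOT 0 = 0%R by rewrite (e1 gTOT 0 _).2 // zr.
have [T2 e2 c2] := cq_ok x0 sz0 covE szN (gok 0) st1 (fun=> erefl) T1 (frs 0).
set h2 := run (cq _ _ _) h1 in T2 e2.
have LB2 i : ra h2 gLB i = LB i by rewrite (e2 gLB i _).2.
have st2 : stat E (szI I) rv (@posI X) h2.
  apply: (stat_eq st1) => [a i|F|F]; [|by apply: (e2 _ _ _).1..].
  by rewrite !inE => /orP[] /eqP->; apply: (e2 _ _ _).1.
have fr2 k a i : own k.+2 a -> na h2 a i = 0 /\ ra h2 a i = 0%R.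
  move=> oa; have [-> ->] : na h2 a i = na h1 a i /\ ra h2 a i = ra h1 a i; last exact: frs oa.
  apply: e2; move: oa => /andP[sa /eqP a1]; rewrite negb_or (nsz a gTOT) // andbT /own sa a1.
  by [].
have r2 k : na h2 (gROWS k) 0 = 0 by rewrite (e2 (gROWS k) 0 _).1 // (z1 (gROWS k) 0 _ _).1.
have o2 : na h2 gOLEN 0 = 0.
  by rewrite (e2 gOLEN 0 _).1 // (e1 gOLEN 0 _).1 // zn.
have [ls [s [[l1 os l3 l4] _ c3]]] := tqs_ok x0 sz0 covE szN exk gok st2 LB2 T2 fr2 r2 o2 T.
set h3 := run (tqs _ _ _ _ _ _) h2 in os l3.
have sizeT k : size (tabI I dl (Lk k) [seq x <- ok k | x \in Lk k] (exk k) (ls k)) = size (ls k) by rewrite size_map.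
exists (jlI I dl B'), (fun k => tabI I dl (Lk k) [seq x <- ok k | x \in Lk k] (exk k) (ls k)), s.
have vL k : [seq x <- ok k | x \in Lk k] =i Lk k.
  by move=> x; rewrite mem_filter; have [_ eo _ _ _] := gok k; rewrite eo andbT.
split.
- split; first exact: jlI_uniq.
  move=> t; exact: jlI_mem.
- by move=> k kT; have [ul ml] := l1 k kT; apply: tabI_ok.
- by split=> //; rewrite l4; apply: eq_bigr => k _; rewrite sizeT.
- move=> k kT; rewrite sizeT; have [-> [p [p' [e3 ->]]]] := l3 k kT; split=> //.
  exists p, p'; split=> //; rewrite (tstr_ostr sdl dlI LBd) //; last exact: l1.
  by have [] := gok k.
- have -> : cost (Cseq dict (Cseq (cq E (@posI X) (ok 0)) (tqs E (@posI X) Lk exk ok T))) h0 =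
     cost dict h0 + (cost (cq E (@posI X) (ok 0)) h1 + cost (tqs E (@posI X) Lk exk ok T) h2) by [].
  apply: arith_main => //.
  by apply: le_trans c3 _; apply: ler_sum => k _; rewrite sizeT.
Qed.
End HLMain.

Section LowLevel.
Variable R : realType.
Implicit Type s : state R.

Definition sl (l : seq instr) : prog := foldr (fun i p => Seq (Do i) p) Skip l.

Lemma exec_sl l s : exec (sl l) s (size l) (foldl (fun s i => do_instr i s) s l).
Proof.
elim: l s => [|i l IH] s /=; first exact: ExecSkip.
by rewrite -add1n; apply: ExecSeq; [exact: ExecDo|exact: IH].
Qed.

Section Copy.
Variable b : nat.
Definition copyL : seq instr := [:: RMove (Ind (b + 3)) (Ind (b + 2)); NArith NAdd (Dir (b + 2)) (Dir (b + 2)) (Dir (b + 5));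
          NArith NAdd (Dir (b + 3)) (Dir (b + 3)) (Dir (b + 6)); NArith NSub (Dir (b + 4)) (Dir (b + 4)) (Dir (b + 1))].
Definition copyP : prog := While (NLe (Dir (b + 1)) (Dir (b + 4))) (sl copyL).

Lemma copy_ok cnt s src dst ss ds :
  nmem s (b + 1) = 1 -> nmem s (b + 2) = src -> nmem s (b + 3) = dst -> nmem s (b + 4) = cnt ->
  nmem s (b + 5) = ss -> nmem s (b + 6) = ds -> 0 < ds -> (forall i, i < cnt -> src + i * ss < dst) ->
  exists s', [/\ exec copyP s (cnt * 5 + 1) s',
    forall c, c \notin [:: b + 2; b + 3; b + 4] -> nmem s' c = nmem s c,
    forall i, i < cnt -> rmem s' (dst + i * ds) = rmem s (src + i * ss) &
    forall c, (forall i, i < cnt -> c != dst + i * ds) -> rmem s' c = rmem s c].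
Proof.
elim: cnt s src dst => [|cnt IH] s src dst e1 e2 e3 e4 e5 e6 ds0 lt.
  exists s; split=> //; rewrite mul0n; apply: ExecWhileStop.
  by rewrite /eval_test /nget /= e1 e4.
set s1 := foldl (fun s i => do_instr i s) s copyL.
have n1 c : nmem s1 c = if c == b + 4 then cnt else if c == b + 3 then dst + ds
    else if c == b + 2 then src + ss else nmem s c.
  by rewrite /s1 /= /nset /rset /nget /loc /= !eqn_add2l /= e1 e2 e3 e4 e5 e6 subn1.
have r1 c : rmem s1 c = if c == dst then rmem s src else rmem s c.
  by rewrite /s1 /= /nset /rset /rget /loc /= e2 e3.
have lt1 i : i < cnt -> (src + ss) + i * ss < dst + ds by move=> ic; rewrite -addnA -mulSn ltn_addr // lt.
have nb i : i \notin [:: 2; 3; 4] -> nmem s1 (b + i) = nmem s (b + i).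
  by rewrite !inE !negb_or n1 !eqn_add2l => /and3P[/negbTE-> /negbTE-> /negbTE->].
have m2 : nmem s1 (b + 2) = src + ss by rewrite n1 !eqn_add2l.
have m3 : nmem s1 (b + 3) = dst + ds by rewrite n1 !eqn_add2l.
have m4 : nmem s1 (b + 4) = cnt by rewrite n1 !eqn_add2l.
have [s' [x a1 a2 a3]] := IH s1 _ _ (etrans (nb 1 isT) e1) m2 m3 m4 (etrans (nb 5 isT) e5) (etrans (nb 6 isT) e6) ds0 lt1.
exists s'; split.
- have -> : cnt.+1 * 5 + 1 = (4 + (cnt * 5 + 1)).+1 by rewrite mulSn; clear; lia.
  apply: ExecWhileLoop x; first by rewrite /eval_test /nget /= e1 e4.
  exact: (exec_sl copyL s).
- move=> c nc; apply: etrans (a1 _ nc) _; rewrite n1; move: nc; rewrite !inE !negb_or => /and3P[/negbTE-> /negbTE-> /negbTE->].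
  by [].
- case=> [|i] ic.
    rewrite !mul0n !addn0 a3 ?r1 ?eqxx // => i _.
    by rewrite -addnA -mulSn -[X in X == _]addn0 eqn_add2l eq_sym muln_eq0 /= -lt0n.
  rewrite !mulSn !addnA a2 // r1; case: eqP => // e.
  by have := lt i.+1 ic; rewrite mulSn addnA e ltnn.
- move=> c nc; rewrite a3 ?r1.
    by have := nc 0 isT; rewrite mul0n addn0 => /negbTE->.
  by move=> i ic; rewrite -addnA -mulSn; apply: nc.
Qed.
End Copy.

Lemma size_step s cN b b1 cO cS kk w : uniq [:: cN; b; b1; cO; cS; kk] -> forall c,
  nmem (foldl (fun s i => do_instr i s) s [:: NMove (Dir cS) (Dir kk); NMove (Dir cO) (Dir b);
      NConst (Dir b1) w; NArith NMul (Dir b1) (Dir b1) (Dir kk);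
      NArith NAdd (Dir b) (Dir b) (Dir b1); NArith NMul (Dir cN) (Dir cN) (Dir kk)]) c =
  if c == cN then nmem s cN * nmem s kk else if c == b then nmem s b + nmem s kk * w
   else if c == b1 then w * nmem s kk else if c == cO then nmem s b
   else if c == cS then nmem s kk else nmem s c.
Proof.
move=> u c; have D i j : i < 6 -> j < 6 -> (nth 0 [:: cN; b; b1; cO; cS; kk] i == nth 0 [:: cN; b; b1; cO; cS; kk] j) = (i == j).
  by move=> li lj; rewrite nth_uniq.
have f01 : (cN == b) = false := D 0 1 isT isT.
have f02 : (cN == b1) = false := D 0 2 isT isT.
have f03 : (cN == cO) = false := D 0 3 isT isT.
have f04 : (cN == cS) = false := D 0 4 isT isT.
have f05 : (cN == kk) = false := D 0 5 isT isT.
have f10 : (b == cN) = false := D 1 0 isT isT.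
have f12 : (b == b1) = false := D 1 2 isT isT.
have f13 : (b == cO) = false := D 1 3 isT isT.
have f14 : (b == cS) = false := D 1 4 isT isT.
have f15 : (b == kk) = false := D 1 5 isT isT.
have f20 : (b1 == cN) = false := D 2 0 isT isT.
have f21 : (b1 == b) = false := D 2 1 isT isT.
have f23 : (b1 == cO) = false := D 2 3 isT isT.
have f24 : (b1 == cS) = false := D 2 4 isT isT.
have f25 : (b1 == kk) = false := D 2 5 isT isT.
have f30 : (cO == cN) = false := D 3 0 isT isT.
have f31 : (cO == b) = false := D 3 1 isT isT.
have f32 : (cO == b1) = false := D 3 2 isT isT.
have f34 : (cO == cS) = false := D 3 4 isT isT.
have f35 : (cO == kk) = false := D 3 5 isT isT.
have f40 : (cS == cN) = false := D 4 0 isT isT.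
have f41 : (cS == b) = false := D 4 1 isT isT.
have f42 : (cS == b1) = false := D 4 2 isT isT.
have f43 : (cS == cO) = false := D 4 3 isT isT.
have f45 : (cS == kk) = false := D 4 5 isT isT.
have f50 : (kk == cN) = false := D 5 0 isT isT.
have f51 : (kk == b) = false := D 5 1 isT isT.
have f52 : (kk == b1) = false := D 5 2 isT isT.
have f53 : (kk == cO) = false := D 5 3 isT isT.
have f54 : (kk == cS) = false := D 5 4 isT isT.
rewrite /= /nset /nget /loc /= !(f01, f02, f03, f04, f05, f10, f12, f13, f14, f15, f20, f21, f23, f24, f25, f30, f31, f32, f34, f35, f40, f41, f42, f43, f45, f50, f51, f52, f53, f54, eqxx) [w * _]mulnC.
by case: (c == cN) => //; case: (c == b) => //; case: (c == b1).
Qed.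

Section Prologue.
Variables (X : finType) (E : {set {set X}}) (I : Defs.instance R E) (S0 O b : nat).
Hypotheses (bE : #|E| <= b) (bO : b + 9 < O).

Variables (hc : nm -> nat) (pI : nat).
Hypotheses (hc_inj : injective hc) (hcO : forall a, O <= hc a).
Definition pF (kF : nat * {set X}) : prog := sl
  [:: NMove (Dir (hc (gSZ kF.2))) (Dir kF.1); NMove (Dir (hc (gOFF kF.2))) (Dir b);
      NConst (Dir (b + 1)) #|kF.2|; NArith NMul (Dir (b + 1)) (Dir (b + 1)) (Dir kF.1);
      NArith NAdd (Dir b) (Dir b) (Dir (b + 1)); NArith NMul (Dir (hc gNE)) (Dir (hc gNE)) (Dir kF.1)].

Fixpoint pFs k (l : seq {set X}) : prog :=
  if l is F :: l' then Seq (pF (k, F)) (pFs k.+1 l') else Skip.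

Definition prologue : prog := Seq (Do (NConst (Dir (hc gNE)) 1)) (Seq (pFs 0 (enum E))
  (Seq (sl [:: NMove (Dir (hc gM)) (Dir b); NConst (Dir (b + 1)) 1; NConst (Dir (b + 2)) 0;
     NConst (Dir (b + 3)) pI; NArith NAdd (Dir (b + 3)) (Dir (b + 3)) (Dir b); NMove (Dir (b + 4)) (Dir b);
     NConst (Dir (b + 5)) 1; NConst (Dir (b + 6)) S0]) (copyP b))).

Lemma hc_eq a a' : (hc a == hc a') = (a == a').
Proof. exact: inj_eq. Qed.

Lemma hcb a k : k <= 9 -> (hc a == b + k) = false.
Proof. by move=> k9; apply/negbTE; rewrite neq_ltn; apply/orP; right; move: (hcO a) bO k9; clear; lia. Qed.

Definition sizes k := nth 0 [seq size (I F) | F <- enum E] k.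

Definition pinv (l : seq {set X}) s := [/\ rmem s = rmem (input_state I),
  forall k, k < b -> nmem s k = sizes k,
  nmem s b = sumn [seq size (I F) * #|F| | F <- l],
  nmem s (hc gNE) = \prod_(F <- l) size (I F) &
  (forall F, F \in l -> nmem s (hc (gSZ F)) = size (I F) /\ nmem s (hc (gOFF F)) = offI I F) /\
  forall c, O <= c -> c != hc gNE -> (forall F : {set X}, c != hc (gSZ F) /\ c != hc (gOFF F)) -> nmem s c = 0].

Lemma pF_ok p F l s : enum E = p ++ F :: l -> pinv p s ->
  exists2 s', exec (pF (size p, F)) s 6 s' & pinv (rcons p F) s'.
Proof.
move=> eE [i1 i2 i3 i4 [i5 i6]].
have kE : size p < #|E| by rewrite cardE eE size_cat /= addnS ltnS leq_addr.
have kb : size p < b by apply: leq_trans bE.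
have sk : nmem s (size p) = size (I F).
  by rewrite i2 // /sizes eE map_cat nth_cat size_map ltnn subnn.
have hk a : (hc a == size p) = false.
  by apply/negbTE; rewrite neq_ltn; apply/orP; right; move: (hcO a) bO kb; clear; lia.
have hb a : (hc a == b) = false by rewrite -[b]addn0 hcb.
have hb1 a : (hc a == b + 1) = false by rewrite hcb.
exists (foldl (fun s i => do_instr i s) s [:: NMove (Dir (hc (gSZ F))) (Dir (size p)); NMove (Dir (hc (gOFF F))) (Dir b);
      NConst (Dir (b + 1)) #|F|; NArith NMul (Dir (b + 1)) (Dir (b + 1)) (Dir (size p));
      NArith NAdd (Dir b) (Dir b) (Dir (b + 1)); NArith NMul (Dir (hc gNE)) (Dir (hc gNE)) (Dir (size p))]).
  exact: (exec_sl _ s).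
set s' := foldl _ _ _.
have u : uniq [:: hc gNE; b; b + 1; hc (gOFF F); hc (gSZ F); size p].
  have e1 : (hc gNE == hc (gOFF F)) = false by rewrite hc_eq.
  have e2 : (hc gNE == hc (gSZ F)) = false by rewrite hc_eq.
  have e3 : (hc (gOFF F) == hc (gSZ F)) = false by rewrite hc_eq.
  have bb : (b == b + 1) = false by apply/negbTE; rewrite neq_ltn addn1 leqnn.
  have bk : (b == size p) = false by apply/negbTE; rewrite neq_ltn kb orbT.
  have b1k : (b + 1 == size p) = false by apply/negbTE; rewrite neq_ltn addn1 ltnS (ltnW kb) orbT.
  move: e1 e2 e3 (hk gNE) (hk (gOFF F)) (hk (gSZ F)) (hb gNE) (hb (gOFF F)) (hb (gSZ F)) (hb1 gNE) (hb1 (gOFF F)) (hb1 (gSZ F)).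
  move: (hc gNE) (hc (gOFF F)) (hc (gSZ F)) => z1 z2 z3 e1 e2 e3 k1 k2 k3 b1 b2 b3 c1 c2 c3.
  by rewrite /= !inE (eq_sym b z2) (eq_sym b z3) (eq_sym (b + 1) z2) (eq_sym (b + 1) z3) e1 e2 e3 k1 k2 k3 b1 b2 b3 c1 c2 c3 bb bk b1k.
have n' c := size_step s #|F| u c; rewrite -/s' sk in n'.
have r' : rmem s' = rmem s by [].
clearbody s'.
have SN (G : {set X}) : (hc (gSZ G) == hc gNE) = false by rewrite hc_eq.
have ON (G : {set X}) : (hc (gOFF G) == hc gNE) = false by rewrite hc_eq.
have offF : nmem s b = offI I F.
  rewrite i3 /offI; congr sumn; congr map; rewrite eE index_cat /= eqxx addn0.
  have := enum_uniq E; rewrite eE cat_uniq /= negb_or => /and3P[_ /andP[Fp _] _].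
  by rewrite (negbTE Fp) take_size_cat.
split.
- by rewrite r' i1.
- move=> k kb'; rewrite (n' k).
  have lh a : (k == hc a) = false by apply/negbTE; rewrite neq_ltn; apply/orP; left; move: (hcO a) kb' bO; clear; lia.
  move: (lh gNE) (lh (gOFF F)) (lh (gSZ F)); move: (hc gNE) (hc (gOFF F)) (hc (gSZ F)) => z1 z2 z3 -> -> ->.
  have -> : (k == b + 1) = false by apply/negbTE; rewrite neq_ltn addn1 ltnS (ltnW kb').
  by rewrite (ltn_eqF kb') i2.
- rewrite (n' b) i3 map_rcons sumn_rcons; move: (hb gNE); move: (hc gNE) => z1; rewrite eq_sym => ->.
  by rewrite eqxx mulnC.
- by rewrite (n' (hc gNE)) eqxx i4 -cats1 big_cat big_seq1 /= mulnC.
- split.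
    move=> G; rewrite mem_rcons inE (n' (hc (gSZ G))) (n' (hc (gOFF G))).
    have eS : (hc (gSZ G) == hc (gSZ F)) = (G == F) by rewrite hc_eq /gSZ !eqseq_cons /= andbT (inj_eq (@pkF_inj X)).
    have eO : (hc (gOFF G) == hc (gOFF F)) = (G == F) by rewrite hc_eq /gOFF !eqseq_cons /= andbT (inj_eq (@pkF_inj X)).
    have SG : (hc (gSZ G) == hc (gOFF F)) = false by rewrite hc_eq.
    have OG : (hc (gOFF G) == hc (gSZ F)) = false by rewrite hc_eq.
    move: (i5 G) eS eO SG OG (hb (gSZ G)) (hb (gOFF G)) (hb1 (gSZ G)) (hb1 (gOFF G)) (SN G) (ON G).
    move: (hc (gSZ G)) (hc (gOFF G)) (hc (gSZ F)) (hc (gOFF F)) (hc gNE) => z1 z2 z3 z4 z5.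
    move=> i5' -> -> -> -> -> -> -> -> -> ->; case: eqP => [-> _|_ /= /i5' [-> ->]] //.
  move=> c Oc cN cF; rewrite (n' c); move: (cF F) cN (i6 c Oc cN cF).
  move: (hc (gSZ F)) (hc (gOFF F)) (hc gNE) => z1 z2 z3 [/negbTE-> /negbTE->] /negbTE-> ->.
  have -> : (c == b) = false by apply/negbTE; rewrite neq_ltn; apply/orP; right; move: Oc bO; clear; lia.
  by have -> : (c == b + 1) = false by apply/negbTE; rewrite neq_ltn; apply/orP; right; move: Oc bO; clear; lia.
Qed.

Lemma pFs_ok p l s : enum E = p ++ l -> pinv p s -> exists2 s', exec (pFs (size p) l) s (6 * size l) s' & pinv (enum E) s'.
Proof.
elim: l p s => [|F l IH] p s eE ip.
  by exists s; [exact: ExecSkip|rewrite eE cats0].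
have [s1 x1 i1] := pF_ok eE ip.
have [|s2 x2 i2] := IH (rcons p F) s1 _ i1; first by rewrite cat_rcons.
exists s2 => //; rewrite mulnS; apply: ExecSeq x1 _.
by move: x2; rewrite size_rcons.
Qed.
End Prologue.
End LowLevel.

Section Width.
Local Open Scope ring_scope.
Variables (R : realType) (X : finType) (E : {set {set X}}).
Hypothesis covE : forall x : X, exists2 F : {set X}, F \in E & x \in F.
Implicit Types (U L : {set X}) (o : seq X).

Definition feas U : set R := [set w | exists lam : {set X} -> R,
    [/\ forall S, S \in E -> 0 <= lam S,
        forall v, v \in U -> 1 <= \sum_(S in E | v \in S) lam S &
        w = \sum_(S in E) lam S]]%classic.

Lemma feas_ne U : (feas U !=set0)%classic.
Proof.
exists (\sum_(S in E) 1), (fun=> 1); split=> // v _; have [F FE vF] := covE v.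
by rewrite (bigD1 F) ?FE //= lerDl sumr_ge0.
Qed.

Lemma bnd_rho U N : (2 <= N)%N -> bnd E N U (N%:R `^ rho_star R E U).
Proof.
move=> N2 T C C0 H.
have N0 : 0 < N%:R :> R by rewrite ltr0n (leq_trans _ N2).
have [T0|T0] := lerP T 0; first by apply: le_trans T0 _; rewrite mulr_ge0 ?powR_ge0.
have [w [lam [l1 l2 _]]] := feas_ne U.
have Cp : 0 < C.
  rewrite lt_def C0 andbT; apply/eqP => C00.
  by have := H lam l1 l2; rewrite C00 mul0r leNgt T0.
have lN : 0 < ln N%:R :> R by rewrite ln_gt0 // ltr1n.
have q0 : 0 < T / C by rewrite divr_gt0.
have key : ln (T / C) / ln N%:R <= rho_star R E U.
  apply: lb_le_inf; first exact: feas_ne.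
  move=> _ [lam' [a b ->]]; rewrite ler_pdivrMr // -ln_powR ler_ln ?posrE ?powR_gt0 //.
  by rewrite ler_pdivrMr // mulrC H.
rewrite mulrC -ler_pdivrMr // -ler_ln ?posrE ?powR_gt0 // ln_powR.
by rewrite -ler_pdivrMr.
Qed.

Lemma rho_ge1 U v : v \in U -> 1 <= rho_star R E U.
Proof.
move=> vU; apply: lb_le_inf; first exact: feas_ne.
move=> _ [lam [a b ->]]; apply: le_trans (b v vU) _.
rewrite [leRHS](bigID (fun S : {set X} => v \in S)) /= lerDl sumr_ge0 // => S /andP[SE _]; exact: a.
Qed.

Lemma seq_argmin (T : eqType) (f : T -> R) (s : seq T) : s != [::] ->
  exists2 x, x \in s & forall y, y \in s -> f x <= f y.
Proof.
elim: s => [//|x s IH] _; case: (eqVneq s [::]) => [->|/IH[z zs zm]].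
  by exists x; rewrite ?inE // => y; rewrite inE => /eqP->.
case: (lerP (f x) (f z)) => c.
  exists x; rewrite ?inE ?eqxx // => y; rewrite inE => /orP[/eqP-> //|/zm]; exact: le_trans.
by exists z; rewrite ?inE ?zs ?orbT // => y; rewrite inE => /orP[/eqP->|/zm //]; exact: ltW.
Qed.

Lemma first_exists L : exists o, ordering_first L o.
Proof.
exists (enum L ++ enum (~: L)); split.
  apply: uniq_perm; rewrite ?enum_uniq // ?cat_uniq ?enum_uniq ?andbT /=.
    by apply/hasPn => x; rewrite !mem_enum inE.
  by move=> x; rewrite mem_cat !mem_enum !inE orbN.
move=> u v uL vL; rewrite !index_cat !mem_enum uL (negbTE vL).
by apply: (@leq_trans (size (enum L))); rewrite ?index_mem ?mem_enum ?leq_addr.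
Qed.

Lemma best_order L : exists o, ordering_first L o /\ faqw_ord R E o <= faqw R E L.
Proof.
pose s := [seq o <- permutations (enum X) | `[< ordering_first L o >]].
have ms o : ordering_first L o -> o \in s.
  by move=> fo; rewrite mem_filter mem_permutations asboolT //=; case: fo.
have [w1 f1] := first_exists L.
have sn : s != [::] by apply: contraTneq (ms _ f1) => ->.
have [w os om] := seq_argmin (faqw_ord R E) sn.
exists w; split; first by move: os; rewrite mem_filter => /andP[/asboolP].
apply: lb_le_inf; first by exists (faqw_ord R E w1), w1.
by move=> _ [w' /ms/om le ->].
Qed.

Lemma faqw_ord_ge o U : U \in elim_sets E (rev o) -> rho_star R E U <= faqw_ord R E o.
Proof. by move=> Uo; rewrite /faqw_ord; apply: (@le_bigmax_seq _ _ _ _ _ U). Qed.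

Lemma faqw_ge1 L (x0 : X) : 1 <= faqw R E L.
Proof.
apply: lb_le_inf.
  by have [w fo] := first_exists L; exists (faqw_ord R E w), w.
move=> _ [w [po _] ->].
have : x0 \in rev w by rewrite mem_rev (perm_mem po) mem_enum.
case e : (rev w) => [//|v rs] _.
have vU : v \in (\bigcup_(F in E | v \in F) F)%SET.
  by have [F FE vF] := covE v; apply/finset.bigcupP; exists F; rewrite ?FE.
apply: le_trans (rho_ge1 vU) (faqw_ord_ge _); by rewrite e /= mem_head.
Qed.

Lemma good_exists L (x0 : X) : exists o, forall N, (2 <= N)%N -> goodo E N L o (N%:R `^ faqw R E L).
Proof.
have [w [[po fo] lo]] := best_order L; exists w.
have uo : uniq w by rewrite (perm_uniq po) enum_uniq.
move=> N N2; split=> //.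
- by move=> x; rewrite (perm_mem po) mem_enum.
- apply/(pairwiseP x0) => i j; rewrite !inE size_rev => li lj ij.
  rewrite !nth_rev //; apply/implyP => aL; apply/negPn/negP => bL.
  have si : (size w - i.+1 < size w)%N by clear - li; lia.
  have sj : (size w - j.+1 < size w)%N by clear - lj; lia.
  have := fo _ _ aL bL; rewrite !index_uniq //; clear - li lj ij; lia.
- move=> U Uo T C C0 H; apply: le_trans (bnd_rho N2 C0 H) _; apply: ler_wpM2l => //.
  apply: ler_powR; first by rewrite ler1n (leq_trans _ N2).
  by apply: le_trans lo; exact: faqw_ord_ge.
Qed.
End Width.

Section Steps.
Variable R : realType.
Implicit Type s : state R.

Lemma setup_step s cM b w S0 : (forall k, k <= 9 -> (cM == b + k) = false) ->
  let s' := foldl (fun s i => do_instr i s) s [:: NMove (Dir cM) (Dir b); NConst (Dir (b + 1)) 1; NConst (Dir (b + 2)) 0;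
     NConst (Dir (b + 3)) w; NArith NAdd (Dir (b + 3)) (Dir (b + 3)) (Dir b); NMove (Dir (b + 4)) (Dir b);
     NConst (Dir (b + 5)) 1; NConst (Dir (b + 6)) S0] in
  [/\ rmem s' = rmem s, forall c, nmem s' c = if c == b + 6 then S0 else if c == b + 5 then 1 else
     if c == b + 4 then nmem s b else if c == b + 3 then w + nmem s b else if c == b + 2 then 0 else
     if c == b + 1 then 1 else if c == cM then nmem s b else nmem s c &
     nmem s' b = nmem s b].
Proof.
move=> h.
have h0 : (b == cM) = false by rewrite eq_sym -[b]addn0 h.
have e k : (b == b + k.+1) = false by rewrite -[X in X == _]addn0 eqn_add2l.
have h' k : k <= 9 -> (b + k == cM) = false by move=> k9; rewrite eq_sym h.
by split=> // [c|]; rewrite /= /nset /nget /loc /= ?(eqn_add2l, e, h0, h') //=; case: (c == b + 6) => //;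
  case: (c == b + 5) => //; case: (c == b + 4) => //; case: (c == b + 3).
Qed.

Lemma epi_step s cO b w S0 : (forall k, k <= 9 -> (cO == b + k) = false) ->
  let s' := foldl (fun s i => do_instr i s) s [:: NConst (Dir (b + 1)) 1; NConst (Dir (b + 2)) w;
     NArith NAdd (Dir (b + 2)) (Dir (b + 2)) (Dir b); NConst (Dir (b + 5)) S0; NMove (Dir (b + 3)) (Dir cO);
     NArith NAdd (Dir (b + 3)) (Dir (b + 3)) (Dir (b + 1)); NArith NMul (Dir (b + 3)) (Dir (b + 3)) (Dir (b + 5));
     NArith NAdd (Dir (b + 3)) (Dir (b + 3)) (Dir b); NMove (Dir (b + 7)) (Dir (b + 3)); NMove (Dir (b + 4)) (Dir cO);
     NConst (Dir (b + 6)) 1] in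
  [/\ rmem s' = rmem s, [/\ nmem s' (b + 1) = 1, nmem s' (b + 2) = w + nmem s b,
     nmem s' (b + 3) = (nmem s cO + 1) * S0 + nmem s b & nmem s' (b + 4) = nmem s cO],
     [/\ nmem s' (b + 5) = S0, nmem s' (b + 6) = 1 & nmem s' (b + 7) = (nmem s cO + 1) * S0 + nmem s b] &
     forall c, b + 9 < c -> nmem s' c = nmem s c].
Proof.
move=> h.
have e k : (b == b + k.+1) = false by rewrite -[X in X == _]addn0 eqn_add2l.
split=> //; first by split; rewrite /= /nset /nget /loc /= !(eqn_add2l, e, h).
  by split; rewrite /= /nset /nget /loc /= !(eqn_add2l, e, h).
move=> c bc.
have hc k : k <= 9 -> (c == b + k) = false.
  by move=> k9; apply/negbTE; rewrite neq_ltn; apply/orP; right; move: bc k9; clear; lia.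
by rewrite /= /nset /nget /loc /= !hc.
Qed.

Section Outs.
Variables (b : nat) (st rw : nat -> nat).
Fixpoint outP (T : nat) : prog := if T is k.+1 then
  Seq (outP k) (sl [:: NArith NAdd (Dir k.*2) (Dir (b + 7)) (Dir (st k)); NMove (Dir k.*2.+1) (Dir (rw k))]) else Skip.

Lemma outP_ok T s : T.*2 <= b -> (forall k, b <= st k) -> (forall k, b <= rw k) ->
  exists s', [/\ exec (outP T) s (T * 2) s', rmem s' = rmem s, forall c, b <= c -> nmem s' c = nmem s c &
    forall k, k < T -> nmem s' k.*2 = nmem s (b + 7) + nmem s (st k) /\ nmem s' k.*2.+1 = nmem s (rw k)].
Proof.
move=> Tb hs hr; elim: T Tb => [|T IH] Tb; first by exists s; split=> //; exact: ExecSkip.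
have [|s1 [x1 r1 n1 o1]] := IH; first by move: Tb; clear; lia.
set l := [:: NArith NAdd (Dir T.*2) (Dir (b + 7)) (Dir (st T)); NMove (Dir T.*2.+1) (Dir (rw T))].
set s2 := foldl (fun s i => do_instr i s) s1 l.
have nr : (rw T == T.*2) = false by apply/negbTE; rewrite neq_ltn; apply/orP; right; move: (hr T) Tb; clear; lia.
have n2 c : nmem s2 c = if c == T.*2.+1 then nmem s1 (rw T) else if c == T.*2 then nmem s1 (b + 7) + nmem s1 (st T) else nmem s1 c.
  by rewrite /s2 /= /nset /nget /loc /= nr.
exists s2; split.
- have -> : T.+1 * 2 = T * 2 + 2 by clear; lia.
  apply: ExecSeq x1 _; exact: (exec_sl l s1).
- by rewrite -r1.
- move=> c bc; rewrite n2 -(n1 c bc); do 2 (rewrite ifF; last by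
    apply/negbTE; rewrite neq_ltn; apply/orP; right; move: bc Tb; clear; lia).
  by [].
- move=> k; rewrite ltnS leq_eqVlt => /orP[/eqP->|kT].
    rewrite !n2 eqxx [_ == T.*2.+1]eqn_leq ltnn andbF eqxx !n1 //.
    by move: (leq_addr 7 b).
  have [<- <-] := o1 k kT; rewrite !n2.
  by split; do 2 (rewrite ifF; last by apply/negbTE; rewrite neq_ltn; apply/orP; left; move: kT; clear; lia).
Qed.
End Outs.
End Steps.

Section Program.
Variables (X : finType) (E : {set {set X}}) (Lk : nat -> {set X}) (exk : nat -> X -> nat) (ok : nat -> seq X) (T : nat).
Definition Mn := main E Lk exk ok T.
Definition pnames : seq nm := cnms Mn ++ [:: gM; gNE; gINP; gOUT; gOLEN] ++ [seq gSZ F | F <- enum {set X}] ++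
  [seq gOFF F | F <- enum {set X}] ++ [seq gROWS k | k <- iota 0 T] ++ [seq gST k | k <- iota 0 T].
Definition pS : nat := (\max_(a <- pnames) pk a).+1.
Definition pb : nat := #|E| + T.*2.
Definition pO : nat := pb + 10 + cdp Mn.
Definition ph (a : nm) : nat := pO + pk a.

Lemma pnamesP a : a \in pnames -> pk a < pS.
Proof. by move=> ap; rewrite ltnS; apply: leq_bigmax_seq. Qed.

Definition program : prog := Seq (prologue E pS pb ph (pk gINP)) (Seq (comp pS pO pb (pb + 1) Mn)
  (Seq (sl [:: NConst (Dir (pb + 1)) 1; NConst (Dir (pb + 2)) (pk gOUT);
     NArith NAdd (Dir (pb + 2)) (Dir (pb + 2)) (Dir pb); NConst (Dir (pb + 5)) pS; NMove (Dir (pb + 3)) (Dir (ph gOLEN));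
     NArith NAdd (Dir (pb + 3)) (Dir (pb + 3)) (Dir (pb + 1)); NArith NMul (Dir (pb + 3)) (Dir (pb + 3)) (Dir (pb + 5));
     NArith NAdd (Dir (pb + 3)) (Dir (pb + 3)) (Dir pb); NMove (Dir (pb + 7)) (Dir (pb + 3)); NMove (Dir (pb + 4)) (Dir (ph gOLEN));
     NConst (Dir (pb + 6)) 1]) (Seq (copyP pb) (outP pb (fun k => ph (gST k)) (fun k => ph (gROWS k)) T)))).

Section Run.
Variables (R : realType) (I : Defs.instance R E) (B' : nat).
Hypothesis sM : size (flat I) = B'.+1.
Hypothesis covE : forall x : X, exists2 F : {set X}, F \in E & x \in F.
Variables (x0 : X) (N : nat) (Ak : nat -> R).
Hypothesis szN : forall F, F \in E -> size (I F) <= N.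
Hypothesis gok : forall k, goodo E N (Lk k) (ok k) (Ak k).
Local Notation M := B'.+1.

Lemma size_flat : size (flat I) = sumn [seq size (I F) * #|F| | F : {set X} <- enum E].
Proof.
by rewrite /flat size_flatten /shape -map_comp; congr sumn; apply: eq_map => F /=; rewrite size_rel.
Qed.

Lemma phO a : pO <= ph a. Proof. exact: leq_addr. Qed.
Lemma pbO : pb + 9 < pO. Proof. rewrite /pO; clear; lia. Qed.
Lemma ph_inj : injective ph.
Proof. by move=> a a' /addnI /pk_inj. Qed.
Lemma phb a k : k <= 9 -> (ph a == pb + k) = false.
Proof. by move=> k9; apply/negbTE; rewrite neq_ltn; apply/orP; right; move: (phO a) pbO k9; clear; lia. Qed.

Lemma prologue_ok : exists s1 : state R,
  [/\ exec (prologue E pS pb ph (pk gINP)) (input_state I) (1 + (6 * #|E| + (8 + (M * 5 + 1)))) s1,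
   nmem s1 pb = M /\ nmem s1 (ph gM) = M /\ nmem s1 (ph gNE) = \prod_(F in E) size (I F),
   forall F, F \in E -> nmem s1 (ph (gSZ F)) = size (I F) /\ nmem s1 (ph (gOFF F)) = offI I F,
   forall c, pO <= c -> c != ph gM -> c != ph gNE -> (forall F : {set X}, c != ph (gSZ F) /\ c != ph (gOFF F)) -> nmem s1 c = 0 &
   (forall i, i < M -> rmem s1 (pk gINP + M + i * pS) = nth 0%R (flat I) i) /\
   (forall c, M <= c -> (forall i, i < M -> c != pk gINP + M + i * pS) -> rmem s1 c = 0%R)].
Proof.
set s0 := do_instr (NConst (Dir (ph gNE)) 1) (input_state I).
have nz c : #|E| <= c -> nmem (input_state I) c = 0 by move=> Ec; rewrite /= nth_default // size_map -cardE.
have n0 c : nmem s0 c = if c == ph gNE then 1 else nmem (input_state I) c by [].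
have bE : #|E| <= pb by exact: leq_addr.
have i0 : pinv I pO pb ph [::] s0.
  split=> //.
  - move=> k kb; rewrite n0; case: eqP => // e; exfalso; move: kb; rewrite e; move: (phO gNE) pbO; clear; lia.
  - rewrite n0 -{1}[pb]addn0 eq_sym phb //=; exact: nz.
  - by rewrite n0 eqxx big_nil.
  - split=> // c Oc cN _; rewrite n0 (negbTE cN); apply: nz; move: bE Oc pbO; clear; lia.
have [s3 x3 [r3 k3 b3 N3 [F3 z3]]] := pFs_ok bE pbO ph_inj phO (erefl : enum E = [::] ++ enum E) i0.
have [] := @setup_step R s3 (ph gM) pb (pk gINP) pS (@phb gM).
set l := [:: _; _; _; _; _; _; _; _]; set s4 := foldl _ s3 _ => r4 n4 b4.
have x4 := exec_sl l s3; rewrite -/s4 in x4.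
have bM : nmem s3 pb = M by rewrite b3 -size_flat.
have m1 : nmem s4 (pb + 1) = 1 by rewrite n4 !eqn_add2l.
have m2 : nmem s4 (pb + 2) = 0 by rewrite n4 !eqn_add2l.
have m3 : nmem s4 (pb + 3) = pk gINP + M by rewrite n4 !eqn_add2l bM.
have m4 : nmem s4 (pb + 4) = M by rewrite n4 !eqn_add2l bM.
have m5 : nmem s4 (pb + 5) = 1 by rewrite n4 !eqn_add2l.
have m6 : nmem s4 (pb + 6) = pS by rewrite n4 !eqn_add2l.
have lt i : i < M -> 0 + i * 1 < pk gINP + M by move=> iM; rewrite muln1 add0n ltn_addl.
have [s5 [x5 n5 c5 d5]] := copy_ok m1 m2 m3 m4 m5 m6 (ltn0Sn _) lt.
have n54 c : pb + 9 < c -> nmem s5 c = if c == ph gM then M else nmem s3 c.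
  move=> bc; have hc k : k <= 9 -> (c == pb + k) = false.
    by move=> k9; apply/negbTE; rewrite neq_ltn; apply/orP; right; move: bc k9; clear; lia.
  by rewrite n5 ?n4 ?inE !hc // bM.
have hlt a : pb + 9 < ph a by apply: leq_trans pbO (phO a).
have rin c : rmem s4 c = nth 0%R (flat I) c by rewrite r4 r3.
exists s5; split.
- have -> : 1 + (6 * #|E| + (8 + (M * 5 + 1))) = 1 + (6 * size (enum E) + (size l + (M * 5 + 1))) by rewrite -cardE.
  apply: ExecSeq (ExecDo _ _) _; apply: ExecSeq x3 _; exact: ExecSeq x4 x5.
- split; last first.
    rewrite (n54 _ (hlt gM)) (n54 _ (hlt gNE)) eqxx (inj_eq ph_inj) N3 big_enum.
    by [].
  have bk k : (pb == pb + k.+1) = false by rewrite -[X in X == _]addn0 eqn_add2l.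
  by rewrite n5 ?b4 // !inE !bk.
- move=> F FE; have [fs fo] := F3 F (etrans (mem_enum _ _) FE).
  by split; [apply: etrans fs|apply: etrans fo]; apply: etrans (n54 _ (hlt _)) _; case: eqP => // /ph_inj.
- move=> c Oc cM cN cF; rewrite n54; last by apply: leq_trans pbO Oc.
  by rewrite (negbTE cM) z3.
- split=> [i iM|c Mc nc]; first by rewrite c5 // rin muln1 add0n.
  by rewrite d5 // rin nth_default // sM.
Qed.

Lemma okn_g a : a \in [:: gM; gNE; gINP; gOUT; gOLEN] -> pk a < pS.
Proof. by move=> ag; apply: pnamesP; rewrite !mem_cat ag !orbT. Qed.
Lemma okn_sz (F : {set X}) : pk (gSZ F) < pS.
Proof. by apply: pnamesP; rewrite !mem_cat (map_f (@gSZ X)) ?mem_enum ?orbT. Qed.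
Lemma okn_off (F : {set X}) : pk (gOFF F) < pS.
Proof. by apply: pnamesP; rewrite !mem_cat (map_f (@gOFF X)) ?mem_enum ?orbT. Qed.
Lemma okn_rows k : k < T -> pk (gROWS k) < pS /\ pk (gST k) < pS.
Proof.
move=> kT; have ki : k \in iota 0 T by rewrite mem_iota.
by split; apply: pnamesP; rewrite !mem_cat ?(map_f gROWS ki) ?(map_f gST ki) ?orbT.
Qed.

Definition readn (s : state R) (B a : nat) : hst R :=
  HSt (fun b i => if pk b < pS then nmem s (a + (i * pS + pk b)) else 0)
      (fun b i => if pk b < pS then rmem s (B + (i * pS + pk b)) else 0%R).

Lemma program_ok : exists jl (ts : forall k, table R (Lk k)) n s,
  [/\ exec program (input_state I) n s, uniq jl /\ (forall t, (t \in jl) <-> Defs.join I t),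
   forall k, k < T -> [/\ uniq (unzip1 (ts k)),
      forall z, z \in unzip1 (ts k) <-> exists2 t, Defs.join I t & z = proj_on (Lk k) t &
      forall z v, (z, v) \in ts k -> v = ws jl (exk k) z],
   forall k, k < T -> holds_table s k (ts k) &
   exists c, n = (22 + 6 * #|E| + M * 5) + c + (5 * \sum_(k < T) size (ts k) * #|Lk k|.+1 + T * 2) /\
     (c%:R <= (10 + 2000 * (M * (2 + trunc_log 2 M)))%:R + qcost E N 1 13 (Ak 0) +
      \sum_(k < T) (12 + qcost E N (size (ts k)) (25 * #|X| + 60) (Ak k)))%R].
Proof.
have [s1 [x1 [b1 [M1 N1]] F1 z1 [c1 d1]]] := prologue_ok.
pose h0 := readn s1 M pO.
have naE a i : na h0 a i = if pk a < pS then nmem s1 (pO + (i * pS + pk a)) else 0 by [].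
have raE a i : ra h0 a i = if pk a < pS then rmem s1 (M + (i * pS + pk a)) else 0%R by [].
have rep0 : rep pS pO pb M h0 s1 by split=> // a i ap; rewrite /= ap.
have rd a : pk a < pS -> na h0 a 0 = nmem s1 (ph a) by move=> ap; rewrite /= ap mul0n.
have adr a a' i j : pk a < pS -> pk a' < pS -> i * pS + pk a = j * pS + pk a' -> a = a' /\ i = j.
  by move=> p1 p2 /eqP; rewrite (@adr_inj pS) // => /andP[/eqP-> /eqP->].
have hM : na h0 gM 0 = M by rewrite (rd gM (okn_g (a := gM) isT)).
have hN : na h0 gNE 0 = \prod_(F in E) size (I F) by rewrite (rd gNE (okn_g (a := gNE) isT)).
have hS (F : {set X}) : F \in E -> na h0 (gSZ F) 0 = size (I F) by move=> /F1[e _]; rewrite rd ?okn_sz.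
have hO (F : {set X}) : F \in E -> na h0 (gOFF F) 0 = offI I F by move=> /F1[_ e]; rewrite rd ?okn_off.
have zn a i : a \notin [:: gM; gNE] -> ~~ ((nth 0 a 1 == 0) && (nth 0 a 0 \in [:: 16; 17])) -> na h0 a i = 0.
  rewrite !inE negb_or => /andP[/eqP aM /eqP aN] aF; rewrite naE; case: ifP => // ap.
  have ne b : pk b < pS -> a <> b -> pO + (i * pS + pk a) != ph b.
    move=> bp ab; apply/eqP => /addnI e; apply: ab; exact: (adr a b i 0 ap bp e).1.
  have nM := ne gM (okn_g (a := gM) isT) aM; have nN := ne gNE (okn_g (a := gNE) isT) aN.
  apply: (z1 _ (leq_addr _ _) nM nN) => F; split.
    by apply: (ne (gSZ F) (okn_sz F)) => e; move: aF; rewrite e.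
  by apply: (ne (gOFF F) (okn_off F)) => e; move: aF; rewrite e.
have zr a i : a != gINP -> ra h0 a i = 0%R.
  move=> /eqP aI; rewrite raE; case: ifP => // ap; apply: d1; first exact: leq_addr.
  move=> j jM; apply/eqP; rewrite [pk gINP + M]addnC -addnA [pk gINP + _]addnC => /addnI e; apply: aI.
  exact: (adr a gINP i j ap (okn_g (a := gINP) isT) e).1.
have hI j : ra h0 gINP j = nth 0%R (flat I) j.
  rewrite raE (okn_g (a := gINP) isT); case: (ltnP j M) => jM.
    by rewrite -c1 // [pk gINP + M]addnC -addnA [pk gINP + _]addnC.
  rewrite nth_default ?sM //; apply: d1; first exact: leq_addr.
  move=> i iM; apply/eqP; rewrite [pk gINP + M]addnC -addnA [pk gINP + _]addnC => /addnI e.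
  by have := (adr gINP gINP j i (okn_g (a := gINP) isT) (okn_g (a := gINP) isT) e).2 => ji; move: iM; rewrite -ji ltnNge jM.
have [jl [ts [s [J1 J2 [os ss] J3 J4]]]] := main_ok sM covE x0 szN exk gok T hM hI hS hO hN zn zr.
have oks : all (okn pS) (cnms Mn) by apply/allP => a aM; apply: pnamesP; rewrite mem_cat aM.
have lpO : pb < pO by move: pbO; clear; lia.
have lr : pb < pb + 1 by rewrite addn1.
have lc : pb + 1 + cdp Mn <= pO by rewrite /pO; clear; lia.
have [s2 [x2 [p2 q2 r2] k2]] := comp_ok lpO rep0 oks lr lc.
set h := run Mn h0 in p2 q2.
have [] := @epi_step R s2 (ph gOLEN) pb (pk gOUT) pS (@phb gOLEN).
set l := [:: _; _; _; _; _; _; _; _; _; _; _]; set s3 := foldl _ s2 _ => r3 [m1 m2 m3 m4] [m5 m6 m7] k3.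
have x3 := exec_sl l s2; rewrite -/s3 in x3.
have rd2 a : pk a < pS -> nmem s2 (ph a) = na h a 0 by move=> ap; rewrite -p2 // mul0n.
have OL : nmem s2 (ph gOLEN) = size s by rewrite (rd2 gOLEN (okn_g (a := gOLEN) isT)); case: os.
rewrite OL r2 in m2 m3 m4 m7.
pose T0 := (size s + 1) * pS + M.
have lt i : i < size s -> pk gOUT + M + i * pS < T0.
  move=> il; have := okn_g (a := gOUT) isT; rewrite /T0; move: il; clear; nia.
have [s4 [x4 n4 c4 _]] := copy_ok m1 m2 m3 m4 m5 m6 isT lt.
have Tb : T.*2 <= pb by exact: leq_addl.
have pbph a : pb <= ph a by apply: leq_trans (ltnW lpO) (phO a).
have [s5 [x5 r5 n5 o5]] := @outP_ok R pb (fun k => ph (gST k)) (fun k => ph (gROWS k)) T s4 Tb (fun k => pbph _) (fun k => pbph _).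
have out i : i < size s -> rmem s5 (T0 + i) = nth 0%R s i.
  move=> il; have [_ os2] := os; rewrite r5 -os2 // -(q2 gOUT i (okn_g (a := gOUT) isT)).
  have := c4 i il; rewrite muln1 => ->; rewrite r3; congr (rmem s2 _); clear; lia.
have cell a : pk a < pS -> nmem s4 (ph a) = na h a 0.
  move=> ap; have la : pb + 9 < ph a by apply: leq_trans pbO (phO a).
  rewrite n4 ?k3 ?rd2 // !inE !negb_or; apply/and3P; split; apply/eqP => e; move: la; rewrite e; clear; lia.
exists jl, ts, (1 + (6 * #|E| + (8 + (M * 5 + 1))) + (cost Mn h0 + (size l + (size s * 5 + 1 + T * 2)))), s5; split=> //.
- apply: ExecSeq x1 _; apply: ExecSeq x2 _; apply: ExecSeq x3 _; exact: ExecSeq x4 x5.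
- move=> k kT; have [e1 [p [p' [e2 e3]]]] := J3 k kT; have [w1 w2] := o5 k kT; have [v1 v2] := okn_rows kT.
  have szt : size (tstr (ts k)) = size (ts k) * #|Lk k|.+1.
    rewrite /tstr; elim: (ts k) => //= r tb IH; by rewrite size_cat size_rcons size_row IH mulSn.
  split; first by rewrite w2 cell.
  apply: (@eq_from_nth _ 0%R); rewrite size_mkseq -/(tstr (ts k)) ?szt // => i il.
  rewrite nth_mkseq // w1 cell // n4; last by rewrite !inE !eqn_add2l.
  rewrite m7 e3 -addnA out.
    by rewrite e2 nth_cat ltnNge leq_addr /= addKn nth_cat szt il.
  by rewrite e2 !size_cat szt ltn_add2l ltn_addr.
- exists (cost Mn h0); split; last exact: J4.
  have lE : size l = 11 by [].
  rewrite -ss lE; clear; lia.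
Qed.
End Run.
End Program.

Lemma qcost_nat n e N r w : 0 < n -> 0 < e -> 0 < N -> w <= 25 * n + 60 ->
  n * (e * (20 + N * (105 + n * 300))) + 100 + 60 * n + r * (w + n * (200 + 20 * n)) <= n * n * e * (585 * N + 305 * r).
Proof.
move=> n0 e0 N0 wn.
have h1 : n <= n * n by rewrite leq_pmulr.
have h2 : n * n <= n * n * e by rewrite leq_pmulr.
have h3 : n * e <= n * n * e by rewrite leq_mul2r h1 orbT.
have h4 : 1 <= n * n * e by rewrite !muln_gt0 n0 e0.
have h5 : n * n * e <= n * n * e * N by rewrite leq_pmulr.
have h6 : n * e * N <= n * n * e * N by rewrite leq_mul2r h3 orbT.
have a1 : n * (e * (20 + N * (105 + n * 300))) <= n * n * e * N * 425.
  have -> : n * (e * (20 + N * (105 + n * 300))) = n * e * 20 + n * e * N * 105 + n * n * e * N * 300 by ring.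
  move: (n * n * e) (n * e * N) (n * n * e * N) (n * e) h5 h6 h3 => z1 z2 z3 z4; clear; lia.
have a2 : 100 + 60 * n <= n * n * e * N * 160.
  move: (n * n) (n * n * e) (n * n * e * N) h1 h2 h4 h5 => z1 z2 z3; clear; lia.
have a3 : r * (w + n * (200 + 20 * n)) <= n * n * e * r * 305.
  rewrite [_ * r * 305]mulnAC [_ * r]mulnC leq_mul2l; apply/orP; right.
  have -> : n * (200 + 20 * n) = 200 * n + 20 * (n * n) by ring.
  move: (n * n) (n * n * e) h1 h2 h4 wn => z1 z2; clear; lia.
have -> : n * n * e * (585 * N + 305 * r) = n * n * e * N * 585 + n * n * e * r * 305 by ring.
move: a1 a2 a3; move: (n * n * e * N) (n * n * e * r) (r * _) (n * (e * _)) => z1 z2 z3 z4; clear; lia.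
Qed.

Lemma qcost_nat2 n e : 0 < n -> 0 < e ->
  n * (1000 + 30 * n + n * (400 * e.+1)) + n * (200 + 60 * n) <= n * n * e * 2090.
Proof.
move=> n0 e0.
have h1 : n <= n * n by rewrite leq_pmulr.
have h2 : n * n <= n * n * e by rewrite leq_pmulr.
have -> : n * (1000 + 30 * n + n * (400 * e.+1)) + n * (200 + 60 * n) = n * 1200 + n * n * 490 + n * n * e * 400 by ring.
move: (n * n) (n * n * e) h1 h2 => z1 z2; clear; lia.
Qed.

Lemma natr_total (K : pzRingType) k1 k2 k3 k4 k5 e M c w T :
  (((k1 + k2 * e + M * k3) + c + (k4 * w + T * k5))%N%:R = k1%:R + k2%:R * e%:R + M%:R * k3%:R + c%:R + (k4%:R * w%:R + T%:R * k5%:R) :> K)%R.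
Proof. by rewrite !natrD !natrM. Qed.
Lemma natr_main (K : pzRingType) k1 k2 M u : ((k1 + k2 * (M * u))%N%:R = k1%:R + k2%:R * (M%:R * u%:R) :> K)%R.
Proof. by rewrite !natrD !natrM. Qed.
Lemma natr_cube (K : pzRingType) k : ((k * k * k)%N%:R = k%:R * k%:R * k%:R :> K)%R.
Proof. by rewrite !natrM. Qed.

Section Cost.
Local Open Scope ring_scope.
Variables (R : realType) (X : finType) (E : {set {set X}}) (N : nat).
Hypotheses (n0 : (0 < #|X|)%N) (e0 : (0 < #|E|)%N) (N2 : (2 <= N)%N).
Local Notation Z := ((#|X| * #|X| * #|E|)%N%:R : R).

Lemma Z1 : 1 <= Z.
Proof. by rewrite ler1n !muln_gt0 n0 e0. Qed.

Lemma cost_lemma (x1 x2 z A r Nr : R) : 1 <= z -> 1 <= A -> Nr <= A -> 0 <= r ->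
  x1 <= z * (585 * Nr + 305 * r) -> x2 <= z * 2090 -> 12 + (x1 + x2 * A) <= 2700 * z * (A + r).
Proof.
move=> z1 A1 NA r0 h1 h2.
have a1 : z * (585 * Nr + 305 * r) <= z * (585 * A + 305 * r) by rewrite ler_pM2l; lra.
have a2 : x2 * A <= z * 2090 * A by rewrite ler_wpM2r //; lra.
have a3 : z <= z * A by rewrite ler_peMr //; lra.
have a4 : 0 <= z * r by rewrite mulr_ge0 //; lra.
have -> : 2700 * z * (A + r) = 2700 * (z * A) + 2700 * (z * r) by ring.
have e1 : z * (585 * A + 305 * r) = 585 * (z * A) + 305 * (z * r) by ring.
have e2 : z * 2090 * A = 2090 * (z * A) by ring.
lra.
Qed.

Lemma qcost_le r w (A : R) : (w <= 25 * #|X| + 60)%N -> N%:R <= A -> 12 + qcost E N r w A <= 2700 * Z * (A + r%:R).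
Proof.
move=> wn NA; have N0 : (0 < N)%N by exact: leq_trans N2.
have A1 : 1 <= A by apply: le_trans NA; rewrite ler1n.
apply: (@cost_lemma _ _ _ _ _ N%:R) => //; first exact: Z1.
  have -> : Z * (585 * N%:R + 305 * r%:R) = (#|X| * #|X| * #|E| * (585 * N + 305 * r))%N%:R.
    by rewrite [RHS]natrM natrD !natrM.
  by rewrite ler_nat; exact: qcost_nat.
have -> : Z * 2090 = (#|X| * #|X| * #|E| * 2090)%N%:R by rewrite [RHS]natrM.
by rewrite ler_nat; exact: qcost_nat2.
Qed.

Lemma ln2_half : 1 <= 2 * ln (2 : R).
Proof.
have -> : ln (2 : R) = - ln (1 / 2) by rewrite div1r lnV ?posrE // opprK.
have h : ln (1 + - (1 / 2) : R) <= - (1 / 2) by apply: le_ln1Dx; lra.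
move: h; have -> : 1 + - (1 / 2) = 1 / 2 :> R by lra.
move: (ln _) => x; lra.
Qed.

Lemma ln_half : 1 <= 2 * ln (N%:R : R).
Proof.
apply: le_trans ln2_half _; rewrite ler_pM2l // ler_ln ?posrE ?ltr0n ?ler_nat //; exact: leq_trans N2.
Qed.

Lemma trunc_nat M : (0 < M)%N -> (M <= #|E| * #|X| * N)%N -> (trunc_log 2 M <= 2 * #|X| + trunc_log 2 N)%N.
Proof.
move=> M0 ML; have N0 : (0 < N)%N by exact: leq_trans N2.
have E2 : (#|E| <= 2 ^ #|X|)%N.
  rewrite -cardsT -card_powerset; apply: subset_leq_card; apply/fintype.subsetP => F _.
  by rewrite powersetE finset.subsetT.
have X2 : (#|X| <= 2 ^ #|X|)%N by apply: ltnW; exact: ltn_expl.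
have /andP[_ N3] := trunc_log_bounds (isT : 1 < 2)%N N0.
have /andP[M3 _] := trunc_log_bounds (isT : 1 < 2)%N M0.
rewrite -ltnS -(ltn_exp2l _ _ (isT : 1 < 2)%N); apply: leq_ltn_trans M3 _; apply: leq_ltn_trans ML _.
rewrite -addnS expnD mul2n -addnn expnD; apply: leq_ltn_trans (_ : (2 ^ #|X| * 2 ^ #|X| * N < _)%N).
  by rewrite leq_mul2r leq_mul ?orbT.
by rewrite ltn_pmul2l // muln_gt0 !expn_gt0.
Qed.

Lemma trunc_le M : (0 < M)%N -> (M <= #|E| * #|X| * N)%N ->
  (2 + trunc_log 2 M)%N%:R <= 10 * #|X|%:R * ln (N%:R : R).
Proof.
move=> M0 ML; have N0 : (0 < N)%N by exact: leq_trans N2.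
have tl := trunc_nat M0 ML.
have tN : (trunc_log 2 N)%:R <= 2 * ln (N%:R : R).
  have : ln ((2 ^ trunc_log 2 N)%N%:R : R) <= ln N%:R.
    rewrite ler_ln ?posrE ?ltr0n ?expn_gt0 // ler_nat.
    by have /andP[] := trunc_log_bounds (isT : 1 < 2)%N N0.
  rewrite natrX lnXn // -[ln _ *+ _]mulr_natl => h; have h2 := ln2_half; have t0 : 0 <= (trunc_log 2 N)%:R :> R by [].
  have h3 : 0 <= (trunc_log 2 N)%:R * (2 * ln (2 : R) - 1) by rewrite mulr_ge0 // subr_ge0.
  by rewrite mulrBr mulr1 mulrCA in h3; lra.
have hX : 1 <= #|X|%:R :> R by rewrite ler1n.
have : (2 + trunc_log 2 M)%N%:R <= 2 + (2 * #|X|%:R + (trunc_log 2 N)%:R) :> R.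
  by rewrite -natrM - !natrD ler_nat leq_add2l.
move: tN ln_half hX; move: (ln (N%:R : R)) (#|X|%:R : R) ((trunc_log 2 N)%:R : R) ((2 + trunc_log 2 M)%N%:R : R) => l x t u; nra.
Qed.

Lemma fin_arith (v v2 v4 w1 w2 w3 w4 z e Mm cr o t Q1 Q2 G : R) : v = 100 * w1 -> v2 = 100 * w2 -> v4 = 100 * w4 ->
  2 <= G -> 0 <= w2 -> w2 <= 2 * w1 -> w4 <= 10 * w1 -> Mm <= w2 -> w3 <= w2 -> G <= w2 -> z * 2 <= w2 -> e <= z ->
  o <= 4 * w3 -> t <= 2 * G -> Q1 <= 54 * v2 -> Q2 <= 54 * v2 -> cr <= 10 + 20 * v4 + Q1 + Q2 ->
  22 + 6 * e + Mm * 5 + cr + (5 * o + t * 2) <= 1000 * v.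
Proof. lra. Qed.

Lemma total_arith (l x e Nn Mm t o cr u G Q1 Q2 : R) : u <= 10 * x * l -> 1 <= 2 * l -> 1 <= x -> 1 <= e -> 2 <= Nn ->
  Mm <= e * x * G -> 0 <= Mm -> Nn <= G -> t <= 2 * G -> o <= 4 * x * G ->
  cr <= 10 + 2000 * (Mm * u) + Q1 + Q2 ->
  Q1 <= 2700 * (x * x * e) * (2 * G) -> Q2 <= 2700 * (x * x * e) * (2 * G) ->
  22 + 6 * e + Mm * 5 + cr + (5 * o + t * 2) <= 100 * 100 * 100 * x ^+ 2 * e * G * l.
Proof.
move=> tl lh hX hE hN mM M1 NG TG OG.
have G2 : 2 <= G by lra.
have xx : x <= x * x by rewrite ler_peMl //; lra.
have ze : x * x <= x * x * e by rewrite ler_peMr //; nra.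
set z := x * x * e in ze *.
have xe : e * x <= z by rewrite /z; nra.
have ez : e <= z by apply: le_trans xe; rewrite ler_peMr //; lra.
have z1 : 1 <= z by lra.
have zG : z * 2 <= z * G by rewrite ler_wpM2l //; lra.
have GzG : G <= z * G by rewrite ler_peMl //; lra.
have xG : x * G <= z * G by rewrite ler_wpM2r //; lra.
have MzG : Mm <= z * G by apply: le_trans mM _; rewrite ler_wpM2r //; lra.
have dM : Mm * u <= 10 * (z * G * l).
  have l0 : 0 <= l by lra.
  have x0 : 0 <= x by lra.
  have p : 0 <= 10 * x * l by rewrite !mulr_ge0.
  have e9 : e * x * G * (10 * x * l) = 10 * (z * G * l) by rewrite /z; ring.
  by have h9 := ler_wpM2r p mM; rewrite e9 in h9; apply: le_trans (ler_wpM2l M1 tl) h9.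
have lzG : z * G <= 2 * (z * G * l).
  have p : 0 <= z * G by lra.
  have := ler_wpM2l p lh; rewrite mulr1 => h; apply: le_trans h _; rewrite le_eqVlt; apply/orP; left; apply/eqP; ring.
have gen (k : R) : k * x ^+ 2 * e * G * l = k * (z * G * l) by rewrite /z; ring.
rewrite gen.
have q : 2700 * z * (2 * G) = 5400 * (z * G) by ring.
move=> cc q1 q2; rewrite q in q1 q2.
have e4 : 4 * x * G = 4 * (x * G) by ring.
rewrite e4 in OG.
have gen' (k w : R) : k * k * k * w = k * (k * (k * w)) by rewrite !mulrA.
rewrite gen'.
have G0 : 0 <= G := le_trans (ler0n R 2) G2.
have p2 : 0 <= z * G := le_trans G0 GzG.
have gk (p q' r : nat) (w : R) : p = (q' * r)%N -> p%:R * w = q'%:R * (r%:R * w) by move=> ->; rewrite natrM mulrA.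
have d2 : 5400 * (z * G) <= 54 * (100 * (z * G)) by rewrite (gk 5400 54 100)%N.
have d4 : 2000 * (Mm * u) = 20 * (100 * (Mm * u)) by apply: (gk 2000 20 100)%N.
rewrite d4 in cc.
have big := fin_arith (erefl _) (erefl _) (erefl _) G2 p2 lzG dM MzG xG GzG zG ez OG TG (le_trans q1 d2) (le_trans q2 d2) cc.
apply: (le_trans big); have p1 : 0 <= 100 * (z * G * l).
  rewrite mulr_ge0 // -(@pmulr_rge0 _ 2) //; exact: (le_trans p2 lzG).
by rewrite [leRHS]mulrA ler_wpM2r // -natrM ler_nat.
Qed.

Lemma total_le M T c O (Q1 Q2 G : R) : (0 < M)%N -> (M <= #|E| * #|X| * N)%N ->
  N%:R <= G -> T%:R <= 2 * G -> O%:R <= 4 * #|X|%:R * G ->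
  Q1 <= 2700 * Z * (2 * G) -> Q2 <= 2700 * Z * (2 * G) ->
  c%:R <= (10 + 2000 * (M * (2 + trunc_log 2 M)))%N%:R + Q1 + Q2 ->
  ((22 + 6 * #|E| + M * 5) + c + (5 * O + T * 2))%N%:R <= (100 * 100 * 100)%N%:R * #|X|%:R ^+ 2 * #|E|%:R * G * ln (N%:R : R).
Proof.
move=> M0 ML NG TG OG q1 q2; rewrite natr_total natr_main natr_cube => cc.
have tl := trunc_le M0 ML.
have lh := ln_half.
have hX : 1 <= #|X|%:R :> R by rewrite ler1n.
have hE : 1 <= #|E|%:R :> R by rewrite ler1n.
have hN : 2 <= N%:R :> R by rewrite ler_nat.
have mM : M%:R <= #|E|%:R * #|X|%:R * G :> R.
  apply: le_trans (_ : (#|E| * #|X| * N)%N%:R <= _); first by rewrite ler_nat.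
  by rewrite !natrM ler_wpM2l // mulr_ge0.
have M1 : 0 <= M%:R :> R by [].
have ZE : Z = #|X|%:R * #|X|%:R * #|E|%:R by rewrite !natrM.
rewrite ZE in q1 q2.
exact: (total_arith tl lh hX hE hN mM M1 NG TG OG cc q1 q2).
Qed.
End Cost.

Section Grid.
Local Open Scope ring_scope.
Variable K : numDomainType.

Lemma sum_grid (a m : nat) (f : nat -> K) :
  \sum_(k < a * m) f k = \sum_(i < a) \sum_(j < m) f (i * m + j)%N.
Proof.
elim: a => [|a IH]; first by rewrite !big_ord0.
rewrite big_ord_recr /= -IH mulSnr big_split_ord /=.
by congr (_ + _); apply: eq_bigr.
Qed.

Lemma sum_diag (m : nat) (f : nat -> K) : (forall k, 0 <= f k) ->
  (forall j, (j < m)%N -> f (m * m + j)%N = f (j * m + j)%N) ->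
  \sum_(k < m * m + m) f k <= 2 * \sum_(i < m) \sum_(j < m) f (i * m + j)%N.
Proof.
move=> f0 fd; rewrite big_split_ord /= sum_grid mulr_natl mulr2n lerD2l.
apply: ler_sum => i _; rewrite fd // (bigD1 i) //= lerDl.
by apply: sumr_ge0.
Qed.

Lemma le_sum2 (m : nat) (f : nat -> K) : (forall k, 0 <= f k) -> (0 < m)%N ->
  f 0%N <= \sum_(i < m) \sum_(j < m) f (i * m + j)%N.
Proof.
case: m => // m f0 _; rewrite big_ord_recl [X in X + _]big_ord_recl /= mul0n addn0.
by rewrite -addrA lerDl addr_ge0 // sumr_ge0 // => i _; apply: sumr_ge0.
Qed.
End Grid.

Definition cast_table (R : realType) (X : finType) (L L' : {set X}) (e : L = L') (tb : table R L) : table R L' :=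
  eq_rect L (fun L => table R L) tb L' e.

Lemma cast_tableP (R : realType) (X : finType) (L L' : {set X}) (e : L = L') (tb : table R L)
  (P : forall L, table R L -> Prop) : P L tb -> P L' (cast_table e tb).
Proof. by case: _ / e. Qed.

Section Final.
Variables (R : realType) (X : finType) (E : {set {set X}}).
Hypothesis covE : forall x : X, exists2 F : {set X}, F \in E & x \in F.

Definition good_table (I : Defs.instance R E) (jl : seq (full_tuple R X)) (e : X -> nat) (L : {set X}) (tb : table R L) :=
  [/\ uniq (unzip1 tb), forall z, z \in unzip1 tb <-> exists2 t, Defs.join I t & z = proj_on L t &
   forall z v, (z, v) \in tb -> v = ws jl e z].

Lemma good_table_size I jl e e' (L L' : {set X}) (tb : table R L) (tb' : table R L') :
  L = L' -> good_table I jl e tb -> good_table I jl e' tb' -> size tb = size tb'.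
Proof.
move=> eL; move: tb'; rewrite -eL => tb' [u m _] [u' m' _].
rewrite -(size_map fst tb) -(size_map fst tb'); apply: perm_size; apply: uniq_perm => // z.
by apply/idP/idP => [/m/m'|/m'/m].
Qed.

Lemma join_list (I : Defs.instance R E) : exists jl : seq (full_tuple R X),
  uniq jl /\ (forall t, (t \in jl) <-> Defs.join I t).
Proof.
have [dl udl dlI] := labels_exist I; exists (jlI I dl (size dl)); split.
  by apply: jlI_uniq.
by move=> t; apply: jlI_mem.
Qed.

Lemma represented (L : {set X}) (T : Type) (idx : full_tuple R X -> T) (A : Defs.instance R E -> T -> R) (e : X -> nat) :
  (forall I jl, uniq jl -> (forall t, (t \in jl) <-> Defs.join I t) -> forall t, A I (idx t) = ws jl e (proj_on L t)) ->
  (forall I jl, uniq jl -> (forall t, (t \in jl) <-> Defs.join I t) -> forall p, A I p != 0%R -> exists2 t, Defs.join I t & p = idx t) ->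
  represented_by_faq L idx A.
Proof.
move=> HA HS; exists (fun x r => r ^+ e x)%R => I.
have [jl [u mj]] := join_list I; have [s [us ms vs]] := table_exists mj L e.
exists s; first by split=> // z v zs; rewrite (faq_ws u mj) (vs z v zs).
apply: (@sparse_of R X E I jl L T idx (A I) e s) => //; [exact: (HA I jl u mj)|exact: (HS I jl u mj)].
Qed.

Lemma flat_gt0 (I : Defs.instance R E) : 2 <= max_size I -> 0 < size (flat I).
Proof.
move=> N2; rewrite lt0n; apply/eqP => /size0nil f0; move: N2; rewrite leqNgt => /negP; apply.
rewrite ltnS; apply/bigmax_leqP => F FE; rewrite leqNgt; apply/negP => s2.
have := rel_uniq I FE; have key t : t \in I F -> t = t00 R F.
  by move=> tI; apply/ffunP => u; have := mem_flat u FE tI; rewrite f0.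
case: (I F) s2 key => [|t [|t' l]] // _ key /=; rewrite inE negb_or => /andP[/andP[/eqP tt _] _].
by apply: tt; rewrite (key t (mem_head _ _)) (key t') // in_cons mem_head orbT.
Qed.

Lemma size_flat_le (I : Defs.instance R E) : size (flat I) <= #|E| * #|X| * max_size I.
Proof.
apply: (@leq_trans (\sum_(F in E) #|X| * max_size I)); last by rewrite sum_nat_const mulnA.
rewrite size_flat sumnE big_map big_enum /=; apply: leq_sum => F FE.
by rewrite mulnC leq_mul ?max_card // /max_size (bigD1 F) //= leq_maxl.
Qed.
End Final.

Local Open Scope ring_scope.

Theorem proposition4p4 (R : realType) :
  exists K : nat,
  forall (X : finType) (E : {set {set X}}) (hE : finset.cover E = [set: X]%SET)
    (V C : {set X}) (hC : C \subset V) (y : X) (hy : y \notin C)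
    (m : nat) (a : 'I_m -> X -> nat),
  let Cv := fun j : 'I_m => feat_cats V C (a j) in
  let sigma := fun (i j : 'I_m) (I : instance R E) =>
    sigma_tensor V C (a i) (a j) I in
  let c := fun (j : 'I_m) (I : instance R E) => c_tensor V C y (a j) I in
  [/\ forall i j : 'I_m,
        represented_by_faq (Cv i :|: Cv j)%SET
          (sigma_idx (Cv i) (Cv j)) (sigma i j),
      forall j : 'I_m, represented_by_faq (Cv j) (proj_on (Cv j)) (c j) &
      exists P : prog, forall I : instance R E, (2 <= max_size I)%N ->
      exists (n : nat) (s : state R)
        (ts : forall i j : 'I_m, table R (Cv i :|: Cv j)%SET)
        (tc : forall j : 'I_m, table R (Cv j)),
      [/\ exec P (input_state I) n s,
          forall i j, sparse_rep I (sigma_idx (Cv i) (Cv j)) (sigma i j I) (ts i j)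
            /\ holds_table s (i * m + j) (ts i j),
          forall j, sparse_rep I (proj_on (Cv j)) (c j I) (tc j)
            /\ holds_table s (m * m + j) (tc j) &
          n%:R <= K%:R * #|X|%:R ^+ 2 * #|E|%:R
            * (\sum_(i < m) \sum_(j < m)
                 ((max_size I)%:R `^ faqw R E (Cv i :|: Cv j)%SET
                  + (size (ts i j))%:R))
            * ln ((max_size I)%:R : R)]].
Proof.
exists (100 * 100 * 100)%N => X E hE V C hC y hy m a Cv sigma c.
have covE x : exists2 F : {set X}, F \in E & x \in F.
  have : x \in finset.cover E by rewrite hE inE.
  by move=> /finset.bigcupP[F FE xF]; exists F.
pose es i j x := (exps V C (a i) x + exps V C (a j) x)%N.
pose ec j x := (exps V C (a j) x + (x == y))%N.
split.
- move=> i j; apply: (represented covE (e := es i j)) => I jl u mj.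
    by move=> t; apply: (sigma_ws u mj).
  by move=> p; apply: (sigma_supp u mj).
- move=> j; apply: (represented covE (e := ec j)) => I jl u mj.
    by move=> t; apply: (c_ws u mj).
  by move=> p; apply: (c_supp u mj).
case: (posnP m) => m0.
  have e0 (i : 'I_m) : False by case: i => j; rewrite m0.
  exists Skip => I N2; exists 0%N, (input_state I).
  exists (fun i => match e0 i with end), (fun i => match e0 i with end); split.
  - exact: ExecSkip.
  - by move=> i; case: (e0 i).
  - by move=> i; case: (e0 i).
  - rewrite [X in _ * X * _]big1 ?mulr0 ?mul0r // => i _; case: (e0 i).
pose od : nat -> 'I_m := insubd (Ordinal m0).
have odK (i : 'I_m) : od i = i by rewrite /od valKd.
pose Lk k := if (k < m * m)%N then (Cv (od (k %/ m)%N) :|: Cv (od (k %% m)%N))%SET else Cv (od (k - m * m)%N).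
pose exk k := if (k < m * m)%N then es (od (k %/ m)%N) (od (k %% m)%N) else ec (od (k - m * m)%N).
have lt_ij (i j : 'I_m) : (i * m + j < m * m)%N.
  apply: (@leq_trans (i.+1 * m)); first by rewrite mulSnr ltn_add2l.
  by rewrite leq_mul2r ltn_ord orbT.
have ij (i j : 'I_m) : od ((i * m + j) %/ m)%N = i /\ od ((i * m + j) %% m)%N = j.
  by rewrite divnMDl // divn_small // addn0 modnMDl modn_small // !odK.
have Lij (i j : 'I_m) : Lk (i * m + j)%N = (Cv i :|: Cv j)%SET.
  by rewrite /Lk lt_ij (ij i j).1 (ij i j).2.
have eij (i j : 'I_m) : exk (i * m + j)%N = es i j by rewrite /exk lt_ij (ij i j).1 (ij i j).2.
have Lj (j : 'I_m) : Lk (m * m + j)%N = Cv j by rewrite /Lk ltnNge leq_addr /= addKn odK.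
have ej (j : 'I_m) : exk (m * m + j)%N = ec j by rewrite /exk ltnNge leq_addr /= addKn odK.
pose ok k := sval (cid (good_exists R covE (Lk k) y)).
have gok k N : (2 <= N)%N -> goodo E N (Lk k) (ok k) (N%:R `^ faqw R E (Lk k)) := svalP (cid (good_exists R covE (Lk k) y)) N.
exists (program E Lk exk ok (m * m + m)) => I N2.
set N := max_size I in N2 *.
pose Ak k : R := N%:R `^ faqw R E (Lk k).
have M0 : (0 < size (flat I))%N by exact: flat_gt0.
have sM : size (flat I) = (size (flat I)).-1.+1 by rewrite prednK.
have szN F : F \in E -> (size (I F) <= N)%N by move=> FE; rewrite /N /max_size (bigD1 F) //= leq_maxl.
have [jl [ts [n [s [x1 [u mj] G H [cc [en cb]]]]]]] := @program_ok X E Lk exk ok (m * m + m)%N R I _ sM covE y N Ak szN (fun k => gok k N N2).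
have ltT (i j : 'I_m) : (i * m + j < m * m + m)%N by rewrite ltn_addr.
have ltT' (j : 'I_m) : (m * m + j < m * m + m)%N by rewrite ltn_add2l.
pose t2 (i j : 'I_m) := cast_table (Lij i j) (ts (i * m + j)%N).
pose t1 (j : 'I_m) := cast_table (Lj j) (ts (m * m + j)%N).
have g2 (i j : 'I_m) : good_table I jl (es i j) (t2 i j).
  by apply: (@cast_tableP _ _ _ _ _ _ (fun L tb => good_table I jl (es i j) tb)); rewrite -eij; exact: G.
have g1 (j : 'I_m) : good_table I jl (ec j) (t1 j).
  by apply: (@cast_tableP _ _ _ _ _ _ (fun L tb => good_table I jl (ec j) tb)); rewrite -ej; exact: G.
have s2 (i j : 'I_m) : size (t2 i j) = size (ts (i * m + j)%N).
  exact: (@cast_tableP _ _ _ _ (Lij i j) _ (fun L tb => size tb = size (ts (i * m + j)%N))).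
have s1 (j : 'I_m) : size (t1 j) = size (ts (m * m + j)%N).
  exact: (@cast_tableP _ _ _ _ (Lj j) _ (fun L tb => size tb = size (ts (m * m + j)%N))).
exists n, s, t2, t1; split=> //.
- move=> i j; split.
    have [a1 a2 a3] := g2 i j; apply: (@sparse_of _ _ _ I jl _ _ _ _ (es i j)) => //.
      by move=> t; apply: (sigma_ws u mj).
    by move=> p; apply: (sigma_supp u mj).
  by apply: (@cast_tableP _ _ _ _ _ _ (fun L tb => holds_table s (i * m + j)%N tb)); exact: H.
- move=> j; split.
    have [a1 a2 a3] := g1 j; apply: (@sparse_of _ _ _ I jl _ _ _ _ (ec j)) => //.
      by move=> t; apply: (c_ws u mj).
    by move=> p; apply: (c_supp u mj).
  by apply: (@cast_tableP _ _ _ _ _ _ (fun L tb => holds_table s (m * m + j)%N tb)); exact: H.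
have n0 : (0 < #|X|)%N by apply/card_gt0P; exists y.
have e0 : (0 < #|E|)%N by have [F FE _] := covE y; apply/card_gt0P; exists F.
pose f k : R := Ak k + (size (ts k))%:R.
have NA k : N%:R <= Ak k.
  have N1 : 1 <= N%:R :> R by rewrite ler1n (leq_trans _ N2).
  by rewrite -[leLHS]powRr1 ?ler0n // ler_powR // (faqw_ge1 R covE _ y).
have N1 : 1 <= N%:R :> R by rewrite ler1n (leq_trans _ N2).
have f1 k : 1 <= f k by apply: le_trans N1 _; apply: le_trans (NA k) _; rewrite lerDl.
have f0 k : 0 <= f k by apply: le_trans (f1 k).
set Gs := \sum_(i < m) \sum_(j < m) (_ + _).
have GE : Gs = \sum_(i < m) \sum_(j < m) f (i * m + j)%N.
  by apply: eq_bigr => i _; apply: eq_bigr => j _; rewrite s2 /f; congr (_ + _); rewrite /Ak Lij.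
have fd j : (j < m)%N -> f (m * m + j)%N = f (j * m + j)%N.
  move=> jm; pose j' := Ordinal jm; have LL : Lk (m * m + j')%N = Lk (j' * m + j')%N by rewrite Lj Lij finset.setUid.
  have sz : size (ts (m * m + j')%N) = size (ts (j' * m + j')%N).
    exact: (good_table_size LL (G _ (ltT' j')) (G _ (ltT j' j'))).
  have fj : f (m * m + j')%N = f (j' * m + j')%N.
    by rewrite /f sz /Ak; congr (_ + _); rewrite LL.
  exact: fj.
have SG : \sum_(k < m * m + m) f k <= 2 * Gs by rewrite GE; apply: sum_diag.
have fG : f 0%N <= Gs by rewrite GE; apply: le_sum2.
have Z0 : 0 <= (#|X| * #|X| * #|E|)%N%:R :> R by [].
have c0 : 0 <= 2700 * (#|X| * #|X| * #|E|)%N%:R :> R := mulr_ge0 (ler0n R 2700) (ler0n R _).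
have ML : ((size (flat I)).-1.+1 <= #|E| * #|X| * N)%N by rewrite -sM; exact: size_flat_le.
rewrite en; apply: (total_le n0 e0 N2 (ltn0Sn _) ML _ _ _ _ _ (Q1 := qcost E N 1 13 (Ak 0%N))
   (Q2 := \sum_(k < m * m + m) (12 + qcost E N (size (ts k)) (25 * #|X| + 60) (Ak k)))).
- by apply: le_trans fG; apply: le_trans (NA 0%N) _; rewrite lerDl.
- apply: le_trans SG; have -> : (m * m + m)%N%:R = \sum_(k < m * m + m) (1 : R) by rewrite sumr_const card_ord.
  by apply: ler_sum => k _.
- have -> : 4 * #|X|%:R * Gs = 2 * #|X|%:R * (2 * Gs) by ring.
  apply: le_trans (ler_wpM2l _ SG); last by rewrite mulr_ge0.
  rewrite natr_sum mulr_sumr; apply: ler_sum => k _.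
  apply: (@le_trans _ _ ((2 * #|X| * size (ts k))%N%:R)).
    rewrite ler_nat mulnC leq_mul2r; apply/orP; right.
    by apply: (@leq_trans #|X|.+1); rewrite ?ltnS ?max_card // mul2n -addnn -addn1 leq_add2l.
  by rewrite !natrM ler_wpM2l ?mulr_ge0 // lerDr (le_trans _ (NA k)).
- have h := qcost_le n0 e0 N2 1 (w := 13) (leq_trans (isT : (13 <= 60)%N) (leq_addl (25 * #|X|) 60)) (NA 0%N).
  have A1 : 1 <= Ak 0%N := le_trans N1 (NA 0%N).
  have AG : Ak 0%N <= Gs by apply: le_trans fG; rewrite lerDl.
  have hle : Ak 0%N + 1%:R <= 2 * Gs by rewrite mulr_natl mulr2n; apply: lerD => //; exact: (le_trans A1).
  have q12 : qcost E N 1 13 (Ak 0%N) <= 12 + qcost E N 1 13 (Ak 0%N) by rewrite lerDr.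
  exact: (le_trans q12 (le_trans h (ler_wpM2l c0 hle))).
- have q2 : \sum_(k < m * m + m) (12 + qcost E N (size (ts k)) (25 * #|X| + 60) (Ak k)) <=
      2700 * (#|X| * #|X| * #|E|)%N%:R * \sum_(k < m * m + m) f k.
    by rewrite mulr_sumr; apply: ler_sum => k _; exact: (qcost_le n0 e0 N2 _ (leqnn _) (NA k)).
  exact: (le_trans q2 (ler_wpM2l c0 SG)).
- exact: cb.
Qed.
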